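(* Let $X$ and $Y$ be proper metric spaces, and let $\mathcal{H}_X$ and $\mathcal{H}_Y$ be ample modules for $X$ and $Y$, respectively. If $X$ and $Y$ are coarsely equivalent, then the quasi-local algebra $C^*_q(\mathcal{H}_X)$ is $*$-isomorphic to $C^*_q(\mathcal{H}_Y)$. In particular, for a proper metric space $X$ the quasi-local algebra $C^*_q(\mathcal{H}_X)$ does not depend on the chosen ample $X$-module $\mathcal{H}_X$ up to $*$-isomorphism.
   Context: A metric space is proper if closed bounded subsets are compact. A map $f:X\to Y$ of metric spaces is coarse if preimages of bounded sets are bounded and there is a non-decreasing $\rho_+:[0,\infty)\to[0,\infty)$ with $d_Y(f(x),f(y))\le\rho_+(d_X(x,y))$ for all $x,y$. Two maps $f,g:X\to Y$ are close if $\sup_xd_Y(f(x),g(x))<\infty$. $X$ and $Y$ are coarsely equivalent if there are coarse maps $f:X\to Y$, $g:Y\to X$ with $f\circ g$ and $g\circ f$ close to the identity maps. An $X$-module is a non-degenerate $*$-representation $C_0(X)\to\mathfrak{B}(\mathcal{H}_X)$ on an infinite-dimensional separable Hilbert space; it is ample if no non-zero element of $C_0(X)$ acts as a compact operator. The representation extends to bounded Borel functions; $\chi_A$ denotes the operator of the characteristic function of $A$. $T\in\mathfrak{B}(\mathcal{H}_X)$ is locally compact if $fT$ and $Tf$ are compact for all $f\in C_0(X)$. $T$ is quasi-local if for every $\varepsilon>0$ there is $R>0$ such that $\|\chi_AT\chi_B\|<\varepsilon$ for all Borel $A,B\subseteq X$ with $d_X(A,B)\ge R$. The quasi-local algebra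 $C^*_q(\mathcal{H}_X)$ is the $C^*$-algebra of all locally compact quasi-local operators on $\mathcal{H}_X$. *)

(* Defs.v *)
From HB Require Import structures.
From mathcomp Require Import all_boot all_order all_algebra.
From mathcomp Require Import sesquilinear complex.
From mathcomp Require Import all_classical all_reals all_analysis.

Set Implicit Arguments.
Unset Strict Implicit.
Unset Printing Implicit Defensive.

Import Order.TTheory GRing.Theory Num.Theory.
Import numFieldNormedType.Exports.

Local Open Scope classical_set_scope.
Local Open Scope ring_scope.

Section CoarseGeometry.
Context {R : realType}.

Definition metric_bounded (X : metricType R) (A : set X) : Prop :=
  exists r : R, forall x y, A x -> A y -> mdist x y <= r.

Definition proper_metric (X : metricType R) : Prop :=
  forall A : set X, closed A -> metric_bounded A -> compact A.

(* Extended-real valued, so that the distance to the empty set is +oo. *)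
Definition set_dist (X : metricType R) (A B : set X) : \bar R :=
  ereal_inf [set (mdist p.1 p.2)%:E | p in A `*` B].

(* [rho] encodes a map [0, +oo[ -> [0, +oo[; its values at negative reals
   are irrelevant. *)
Definition coarse_map (X Y : metricType R) (f : X -> Y) : Prop :=
  (forall B : set Y, metric_bounded B -> metric_bounded (f @^-1` B)) /\
  exists rho : R -> R,
    [/\ forall t, 0 <= t -> 0 <= rho t,
        forall s t, 0 <= s -> s <= t -> rho s <= rho t &
        forall x y, mdist (f x) (f y) <= rho (mdist x y)].

Definition close_maps (X Y : metricType R) (f g : X -> Y) : Prop :=
  exists C : R, forall x, mdist (f x) (g x) <= C.

Definition coarsely_equivalent (X Y : metricType R) : Prop :=
  exists (f : X -> Y) (g : Y -> X),
    [/\ coarse_map f, coarse_map g,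
        close_maps (f \o g) idfun & close_maps (g \o f) idfun].

End CoarseGeometry.

(* The inner product is linear in its first argument and conjugate-linear in
   its second one; the norm takes its values in R[i]. *)
Record hilbertSpace (R : realType) := HilbertSpace {
  hilbert_carrier :> completeNormedModType R[i] ;
  inner : {dot hilbert_carrier for @Num.conj R[i]} ;
  inner_norm : forall v : hilbert_carrier, `|v| ^+ 2 = inner v v }.

Section Operators.
Context {R : realType}.

Definition linear_span (V : lmodType R[i]) (S : set V) : set V :=
  [set v | exists n (c : 'I_n -> R[i]) (u : 'I_n -> V),
     (forall i, S (u i)) /\ v = \sum_i c i *: u i].

Definition infinite_dimensional (V : lmodType R[i]) : Prop :=
  forall n (e : 'I_n -> V), linear_span (range e) <> setT.

Definition separable_space (T : topologicalType) : Prop :=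
  exists2 D : set T, countable D & dense D.

Definition bounded_operator (V : normedModType R[i]) (T : V -> V) : Prop :=
  linear T /\ continuous T.

(* [`|T v|] is a nonnegative real element of R[i]. *)
Definition op_norm (V : normedModType R[i]) (T : V -> V) : R :=
  sup [set complex.Re `|T v| | v in [set v : V | `|v| <= 1]].

Definition compact_operator (V : normedModType R[i]) (T : V -> V) : Prop :=
  bounded_operator T /\
  compact (closure (T @` [set v : V | `|v| <= 1])).

(* [S] is the adjoint of [T]. *)
Definition is_adjoint (H : hilbertSpace R) (T S : H -> H) : Prop :=
  forall v w : H, inner H (T v) w = inner H v (S w).

(* *-homomorphism from the function algebra [A] to the bounded operators;
   the values of [phi] outside of [A] are irrelevant. *)
Definition star_representation (X : Type) (H : hilbertSpace R)
    (A : set (X -> R[i])) (phi : (X -> R[i]) -> H -> H) : Prop :=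
  [/\ forall f, A f -> bounded_operator (phi f),
      forall f g, A f -> A g ->
        phi (fun x => f x + g x) = (fun v => phi f v + phi g v),
      forall (c : R[i]) f, A f ->
        phi (fun x => c * f x) = (fun v => c *: phi f v),
      forall f g, A f -> A g ->
        phi (fun x => f x * g x) = phi f \o phi g &
      forall f, A f -> is_adjoint (phi f) (phi (fun x => (f x)^*))].

(* *-isomorphism between *-algebras of operators, given as sets of maps; the
   values of [Phi] outside of [A] are irrelevant. *)
Definition star_isomorphic (H K : hilbertSpace R)
    (A : set (H -> H)) (B : set (K -> K)) : Prop :=
  exists Phi : (H -> H) -> (K -> K),
    [/\ set_bij A B Phi,
        forall S T, A S -> A T ->
          Phi (fun v => S v + T v) = (fun w => Phi S w + Phi T w),
        forall (c : R[i]) T, A T ->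
          Phi (fun v => c *: T v) = (fun w => c *: Phi T w),
        forall S T, A S -> A T -> Phi (S \o T) = Phi S \o Phi T &
        forall T S, A T -> is_adjoint T S -> is_adjoint (Phi T) (Phi S)].

End Operators.

Section FunctionAlgebras.
Context {R : realType} (X : metricType R).

Definition C0 : set (X -> R[i]) :=
  [set f | continuous (f : X -> R[i]^o) /\
     forall eps : R[i], 0 < eps ->
       exists2 K : set X, compact K & forall x, ~ K x -> `|f x| < eps].

Definition borel_set (A : set X) : Prop := <<s @open X >> A.

Definition bounded_borel : set (X -> R[i]) :=
  [set f | (exists M : R[i], forall x, `|f x| <= M) /\
     forall U : set R[i]^o, open U -> borel_set (f @^-1` U)].

End FunctionAlgebras.

Record xmodule (R : realType) (X : metricType R) := XModule {
  mod_space :> hilbertSpace R ;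
  rep : (X -> R[i]) -> mod_space -> mod_space ;
  rep_star : star_representation (@C0 R X) rep ;
  rep_nondegenerate :
    dense (linear_span [set w | exists2 f, C0 f & exists v, w = rep f v]) ;
  mod_infinite : infinite_dimensional mod_space ;
  mod_separable : separable_space mod_space }.
Arguments rep {R X} _ _ _.

Section Modules.
Context {R : realType} (X : metricType R) (H : xmodule X).

Definition ample : Prop :=
  forall f, C0 f -> compact_operator (rep H f) -> f = cst 0.

(* The Borel functional calculus: the extension of the representation to
   bounded Borel functions, characterised by compatibility with bounded
   pointwise limits of sequences. *)
Definition borel_extension : set ((X -> R[i]) -> H -> H) :=
  [set phi |
    [/\ star_representation (@bounded_borel R X) phi,
        forall f, C0 f -> phi f = rep H f &
        forall (f_ : nat -> X -> R[i]) (f : X -> R[i]) (M : R[i]),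
          (forall n, bounded_borel (f_ n)) ->
          (forall n x, `|f_ n x| <= M) ->
          (forall x, (f_ n x : R[i]^o) @[n --> \oo] --> (f x : R[i]^o)) ->
          forall v, phi (f_ n) v @[n --> \oo] --> phi f v]].

(* For proper [X] the extension exists, and its values on bounded Borel
   functions are unique, so the default value of [xget] plays no role. *)
Definition borel_rep : (X -> R[i]) -> H -> H :=
  xget (fun _ _ => 0) borel_extension.

Definition chi (A : set X) : H -> H := borel_rep \1_A.

Definition locally_compact_operator (T : H -> H) : Prop :=
  forall f, C0 f ->
    compact_operator (rep H f \o T) /\ compact_operator (T \o rep H f).

Definition quasi_local (T : H -> H) : Prop :=
  forall eps : R, 0 < eps -> exists2 r : R, 0 < r &
    forall A B : set X, borel_set A -> borel_set B ->
      (r%:E <= set_dist A B)%E -> op_norm (chi A \o T \o chi B) < eps.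

Definition quasi_local_algebra : set (H -> H) :=
  [set T | [/\ bounded_operator T, locally_compact_operator T
             & quasi_local T]].

End Modules.
Arguments borel_extension {R X} H _.
Arguments borel_rep {R X} H _ _.
Arguments chi {R X} H A _.
Arguments locally_compact_operator {R X} H T.
Arguments quasi_local {R X} H T.
Arguments quasi_local_algebra {R X} H _.

(* Main.v *)
(* A coarse equivalence [f : X -> Y] yields Borel partitions [(A_i)] of [X] and
   [(B_i)] of [Y], with the same index set, into uniformly bounded blocks of
   non-empty interior such that [f A_i] stays at bounded distance from [B_i]:
   take a separated net [(y_i)] of [Y] and the Voronoi-like cells around the
   points [y_i] and [g y_i].  By ampleness the ranges of [chi A_i] and [chi B_i]
   are all infinite-dimensional, so there is a unitary [V] from [H_X] to [H_Y]
   that intertwines [chi A_i] and [chi B_i] for every [i].  Conjugation by [V]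
   displaces supports by a bounded amount only, hence preserves local
   compactness and quasi-locality.

   The projections [chi A] come from the Borel functional calculus, whose
   existence is proved without the Riesz representation theorem.  For a vector
   [v] and an open set [U], the supremum [c_v U] of [|rho h v|], over the
   continuous [0 <= h <= 1] vanishing off [U], is countably subadditive and inner
   regular.  Every bounded Borel function [f] is uniformly close to C0 functions
   off open sets of small capacity [c_v], and [phi f v] is the limit of the
   vectors [rho g v] over these approximations [g]; Egorov's theorem for the
   capacity gives the compatibility with bounded pointwise limits. *)
Require Import Defs.
From mathcomp Require Import all_boot all_order all_algebra.
From mathcomp Require Import sesquilinear complex.
From mathcomp Require Import all_classical all_reals all_analysis.
From mathcomp Require Import ring lra.

Set Implicit Arguments.
Unset Strict Implicit.
Unset Printing Implicit Defensive.

Import Order.TTheory GRing.Theory Num.Theory.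
Import numFieldNormedType.Exports.

Local Open Scope classical_set_scope.
Local Open Scope ring_scope.

(** * Norms, inner products and bounded operators *)

(** On open sets the capacity [c_v] is the square root of the spectral measure of [v]. Using norms
    instead of their squares turns subadditivity into the triangle inequality, while Pythagoras for
    functions with disjoint supports yields inner regularity. The price is that [phi f v] is
    approximated for each [v] separately, so an identity relating several vectors needs one
    approximation that is good for all of them; sums of capacities provide it.

    Quasi-locality is tested on Borel sets of arbitrary shape. Each such set is enlarged to the
    union of the blocks it meets, possibly infinitely many, so [V] has to intertwine the projections
    of all unions of blocks at once; this is why [V] comes from bases adapted to the partitions. Two
    opposite demands shape the blocks: uniform boundedness, so that the enlargement changes
    distances by a bounded amount, and a ball of fixed radius inside each, so that ampleness
    applies. The net in [Y] must therefore be so sparse that its image under [g] is still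
    separated. *)

Section RealNorm.
Context {R : realType}.
Local Notation toC := (real_complex R).

(* The norm of [V] takes its values in [R[i]]; [nrm] is the same number in [R]. *)
Definition nrm (V : normedZmodType R[i]) (v : V) : R := complex.Re `|v|.

Lemma nrmE (V : normedZmodType R[i]) (v : V) : `|v| = toC (nrm v).
Proof. by rewrite /nrm RRe_real// ger0_real. Qed.

Section Zmod.
Context {V : normedZmodType R[i]}.
Implicit Types u v w : V.

Lemma nrm_ge0 v : 0 <= nrm v.
Proof. by rewrite -lecR -nrmE normr_ge0. Qed.

Lemma nrm0 : nrm (0 : V) = 0.
Proof. by rewrite /nrm normr0. Qed.

Lemma nrm0_eq0 v : nrm v = 0 -> v = 0.
Proof. by move=> v0; apply/normr0_eq0; rewrite nrmE v0. Qed.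

Lemma nrmD u v : nrm (u + v) <= nrm u + nrm v.
Proof. by rewrite -lecR rmorphD/= -!nrmE ler_normD. Qed.

Lemma nrmN v : nrm (- v) = nrm v.
Proof. by rewrite /nrm normrN. Qed.

Lemma nrmB u v : nrm (u - v) <= nrm u + nrm v.
Proof. by rewrite -(nrmN v) nrmD. Qed.

Lemma nrmC u v : nrm (u - v) = nrm (v - u).
Proof. by rewrite -nrmN opprB. Qed.

Lemma nrm_triangle w u v : nrm (u - v) <= nrm (u - w) + nrm (w - v).
Proof. by rewrite -{1}(subrK w u) -addrA nrmD. Qed.

Lemma nrm_sub_ge u v : nrm u - nrm v <= nrm (u - v).
Proof. by rewrite lerBlDr -{1}(subrK v u) nrmD. Qed.

Lemma nrm_leP v (r : R) : (`|v| <= toC r) = (nrm v <= r).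
Proof. by rewrite nrmE lecR. Qed.

Lemma nrm_ltP v (r : R) : (`|v| < toC r) = (nrm v < r).
Proof. by rewrite nrmE ltcR. Qed.

Lemma nrm_le1 v : (`|v| <= 1) = (nrm v <= 1).
Proof. by rewrite -(rmorph1 toC) nrm_leP. Qed.

Lemma le_eps_nrm0 v : (forall e : R, 0 < e -> nrm v <= e) -> v = 0.
Proof.
move=> h; apply: nrm0_eq0; apply/eqP; rewrite eq_le nrm_ge0 andbT.
by apply/ler_addgt0Pl => e e0; rewrite addr0 h.
Qed.

End Zmod.

Lemma posC (e : R[i]) : 0 < e -> exists2 r : R, 0 < r & e = toC r.
Proof.
move=> e0; have e_real : toC (complex.Re e) = e by rewrite RRe_real// gtr0_real.
by exists (complex.Re e); rewrite ?e_real// -ltcR e_real.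
Qed.

Lemma nrmM (a b : R[i]) : nrm (a * b) = nrm a * nrm b.
Proof. by apply: (@complexI R); rewrite rmorphM/= -!nrmE normrM. Qed.

Lemma nrm_toC (a : R) : nrm (toC a) = `|a|.
Proof. by rewrite /nrm normc_def/= expr0n addr0 sqrtr_sqr. Qed.

Lemma nrm_conj (a : R[i]) : nrm a^* = nrm a.
Proof. by rewrite /nrm norm_conjC. Qed.

Lemma conj_toC (a : R) : (toC a)^* = toC a.
Proof. by rewrite conj_Creal// complex_real. Qed.

Lemma mul_conjE (a : R[i]) : a * a^* = toC (nrm a ^+ 2).
Proof. by rewrite -normCK nrmE rmorphXn. Qed.

Lemma nrm_Re (a : R[i]) : `|complex.Re a| <= nrm a.
Proof. by rewrite -lecR -nrmE normc_ge_Re. Qed.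

Lemma nrm_Im (a : R[i]) : `|complex.Im a| <= nrm a.
Proof.
rewrite -lecR -nrmE normc_def lecR -sqrtr_sqr ler_wsqrtr//.
by rewrite lerDr sqr_ge0.
Qed.

Lemma nrm_ReIm (a : R[i]) : nrm a <= `|complex.Re a| + `|complex.Im a|.
Proof.
have -> : a = toC (complex.Re a) + 'i%C * toC (complex.Im a) by rewrite -complexE.
rewrite (le_trans (nrmD _ _))// nrm_toC nrmM nrm_toC.
have -> : nrm ('i%C : R[i]) = 1 by rewrite /nrm normc_def/= expr0n add0r expr1n sqrtr1.
by rewrite mul1r -complexE.
Qed.

Lemma nrmZ (V : normedModType R[i]) (c : R[i]) (v : V) :
  nrm (c *: v) = nrm c * nrm v.
Proof. by apply: (@complexI R); rewrite rmorphM/= -!nrmE normrZ. Qed.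

Section Convergence.
Context {V : normedModType R[i]}.

Lemma cvg_nrmP (u : nat -> V) (l : V) :
  u n @[n --> \oo] --> l <->
  forall e : R, 0 < e -> exists N, forall n, (N <= n)%N -> nrm (u n - l) < e.
Proof.
split=> [/cvgrPdist_lt ul e e0|ul].
  have /ul [N _ Nul] : 0 < toC e by rewrite ltcR.
  by exists N => n Nn; rewrite nrmC -nrm_ltP; exact: Nul.
apply/cvgrPdist_lt => _ /posC [e e0 ->]; have [N Nul] := ul _ e0.
by exists N => // n Nn; rewrite /= nrm_ltP nrmC; exact: Nul.
Qed.

Lemma continuous_nrmP (W : normedModType R[i]) (T : V -> W) :
  (exists2 C : R, 0 <= C & forall u v, nrm (T u - T v) <= C * nrm (u - v)) ->
  continuous T.
Proof.
move=> [C C0 TC] v; apply/cvgrPdist_lt => _ /posC [e e0 ->].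
have C1 : 0 < C + 1 by rewrite ltr_wpDl.
near_simpl; apply/nbhs_ballP; exists (toC (e / (C + 1))) => [|w]/=.
  by rewrite ltcR divr_gt0.
rewrite -ball_normE/= !nrm_ltP => vw; rewrite (le_lt_trans (TC _ _))//.
rewrite (@le_lt_trans _ _ ((C + 1) * nrm (v - w)))//.
  by rewrite ler_wpM2r ?nrm_ge0// lerDl.
by rewrite mulrC -ltr_pdivlMr.
Qed.

Lemma closure_nrmP (A : set V) (v : V) :
  closure A v <-> forall e : R, 0 < e -> exists2 a, A a & nrm (a - v) < e.
Proof.
split=> [Av e e0|Av B].
  have /Av [a [Aa]] : nbhs v (ball v (toC e)) by apply: nbhsx_ballx; rewrite ltcR.
  by rewrite -ball_normE/= nrm_ltP nrmC; exists a.
move/nbhs_ballP => -[_ /= /posC [e e0 ->]] eB.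
have [a Aa ae] := Av _ e0; exists a; split=> //; apply: eB.
by rewrite -ball_normE/= nrm_ltP nrmC.
Qed.

Lemma dense_nrmP (A : set V) :
  dense A <-> forall v (e : R), 0 < e -> exists2 a, A a & nrm (a - v) < e.
Proof.
split=> [dA v e e0|Ad O [v Ov] oO].
  have [||a [va Aa]] := dA (ball v (toC e)).
  - by exists v; apply: ballxx; rewrite ltcR.
  - by apply: ball_open; rewrite ltcR.
  - by exists a => //; move: va; rewrite -ball_normE/= nrm_ltP nrmC.
have /nbhs_ballP [_ /= /posC [e e0 ->] eO] : nbhs v O by exact: open_nbhs_nbhs.
have [a Aa ae] := Ad v e e0; exists a; split=> //; apply: eO.
by rewrite -ball_normE/= nrm_ltP nrmC.
Qed.

End Convergence.

Lemma complete_nrmP (V : completeNormedModType R[i]) (u : nat -> V) :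
  (forall e : R, 0 < e ->
    exists N, forall m n, (N <= m)%N -> (N <= n)%N -> nrm (u m - u n) < e) ->
  exists l : V, u n @[n --> \oo] --> l.
Proof.
move=> u_cauchy; have cu : cauchy (u n @[n --> \oo]).
  apply: cauchy_exP => _ /posC [e e0 ->].
  have [N Nu] := u_cauchy _ e0; exists (u N); exists N => // n Nn.
  by rewrite /= -ball_normE/= nrm_ltP; exact: Nu.
by exists (lim (u n @[n --> \oo])); exact: cauchy_cvg cu.
Qed.

Lemma cvg_nrm_unique (V : normedModType R[i]) (u : nat -> V) (l l' : V) :
  u n @[n --> \oo] --> l -> u n @[n --> \oo] --> l' -> l = l'.
Proof. by move=> ul ul'; exact: (cvg_unique (@norm_hausdorff _ _) ul ul'). Qed.

Section LinearMaps.
Context {V W : normedModType R[i]} (T : V -> W).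
Hypothesis Tlin : linear T.

Lemma linB u v : T (u - v) = T u - T v.
Proof. by rewrite addrC -scaleN1r Tlin scaleN1r addrC. Qed.

Lemma lin0 : T 0 = 0.
Proof. by rewrite -(subrr 0) linB subrr. Qed.

Lemma linZ c v : T (c *: v) = c *: T v.
Proof. by rewrite -[c *: v]addr0 Tlin lin0 addr0. Qed.

Lemma linD u v : T (u + v) = T u + T v.
Proof. by rewrite -[u]scale1r Tlin !scale1r. Qed.

Lemma lin_sum (I : Type) (s : seq I) (P : pred I) (F : I -> V) :
  T (\sum_(i <- s | P i) F i) = \sum_(i <- s | P i) T (F i).
Proof.
by elim/big_rec2 : _ => [|i x y _ <-]; rewrite ?lin0 ?linD.
Qed.

Lemma lin_bound_continuous (C : R) :
  0 <= C -> (forall v, nrm (T v) <= C * nrm v) -> continuous T.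
Proof.
by move=> C0 TC; apply: continuous_nrmP; exists C => // u v; rewrite -linB.
Qed.

Lemma lin_continuous_bound :
  continuous T -> exists2 C : R, 0 < C & forall v, nrm (T v) <= C * nrm v.
Proof.
move=> /(_ 0) /cvgrPdist_lt /(_ 1 ltr01); rewrite lin0.
move=> /nbhs_ballP [_ /= /posC [e e0 ->]] eT.
have small v : nrm v < e -> nrm (T v) < 1.
  move=> ve; rewrite -(nrmN (T v)) -sub0r -nrm_ltP; apply: eT.
  by rewrite -ball_normE/= nrm_ltP sub0r nrmN.
(* Continuity at 0 sends vectors of norm below [e] into the unit ball; [v] is rescaled to norm
   [e / 2]. *)
exists (2 / e); first by rewrite divr_gt0.
move=> v; have [v0|v0] := eqVneq (nrm v) 0.
  by rewrite (nrm0_eq0 v0) lin0 !nrm0 mulr0.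
have vpos : 0 < nrm v by rewrite lt_neqAle eq_sym v0 nrm_ge0.
have := small (toC (e / 2 / nrm v) *: v); rewrite linZ !nrmZ nrm_toC.
have ge0 : 0 <= e / 2 / nrm v by rewrite !divr_ge0// ltW.
rewrite (ger0_norm ge0) divfK// => /(_ _)/wrap[].
  by rewrite ltr_pdivrMr// ltr_pMr// ltr1n.
rewrite mulrAC ltr_pdivrMr// mul1r => /ltW h.
rewrite -ler_pdivrMl ?divr_gt0// invf_div mulrC.
by rewrite mulrC.
Qed.

End LinearMaps.

Section Hilbert.
Context {H : hilbertSpace R}.
Implicit Types u v w : H.
Local Notation "'[ u , v ]" := (inner H u v).

Lemma innerDl u v w : '[u + v, w] = '[u, w] + '[v, w].
Proof. exact: linearDl. Qed.
Lemma innerDr u v w : '[u, v + w] = '[u, v] + '[u, w].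
Proof. exact: linearDr. Qed.
Lemma innerBl u v w : '[u - v, w] = '[u, w] - '[v, w].
Proof. exact: linearBl. Qed.
Lemma innerBr u v w : '[u, v - w] = '[u, v] - '[u, w].
Proof. exact: linearBr. Qed.
Lemma inner0l v : '[0, v] = 0.
Proof. exact: linear0l. Qed.
Lemma inner0r v : '[v, 0] = 0.
Proof. exact: linear0r. Qed.
Lemma innerZl c u v : '[c *: u, v] = c * '[u, v].
Proof. exact: linearZl_LR. Qed.
Lemma innerZr c u v : '[u, c *: v] = c^* * '[u, v].
Proof. by rewrite linearZr_LR. Qed.
Lemma inner_suml (I : Type) (s : seq I) (P : pred I) (F : I -> H) v :
  '[\sum_(i <- s | P i) F i, v] = \sum_(i <- s | P i) '[F i, v].
Proof. exact: linear_sumlz. Qed.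
Lemma innerC u v : '[u, v] = '[v, u]^*.
Proof. by rewrite hermC/= expr0 mul1r. Qed.

Lemma inner_nrm v : '[v, v] = toC (nrm v ^+ 2).
Proof. by rewrite -inner_norm nrmE rmorphXn. Qed.

Lemma nrmD_orth u v : '[u, v] = 0 -> nrm (u + v) ^+ 2 = nrm u ^+ 2 + nrm v ^+ 2.
Proof.
move=> uv; apply: (@complexI R); rewrite rmorphD/= -!inner_nrm innerDl !innerDr.
by rewrite uv (innerC v u) uv conjC0 addr0 add0r.
Qed.

Lemma Cauchy_Schwarz u v : nrm '[u, v] <= nrm u * nrm v.
Proof.
have [v0|v0] := eqVneq (nrm v) 0.
  by rewrite (nrm0_eq0 v0) inner0r !nrm0 mulr0.
have vpos : 0 < nrm v by rewrite lt_neqAle eq_sym v0 nrm_ge0.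
(* [c *: v] is the orthogonal projection of [u] onto the line of [v], and Pythagoras bounds its norm
   by that of [u]. *)
pose c := '[u, v] / toC (nrm v ^+ 2).
have c_orth : '[c *: v, u - c *: v] = 0.
  rewrite innerC innerBl !innerZr !innerZl inner_nrm /c divfK ?subrr ?mulr0 ?conjC0//.
  by rewrite (inj_eq (@complexI R) _ 0) expf_eq0.
have := nrmD_orth c_orth; rewrite addrC subrK nrmZ exprMn => uE.
have : (nrm c * nrm v) ^+ 2 <= nrm u ^+ 2 by rewrite uE exprMn lerDl sqr_ge0.
rewrite ler_sqr ?nnegrE ?mulr_ge0 ?nrm_ge0// /c nrmM.
have -> : nrm ((toC (nrm v ^+ 2))^-1) = (nrm v ^+ 2)^-1.
  by rewrite -fmorphV nrm_toC ger0_norm// invr_ge0 sqr_ge0.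
by rewrite expr2 invfM mulrA mulrAC divfK// ler_pdivrMr.
Qed.

Lemma inner_ext u v : (forall w, '[u, w] = '[v, w]) -> u = v.
Proof.
move=> uv; apply/eqP; rewrite -subr_eq0; apply/eqP/nrm0_eq0.
have : '[u - v, u - v] = 0 by rewrite innerBl uv subrr.
by rewrite inner_nrm => /(@complexI R _ 0) /eqP; rewrite sqrf_eq0 => /eqP.
Qed.

Lemma inner_cvg (u : nat -> H) v w :
  u n @[n --> \oo] --> v -> ('[u n, w] : R[i]^o) @[n --> \oo] --> ('[v, w] : R[i]^o).
Proof.
move=> /cvg_nrmP uv; apply/cvg_nrmP => e e0.
have w1 : 0 < nrm w + 1 by rewrite ltr_wpDl ?nrm_ge0.
have [N Nu] := uv (e / (nrm w + 1)) (divr_gt0 e0 w1).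
exists N => n /Nu; rewrite ltr_pdivlMr// => le_e.
rewrite -innerBl (le_lt_trans (Cauchy_Schwarz _ _))// (le_lt_trans _ le_e)//.
by rewrite ler_wpM2l ?nrm_ge0// lerDl.
Qed.

End Hilbert.

Section OperatorNorm.
Context {V : normedModType R[i]} (T : V -> V).

Lemma op_norm_le (C : R) :
  0 <= C -> linear T -> (forall v, nrm (T v) <= C * nrm v) -> op_norm T <= C.
Proof.
move=> C0 Tlin TC; apply: ge_sup.
  by exists 0; exists 0 => /=; rewrite ?(lin0 Tlin) normr0.
move=> _ [v /= v1 <-]; rewrite (le_trans (TC v))// ler_piMr//.
by rewrite -nrm_le1.
Qed.

Lemma op_norm_ge (v : V) :
  bounded_operator T -> nrm (T v) <= op_norm T * nrm v.
Proof.
move=> [Tlin Tcont]; have [C C0 TC] := lin_continuous_bound Tlin Tcont.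
have [v0|v0] := eqVneq (nrm v) 0.
  by rewrite (nrm0_eq0 v0) (lin0 Tlin) !nrm0 mulr0.
have vpos : 0 < nrm v by rewrite lt_neqAle eq_sym v0 nrm_ge0.
rewrite -ler_pdivrMr//; apply: ub_le_sup.
  exists C => _ [w /= w1 <-]; rewrite (le_trans (TC w))// ler_piMr//; first exact: ltW.
  by rewrite -nrm_le1.
exists (toC (nrm v)^-1 *: v) => /=.
  by rewrite nrm_le1 nrmZ nrm_toC ger0_norm ?invr_ge0 ?nrm_ge0// mulVf.
rewrite (linZ Tlin) -/(nrm _) nrmZ nrm_toC ger0_norm ?invr_ge0 ?nrm_ge0//.
by rewrite mulrC.
Qed.

End OperatorNorm.

End RealNorm.

(** * Functions vanishing at infinity *)

Lemma continuous_maxr {R : realType} {T : topologicalType} (f g : T -> R) :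
  continuous f -> continuous g -> continuous (fun x => Num.max (f x) (g x)).
Proof. by move=> fc gc x; exact: (@continuous_max R T f g x (fc x) (gc x)). Qed.

Lemma continuous_minr {R : realType} {T : topologicalType} (f g : T -> R) :
  continuous f -> continuous g -> continuous (fun x => Num.min (f x) (g x)).
Proof. by move=> fc gc x; exact: (@continuous_min R T f g x (fc x) (gc x)). Qed.

Lemma compact_bigcup_lt {X : topologicalType} (K : set X) (U : nat -> set X) :
  compact K -> (forall n, open (U n)) -> K `<=` \bigcup_n U n ->
  exists N, K `<=` \bigcup_(n < N) U n.
Proof.
move=> /compact_near_coveringP cK oU KU.
have [|N _ NK] := cK nat \oo (fun N x => exists2 n, (n < N)%N & U n x) _.
  move=> x /KU [n _ Unx]; exists (U n, [set N | (n < N)%N]).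
    split; last by exists n.+1.
    by apply: open_nbhs_nbhs; split; [exact: oU|].
  by move=> [y N] /= [Uny nN]; exists n.
by exists N => x /(NK N (leqnn N)) [n nN Unx]; exists n.
Qed.

Section C0Functions.
Context {R : realType} {X : metricType R}.
Local Notation toC := (real_complex R).
Implicit Types (f g : X -> R[i]) (u w : X -> R).

Lemma continuousCP f :
  continuous (f : X -> R[i]^o) <->
  forall x (e : R), 0 < e -> \forall y \near x, nrm (f y - f x) < e.
Proof.
split=> [fc x e e0|fc x].
  have /cvgrPdist_lt /(_ (toC e)) := fc x; rewrite ltcR => /(_ e0).
  by apply: filterS => y; rewrite nrm_ltP nrmC.
apply/cvgrPdist_lt => _ /posC [e e0 ->].
by apply: filterS (fc x e e0) => y; rewrite nrm_ltP nrmC.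
Qed.

Lemma continuous_mdist (x0 : X) : continuous (mdist x0).
Proof.
move=> x; apply/cvgrPdist_lt => e e0.
have : nbhs x (ball x e) by exact: nbhsx_ballx.
apply: filterS => y; rewrite ballEmdist/= => xy.
rewrite (le_lt_trans _ xy)// ler_norml lerBlDr lerBrDr.
have := metric_triangle x0 x y; have := metric_triangle x0 y x.
by rewrite (metric_sym y x) => *; apply/andP; split; lra.
Qed.

(** Real counterpart of [C0]: positivity, square roots and truncation are used on real functions,
    which [toC] then feeds to the representation. *)
Definition C0r u : Prop :=
  continuous u /\ forall e : R, 0 < e ->
    exists2 K : set X, compact K & forall x, ~ K x -> `|u x| < e.

Lemma C0_nrmP f :
  C0 f <-> continuous (f : X -> R[i]^o) /\ C0r (fun x => nrm (f x)).
Proof.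
split=> [[fc f0]|[fc [_ f0]]].
  split=> //; split=> [x|e e0].
    apply/cvgrPdist_lt => e e0; have /continuousCP /(_ x e e0) := fc.
    apply: filterS => y; apply: le_lt_trans.
    have := nrm_sub_ge (f x) (f y); have := nrm_sub_ge (f y) (f x).
    by rewrite (nrmC (f x)) ler_norml => *; apply/andP; split; lra.
  have [|K cK Kf] := f0 (toC e); first by rewrite ltcR.
  by exists K => // x /Kf; rewrite nrm_ltP ger0_norm ?nrm_ge0.
split=> // _ /posC [e e0 ->]; have [K cK Kf] := f0 e e0.
by exists K => // x /Kf; rewrite nrm_ltP ger0_norm ?nrm_ge0.
Qed.

Lemma C0r_dominated u w :
  continuous u -> C0r w -> (forall x, `|u x| <= `|w x|) -> C0r u.
Proof.
move=> uc [_ w0] uw; split=> // e /w0 [K cK Kw].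
by exists K => // x /Kw; apply: le_lt_trans.
Qed.

Lemma C0_dominated f w :
  continuous (f : X -> R[i]^o) -> C0r w -> (forall x, nrm (f x) <= `|w x|) ->
  C0 f.
Proof.
move=> fc [_ w0] fw; split=> // _ /posC [e e0 ->]; have [K cK Kw] := w0 _ e0.
by exists K => // x /Kw; rewrite nrm_ltP; apply: le_lt_trans.
Qed.

Lemma C0r_scale (c : R) u : C0r u -> C0r (fun x => c * u x).
Proof.
move=> [uc u0]; split=> [x|e e0]; first by apply: cvgM; [exact: cvg_cst|exact: uc].
have c1 : 0 < `|c| + 1 by rewrite ltr_wpDl.
have [K cK Ku] := u0 _ (divr_gt0 e0 c1); exists K => // x /Ku.
rewrite ltr_pdivlMr// normrM; apply: le_lt_trans.
by rewrite mulrC ler_wpM2l// lerDl.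
Qed.

Lemma C0rD u w : C0r u -> C0r w -> C0r (fun x => u x + w x).
Proof.
move=> [uc u0] [wc w0]; split=> [x|e e0]; first exact: cvgD (uc x) (wc x).
have e2 : 0 < e / 2 by rewrite divr_gt0.
have [K cK Ku] := u0 _ e2; have [L cL Lw] := w0 _ e2.
exists (K `|` L); first exact: compactU.
move=> x /not_orP [/Ku xu /Lw xw]; rewrite (splitr e).
by rewrite (le_lt_trans (ler_normD _ _))// ltrD.
Qed.

Lemma C0_cst0 : C0 (fun _ : X => 0 : R[i]).
Proof.
split; first exact: cst_continuous.
by move=> e e0; exists set0; [exact: compact0|move=> x _; rewrite normr0].
Qed.

Lemma C0r_cst0 : C0r (fun _ : X => 0).
Proof.
split; first exact: cst_continuous.
by move=> e e0; exists set0; [exact: compact0|move=> x _; rewrite normr0].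
Qed.

Lemma C0D f g : C0 f -> C0 g -> C0 (fun x => f x + g x).
Proof.
move=> /C0_nrmP [fc f0] /C0_nrmP [gc g0].
apply: (C0_dominated _ (C0rD f0 g0)) => [x|x]; first exact: cvgD (fc x) (gc x).
by rewrite ger0_norm ?addr_ge0 ?nrm_ge0// nrmD.
Qed.

Lemma C0_bounded f : C0 f -> exists2 M : R, 0 <= M & forall x, nrm (f x) <= M.
Proof.
move=> /C0_nrmP [_ [fc f0]]; have [K cK Kf] := f0 1 ltr01.
have : compact ((fun x => nrm (f x)) @` K).
  by apply: continuous_compact => //; exact: continuous_subspaceT.
move=> /compact_bounded [M [_ Mf]].
exists (`|M| + 1) => [|x]; first by rewrite addr_ge0.
have [Kx|/Kf/ltW] := pselect (K x).
  have M1 : M < `|M| + 1 by rewrite (le_lt_trans (ler_norm _))// ltrDl.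
  have := Mf _ M1 (nrm (f x)); rewrite /= ger0_norm ?nrm_ge0//; apply.
  by exists x.
by rewrite ger0_norm ?nrm_ge0// => /le_trans; apply; rewrite lerDr.
Qed.

Lemma C0_bounded_mul f g (M : R) :
  continuous (f : X -> R[i]^o) -> (forall x, nrm (f x) <= M) -> C0 g ->
  C0 (fun x => f x * g x).
Proof.
move=> fc fM /C0_nrmP [gc g0].
apply: (C0_dominated _ (C0r_scale M g0)) => [x|x]; first exact: cvgM (fc x) (gc x).
by rewrite normrM nrmM ler_pM ?nrm_ge0// ?(le_trans (fM x)) ?ler_norm.
Qed.

Lemma C0M f g : C0 f -> C0 g -> C0 (fun x => f x * g x).
Proof.
by move=> f0 g0; have [M _ fM] := C0_bounded f0; exact: C0_bounded_mul f0.1 fM g0.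
Qed.

Lemma C0Z (c : R[i]) f : C0 f -> C0 (fun x => c * f x).
Proof.
move=> f0; apply: (@C0_bounded_mul (fun _ : X => c) f (nrm c)) => //.
exact: cst_continuous.
Qed.

Lemma C0N f : C0 f -> C0 (fun x => - f x).
Proof. by move=> /(C0Z (-1)); under eq_fun do rewrite mulN1r. Qed.

Lemma C0B f g : C0 f -> C0 g -> C0 (fun x => f x - g x).
Proof. by move=> f0 /C0N; exact: C0D. Qed.

Lemma C0_conj f : C0 f -> C0 (fun x => (f x)^*).
Proof.
move=> /C0_nrmP [/continuousCP fc f0].
apply: (C0_dominated _ f0) => [|x]; last by rewrite nrm_conj ler_norm.
apply/continuousCP => x e e0; apply: filterS (fc x e e0) => y.
by rewrite -rmorphB nrm_conj.
Qed.

Lemma continuous_toC u : continuous u -> continuous (fun x => toC (u x) : R[i]^o).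
Proof.
move=> uc; apply/continuousCP => x e e0.
have /cvgrPdist_lt /(_ e e0) := uc x; apply: filterS => y.
by rewrite -rmorphB/= nrm_toC distrC.
Qed.

Lemma C0_toC u : C0r u -> C0 (fun x => toC (u x)).
Proof.
move=> u0; apply: (C0_dominated _ u0) => [|x]; last by rewrite nrm_toC.
exact: continuous_toC u0.1.
Qed.

Lemma C0r_comp (F : R -> R) u :
  continuous F -> F 0 = 0 -> C0r u -> C0r (fun x => F (u x)).
Proof.
move=> Fc F0 [uc u0]; split=> [x|e e0].
  by apply: continuous_comp; [exact: uc|exact: Fc].
have /cvgrPdist_lt /(_ e e0) := Fc 0; rewrite F0 => /nbhs_ballP [d /= d0 dF].
have [K cK Ku] := u0 d d0; exists K => // x /Ku ud.
have := dF (u x); rewrite /= sub0r normrN; apply.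
by rewrite -ball_normE/= sub0r normrN.
Qed.

Lemma C0r_threshold (d : R) u :
  0 <= d -> C0r u -> C0r (fun x => Num.max 0 (u x - d)).
Proof.
move=> d0 u0; apply: (@C0r_comp (fun t => Num.max 0 (t - d))) => //.
  apply: continuous_maxr => t; first exact: cvg_cst.
  by apply: cvgB; [exact: cvg_id|exact: cvg_cst].
by rewrite sub0r; apply/max_idPl; rewrite oppr_le0.
Qed.

Lemma C0r_level_compact (d : R) u :
  0 < d -> C0r u -> compact [set x | d <= u x].
Proof.
move=> d0 [uc u0]; have [K cK Ku] := u0 d d0.
apply: (subclosed_compact _ cK).
  by apply: (@closed_comp _ _ u [set t | d <= t]) => [x _|]; [exact: uc|exact: closed_ge].
move=> x /= dx; apply: contrapT => /Ku; rewrite ltNge (le_trans dx)//.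
exact: ler_norm.
Qed.

Lemma metric_compact_closed (K : set X) : compact K -> closed K.
Proof. by apply: compact_closed; exact: metric_hausdorff. Qed.

Lemma compact_radius (K : set X) (x0 : X) :
  compact K -> exists r : R, forall x, K x -> mdist x0 x <= r.
Proof.
move=> cK.
have : compact (mdist x0 @` K).
  apply: continuous_compact => //; apply: continuous_subspaceT.
  exact: continuous_mdist.
move=> /compact_bounded [M [_ Mf]]; exists (`|M| + 1) => x Kx.
have M1 : M < `|M| + 1 by rewrite (le_lt_trans (ler_norm _))// ltrDl.
have := Mf _ M1 (mdist x0 x); rewrite /= ger0_norm ?mdist_ge0//; apply.
by exists x.
Qed.

Lemma Urysohn_metric (A B : set X) :
  closed A -> closed B -> A `&` B = set0 ->
  exists u, [/\ continuous u, forall x, 0 <= u x <= 1,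
    forall x, A x -> u x = 0 & forall x, B x -> u x = 1].
Proof.
move=> cA cB AB.
have sep : uniform_separator A B.
  by apply: normal_uniform_separator => //; exact: pseudometric_normal.
exists (Urysohn A B); split.
- exact: Urysohn_continuous.
- by move=> x; have := @Urysohn_range _ R A B (Urysohn A B x); rewrite /= in_itv/=; apply; exists x.
- by move=> x Ax; apply: (Urysohn_sub0 sep); exists x.
- by move=> x Bx; apply: (Urysohn_sub1 sep); exists x.
Qed.

Section Proper.
Hypothesis Xproper : proper_metric X.

Lemma closed_ball_compact (x0 : X) (r : R) : compact [set x | mdist x0 x <= r].
Proof.
apply: Xproper.
  apply: (@closed_comp _ _ (mdist x0) [set t | t <= r]) => [x _|].
    exact: continuous_mdist.
  exact: closed_le.
exists (r + r) => x y /= xr yr; rewrite (le_trans (metric_triangle _ x0 _))//.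
by rewrite (metric_sym x) lerD.
Qed.

Lemma cutoff (x0 : X) (r : R) :
  exists u, [/\ C0r u, forall x, 0 <= u x <= 1,
    forall x, mdist x0 x <= r -> u x = 1 &
    forall x, r + 1 < mdist x0 x -> u x = 0].
Proof.
pose u x := Num.max 0 (Num.min 1 (r + 1 - mdist x0 x)).
have u01 x : 0 <= u x <= 1.
  by rewrite /u le_max lexx/= ge_max ler01/= ge_min lexx.
exists u; split=> //.
- split=> [|e e0].
    apply: continuous_maxr; first by move=> ?; exact: cvg_cst.
    apply: continuous_minr => x; first exact: cvg_cst.
    by apply: cvgB; [exact: cvg_cst|exact: continuous_mdist].
  exists [set x | mdist x0 x <= r + 1]; first exact: closed_ball_compact.
  move=> x /negP; rewrite -ltNge => rx.
  rewrite /u; have -> : Num.max 0 (Num.min 1 (r + 1 - mdist x0 x)) = 0.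
    by apply/max_idPl; rewrite ge_min orbC subr_le0 ltW.
  by rewrite normr0.
- move=> x xr; rewrite /u; have -> : Num.min 1 (r + 1 - mdist x0 x) = 1.
    by apply/min_idPl; lra.
  by apply/max_idPr; rewrite ler01.
- move=> x xr; apply/max_idPl; rewrite ge_min orbC; lra.
Qed.

Lemma bump_fun (K U : set X) : compact K -> open U -> K `<=` U ->
  exists u, [/\ C0r u, forall x, 0 <= u x <= 1,
    forall x, K x -> u x = 1 & forall x, ~ U x -> u x = 0].
Proof.
move=> cK oU KU; have [[x0 Kx0]|K0] := pselect (K !=set0); last first.
  exists (fun=> 0); split=> //.
  - exact: C0r_cst0.
  - by move=> x; rewrite lexx ler01.
  - by move=> x Kx; case: K0; exists x.
have [r Kr] := compact_radius x0 cK.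
have [c [[cc c0] c01 c1 _]] := cutoff x0 r.
have [|||u [uc u01 u0 u1]] := @Urysohn_metric (~` U) K.
- by rewrite closedC.
- exact: metric_compact_closed.
- by apply/disjoints_subset/subsetC.
(* The Urysohn function need not vanish at infinity; the cutoff, equal to 1 on [K], enforces
   this. *)
exists (fun x => u x * c x); split.
- apply: (C0r_dominated _ (conj cc c0)) => [x|x].
    by apply: cvgM; [exact: uc|exact: cc].
  have /andP[u0x u1x] := u01 x.
  by rewrite normrM (ger0_norm u0x) ler_piMl.
- move=> x; have /andP[u0x u1x] := u01 x; have /andP[c0x c1x] := c01 x.
  by rewrite mulr_ge0//= mulr_ile1.
- by move=> x Kx; rewrite u1// c1 ?mulr1//; exact: Kr.
- by move=> x Ux; rewrite u0// mul0r.
Qed.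

End Proper.

End C0Functions.

(** * The capacity of a vector *)

Section Representation.
Context {R : realType} {X : metricType R} {H : hilbertSpace R}.
Variable rho : (X -> R[i]) -> H -> H.
Hypothesis rho_star : star_representation (@C0 R X) rho.
Local Notation toC := (real_complex R).
Local Notation rhor u := (rho (fun x => toC (u x))).
Implicit Types (f g : X -> R[i]) (u w : X -> R) (v : H).

Lemma rho_lin f : C0 f -> linear (rho f).
Proof. by case: rho_star => + _ _ _ _ f0 => /(_ f f0) []. Qed.

Lemma rho_continuous f : C0 f -> continuous (rho f).
Proof. by case: rho_star => + _ _ _ _ f0 => /(_ f f0) []. Qed.

Lemma rhoD f g v : C0 f -> C0 g -> rho (fun x => f x + g x) v = rho f v + rho g v.
Proof. by case: rho_star => _ + _ _ _ f0 g0 => /(_ f g f0 g0) ->. Qed.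

Lemma rhoZ (c : R[i]) f v : C0 f -> rho (fun x => c * f x) v = c *: rho f v.
Proof. by case: rho_star => _ _ + _ _ f0 => /(_ c f f0) ->. Qed.

Lemma rhoM f g v : C0 f -> C0 g -> rho (fun x => f x * g x) v = rho f (rho g v).
Proof. by case: rho_star => _ _ _ + _ f0 g0 => /(_ f g f0 g0) ->. Qed.

Lemma rho_adj f v v' : C0 f ->
  inner H (rho f v) v' = inner H v (rho (fun x => (f x)^*) v').
Proof. by case: rho_star => _ _ _ _ + f0; apply. Qed.

Lemma rhoN f v : C0 f -> rho (fun x => - f x) v = - rho f v.
Proof.
by move=> f0; rewrite -scaleN1r -rhoZ//; under [in RHS]eq_fun do rewrite mulN1r.
Qed.

Lemma rhoB f g v : C0 f -> C0 g -> rho (fun x => f x - g x) v = rho f v - rho g v.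
Proof. by move=> f0 g0; rewrite (@rhoD f (fun x => - g x)) ?rhoN//; exact: C0N. Qed.

Lemma rhor_adj u v v' : C0r u -> inner H (rhor u v) v' = inner H v (rhor u v').
Proof.
move=> u0; rewrite rho_adj; last exact: C0_toC.
by congr (inner H v (rho _ v')); apply/funext => x; rewrite conj_toC.
Qed.

(** The integral of [u] against the spectral measure of [v], available before any measure is. *)
Definition rho_form v u : R := complex.Re (inner H v (rhor u v)).

Lemma rho_formD v u w : C0r u -> C0r w ->
  rho_form v (fun x => u x + w x) = rho_form v u + rho_form v w.
Proof.
move=> u0 w0; rewrite /rho_form.
have -> : (fun x => toC (u x + w x)) = (fun x => toC (u x) + toC (w x)).
  by apply/funext => x; rewrite rmorphD.
by rewrite rhoD ?innerDr//; first exact: raddfD; exact: C0_toC.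
Qed.

Lemma rho_formZ v (c : R) u : C0r u ->
  rho_form v (fun x => c * u x) = c * rho_form v u.
Proof.
move=> u0; rewrite /rho_form.
have -> : (fun x => toC (c * u x)) = (fun x => toC c * toC (u x)).
  by apply/funext => x; rewrite rmorphM.
rewrite rhoZ ?innerZr ?conj_toC//; last exact: C0_toC.
by case: (inner H _ _) => a b /=; rewrite mul0r subr0.
Qed.

Lemma rho_form_sqr v u : C0r u ->
  rho_form v (fun x => u x ^+ 2) = nrm (rhor u v) ^+ 2.
Proof.
move=> u0; rewrite /rho_form.
have -> : (fun x => toC (u x ^+ 2)) = (fun x => toC (u x) * toC (u x)).
  by apply/funext => x; rewrite expr2 rmorphM.
rewrite rhoM; [|exact: C0_toC..].
by rewrite -rhor_adj// inner_nrm.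
Qed.

Lemma C0r_sqr u : C0r u -> C0r (fun x => u x ^+ 2).
Proof.
by apply: (@C0r_comp _ _ (fun t => t ^+ 2)); [exact: exprn_continuous|rewrite expr0n].
Qed.

Lemma C0r_sqrt u : C0r u -> C0r (fun x => Num.sqrt (u x)).
Proof. by apply: C0r_comp; [exact: sqrt_continuous|rewrite sqrtr0]. Qed.

(** A nonnegative function is the square of its root, which again vanishes at infinity. *)
Lemma rho_form_ge0 v u : C0r u -> (forall x, 0 <= u x) -> 0 <= rho_form v u.
Proof.
move=> u0 uge0; have -> : u = (fun x => Num.sqrt (u x) ^+ 2).
  by apply/funext => x; rewrite sqr_sqrtr.
by rewrite rho_form_sqr ?sqr_ge0//; exact: C0r_sqrt.
Qed.

Lemma rho_form_le v u w : C0r u -> C0r w -> (forall x, u x <= w x) ->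
  rho_form v u <= rho_form v w.
Proof.
move=> u0 w0 uw.
have -> : w = (fun x => u x + (w x + -1 * u x)).
  by apply/funext => x; rewrite mulN1r addrC subrK.
have d0 : C0r (fun x => w x + -1 * u x) by apply: C0rD => //; exact: C0r_scale.
rewrite (rho_formD v u0 d0) lerDl.
by apply: rho_form_ge0 => // x; rewrite mulN1r subr_ge0.
Qed.

(** The norm depends on [f] only through its modulus; order properties of the form thereby pass to
    norms. *)
Lemma nrm_rho v f : C0 f ->
  nrm (rho f v) ^+ 2 = rho_form v (fun x => nrm (f x) ^+ 2).
Proof.
move=> f0; apply: (@complexI R); rewrite -inner_nrm rho_adj// -rhoM//; last exact: C0_conj.
have -> : (fun x => (f x)^* * f x) = (fun x => toC (nrm (f x) ^+ 2)).
  by apply/funext => x; rewrite mulrC mul_conjE.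
rewrite /rho_form RRe_real//.
have /C0_nrmP [_ u0] := f0.
have -> : (fun x => toC (nrm (f x) ^+ 2)) = (fun x => toC (nrm (f x)) * toC (nrm (f x))).
  by apply/funext => x; rewrite expr2 rmorphM.
rewrite rhoM; [|exact: C0_toC..].
by rewrite -rhor_adj// inner_nrm ger0_real// lecR sqr_ge0.
Qed.

Lemma rho_monotone v f g : C0 f -> C0 g -> (forall x, nrm (f x) <= nrm (g x)) ->
  nrm (rho f v) <= nrm (rho g v).
Proof.
move=> f0 g0 fg; rewrite -ler_sqr ?nnegrE ?nrm_ge0// !nrm_rho//.
apply: rho_form_le => [||x]; [by apply: C0r_sqr; case/C0_nrmP: f0|
  by apply: C0r_sqr; case/C0_nrmP: g0|].
by rewrite ler_sqr ?nnegrE ?nrm_ge0.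
Qed.

(* [M^2 - |f|^2 = (M - k)^2] for a function [k] vanishing at infinity; this
   replaces the unitisation of C0. *)
Lemma rho_contractive v f (M : R) : C0 f -> 0 <= M -> (forall x, nrm (f x) <= M) ->
  nrm (rho f v) <= M * nrm v.
Proof.
move=> f0 M0 fM; have /C0_nrmP [_ u0] := f0.
pose k x := M - Num.sqrt (M ^+ 2 - nrm (f x) ^+ 2).
have k0 : C0r k.
  apply: (@C0r_comp _ _ (fun t => M - Num.sqrt (M ^+ 2 - t ^+ 2))) => //.
    move=> t; apply: cvgB; first exact: cvg_cst.
    apply: continuous_comp; last exact: sqrt_continuous.
    by apply: cvgB; [exact: cvg_cst|exact: exprn_continuous].
  by rewrite expr0n subr0 sqrtr_sqr ger0_norm ?subrr.
have k2 : (fun x => k x ^+ 2) = (fun x => 2 * M * k x + -1 * nrm (f x) ^+ 2).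
  apply/funext => x; rewrite /k.
  have : 0 <= M ^+ 2 - nrm (f x) ^+ 2.
    by rewrite subr_ge0 ler_sqr ?nnegrE ?nrm_ge0.
  by move=> /sqr_sqrtr; set s := Num.sqrt _ => s2; nra.
rewrite -ler_sqr ?nnegrE ?mulr_ge0 ?nrm_ge0// nrm_rho// exprMn.
(* This vector stands for the action of [M - k] on [v]; its squared norm is [M ^+ 2 * nrm v ^+ 2]
   minus the form of the squared modulus of [f]. *)
have := sqr_ge0 (nrm (toC M *: v - rhor k v)).
have -> : nrm (toC M *: v - rhor k v) ^+ 2 =
    M ^+ 2 * nrm v ^+ 2 - 2 * M * rho_form v k + rho_form v (fun x => k x ^+ 2).
  rewrite rho_form_sqr// -[LHS]/(complex.Re (toC (nrm _ ^+ 2))) -inner_nrm.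
  rewrite innerBl !innerBr !innerZl !innerZr !inner_nrm conj_toC.
  rewrite rhor_adj// /rho_form.
  by case: (inner H v _) => a b /=; ring.
have f20 : C0r (fun x => nrm (f x) ^+ 2) by exact: C0r_sqr.
rewrite k2 (rho_formD v (C0r_scale (2 * M) k0) (C0r_scale (-1) f20)).
by rewrite !rho_formZ// mulN1r addrA subrK subr_ge0.
Qed.

Definition test_fun (U : set X) u : Prop :=
  [/\ C0r u, forall x, 0 <= u x <= 1 & forall x, ~ U x -> u x = 0].

(* The norm of [phi 1_U v], available before [phi] is constructed. *)
Definition rho_capacity v (U : set X) : R :=
  sup [set nrm (rhor u v) | u in test_fun U].

Local Notation cap := rho_capacity.

Lemma test_fun_contractive v U u : test_fun U u -> nrm (rhor u v) <= nrm v.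
Proof.
move=> [u0 u01 _]; rewrite -[leRHS]mul1r; apply: rho_contractive => //.
  exact: C0_toC.
by move=> x; have /andP[u0x u1x] := u01 x; rewrite nrm_toC ger0_norm.
Qed.

Lemma capacity_ub v U u : test_fun U u -> nrm (rhor u v) <= cap v U.
Proof.
move=> Uu; apply: ub_le_sup; last by exists u.
by exists (nrm v) => _ [w Uw <-]; exact: test_fun_contractive Uw.
Qed.

Lemma capacity_le v U (c : R) :
  (forall u, test_fun U u -> nrm (rhor u v) <= c) -> cap v U <= c.
Proof.
move=> Uc; apply: ge_sup; last by move=> _ [u Uu <-]; exact: Uc.
exists (nrm (rhor (fun=> 0) v)); exists (fun=> 0) => //.
by split=> //; [exact: C0r_cst0|move=> x; rewrite lexx ler01].
Qed.

Lemma test_fun0 U : test_fun U (fun=> 0).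
Proof. by split=> //; [exact: C0r_cst0|move=> x; rewrite lexx ler01]. Qed.

Lemma capacity_ge0 v U : 0 <= cap v U.
Proof. by rewrite (le_trans (nrm_ge0 _) (capacity_ub v (test_fun0 U))). Qed.

Lemma capacity_adherent v U (e : R) : 0 < e ->
  exists2 u, test_fun U u & cap v U - e < nrm (rhor u v).
Proof.
move=> e0; have [|_ [u Uu <-] ule] := @sup_adherent _ [set nrm (rhor u v) | u in test_fun U] _ e0.
  split; first by exists (nrm (rhor (fun=> 0) v)); exists (fun=> 0) => //; exact: test_fun0.
  by exists (nrm v) => _ [w Uw <-]; exact: test_fun_contractive Uw.
by exists u.
Qed.

Lemma capacity_mono v U V : U `<=` V -> cap v U <= cap v V.
Proof.
move=> UV; apply: capacity_le => u [u0 u01 uU]; apply: capacity_ub.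
by split=> // x Vx; apply: uU => /UV.
Qed.

(** The modulus of [f] is split at height [d]: the lower part [m] is bounded by [d], and the excess
    [q] lives on [W] and is [M] times a test function of [W]. *)
Lemma capacity_key v W f (d M : R) : C0 f -> 0 <= d -> 0 <= M ->
  (forall x, nrm (f x) <= M) -> (forall x, ~ W x -> nrm (f x) <= d) ->
  nrm (rho f v) <= d * nrm v + M * cap v W.
Proof.
move=> f0 d0; rewrite le_eqVlt => /predU1P[<- fM fd|M0 fM fd].
  by rewrite mul0r addr0 (le_trans (rho_contractive v f0 (lexx 0) fM))// ler_wpM2r ?nrm_ge0.
have /C0_nrmP [_ u0] := f0.
pose q x := Num.max 0 (nrm (f x) - d).
have q0 : C0r q by exact: C0r_threshold.
have qE x : 0 <= q x <= nrm (f x) /\ nrm (f x) - q x <= d.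
  rewrite /q; have := nrm_ge0 (f x).
  by case: (lerP 0 (nrm (f x) - d)) => *; (split; [apply/andP; split|]); lra.
pose m x := nrm (f x) + -1 * q x.
have m0 : C0r m by apply: C0rD => //; exact: C0r_scale.
have -> : nrm (rho f v) = nrm (rhor (fun x => nrm (f x)) v).
  apply/eqP; rewrite eq_le.
  by apply/andP; split; apply: rho_monotone => //;
    (try exact: C0_toC) => x; rewrite nrm_toC ger0_norm ?nrm_ge0.
have -> : (fun x => toC (nrm (f x))) = (fun x => toC (m x) + toC M * toC (M^-1 * q x)).
  apply/funext => x; rewrite -rmorphM -rmorphD/= /m mulVKf ?gt_eqF//.
  by rewrite mulN1r subrK.
have q1 : C0r (fun x => M^-1 * q x) by exact: C0r_scale.
rewrite rhoD ?rhoZ; [|exact: C0_toC|exact: C0_toC|by apply: C0Z; exact: C0_toC].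
rewrite (le_trans (nrmD _ _))// lerD//.
  apply: rho_contractive => //; first exact: C0_toC.
  move=> x; have [/andP[q0x qx] fqd] := qE x.
  by rewrite nrm_toC ger0_norm /m; lra.
rewrite nrmZ nrm_toC gtr0_norm// ler_pM2l//; apply: capacity_ub; split=> //.
- move=> x; have [/andP[q0x qx] _] := qE x.
  rewrite mulr_ge0 ?invr_ge0 ?(ltW M0)//= ler_pdivrMl// mulr1.
  exact: le_trans qx (fM x).
- move=> x /fd fxd; rewrite /q; have -> : Num.max 0 (nrm (f x) - d) = 0.
    by apply/max_idPl; rewrite subr_le0.
  by rewrite mulr0.
Qed.

(* Lowering a test function by [d] makes its support compact. *)
Lemma test_fun_threshold v U u (d : R) : 0 < d -> test_fun U u ->
  let q := fun x => Num.max 0 (u x - d) in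
  [/\ test_fun U q, forall x, q x != 0 -> d <= u x &
      nrm (rhor u v) - d * nrm v <= nrm (rhor q v)].
Proof.
move=> d0 [u0 u01 uU] q.
have qu x : 0 <= q x /\ q x <= u x.
  by have /andP[? ?] := u01 x; rewrite /q; case: (lerP 0 (u x - d)) => *; lra.
have q0 : C0r q by apply: C0r_threshold => //; exact: ltW.
split.
- split=> // x; last by move=> /uU ux; have [] := qu x; rewrite ux => *; apply/le_anti/andP.
  by have [-> le] := qu x; rewrite (le_trans le)//; have /andP[] := u01 x.
- by move=> x; rewrite /q; case: (lerP 0 (u x - d)) => [*|_]; [lra|rewrite eqxx].
- rewrite lerBlDl -lerBlDr (le_trans (nrm_sub_ge _ _))// -rhoB; [|exact: C0_toC..].
  apply: rho_contractive; [by apply: C0B; exact: C0_toC|exact: ltW|move=> x].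
  rewrite -rmorphB/= nrm_toC; have /andP[? ?] := u01 x.
  by rewrite /q ger0_norm; case: (lerP 0 (u x - d)) => *; lra.
Qed.

Hypothesis Xproper : proper_metric X.

(** The lowered test function [q] is cut in two by a bump [b] inside [U] that equals 1 on the
    compact set [K] minus [V]: then [q * b] is a test function of [U] and [q * (1 - b)] one of
    [V]. *)
Lemma capacityU v U V : open U -> open V ->
  cap v (U `|` V) <= cap v U + cap v V.
Proof.
move=> oU oV; apply: capacity_le => u uUV; apply/ler_addgt0Pr => e e0.
have v1 : 0 < nrm v + 1 by rewrite ltr_wpDl ?nrm_ge0.
(* Lowering by [d] costs at most [d * nrm v <= e]; the summand 1 keeps the denominator positive. *)
pose d := e / (nrm v + 1); have d0 : 0 < d by rewrite divr_gt0.
have dv : d * nrm v <= e.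
  by rewrite /d mulrAC ler_pdivrMr// ler_wpM2l ?lerDl// ltW.
have := test_fun_threshold v d0 uUV; set q := fun _ => _ => -[[q0 q01 qUV] qd uq].
have u0 : C0r u by case: uUV.
pose K := [set x | d <= u x].
have cKV : compact (K `\` V).
  by rewrite setDE; apply: compact_closedI; [exact: C0r_level_compact|rewrite closedC].
have [|b [b0 b01 b1 bU]] := bump_fun Xproper cKV oU.
  move=> x [Kx nVx]; apply: contrapT => nUx.
  case: uUV => _ _ /(_ x) ux0; rewrite /K/= ux0 in Kx; last by case.
  by move: d0; rewrite ltNge Kx.
have qb0 : C0r (fun x => q x * b x).
  apply: (C0r_dominated _ q0) => [x|x]; first by apply: cvgM; [exact: q0.1|exact: b0.1].
  by have /andP[? ?] := b01 x; rewrite normrM ler_piMr// ger0_norm.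
have qc0 : C0r (fun x => q x * (1 - b x)).
  apply: (C0r_dominated _ q0) => [x|x].
    by apply: cvgM; [exact: q0.1|apply: cvgB; [exact: cvg_cst|exact: b0.1]].
  by have /andP[? ?] := b01 x; rewrite normrM ler_piMr// ger0_norm; lra.
have qE : (fun x => toC (q x)) = (fun x => toC (q x * b x) + toC (q x * (1 - b x))).
  by apply/funext => x; rewrite -rmorphD/= -mulrDr addrC subrK mulr1.
suff : nrm (rhor q v) <= cap v U + cap v V by lra.
rewrite qE rhoD; [|exact: C0_toC..].
rewrite (le_trans (nrmD _ _))// lerD//; apply: capacity_ub; split=> //.
- move=> x; have /andP[? ?] := b01 x; have /andP[? ?] := q01 x.
  by rewrite mulr_ge0//= mulr_ile1.
- by move=> x /bU ->; rewrite mulr0.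
- move=> x; have /andP[? ?] := b01 x; have /andP[? ?] := q01 x.
  by rewrite mulr_ge0 ?subr_ge0//= mulr_ile1 ?subr_ge0//; lra.
- move=> x nVx; have [->|/qd Kx] := eqVneq (q x) 0; first by rewrite mul0r.
  by rewrite b1 ?subrr ?mulr0.
Qed.

Lemma open_bigcup_lt (U : nat -> set X) N :
  (forall n, open (U n)) -> open (\bigcup_(n < N) U n).
Proof. by move=> oU; apply: bigcup_open. Qed.

Lemma capacity_bigcup_lt v (U : nat -> set X) N : (forall n, open (U n)) ->
  cap v (\bigcup_(n < N) U n) <= \sum_(n < N) cap v (U n).
Proof.
move=> oU; elim: N => [|N IH].
  rewrite big_ord0; apply: capacity_le => u [u0 u01 uE].
  rewrite (_ : u = fun=> 0); last by apply/funext => x; apply: uE => -[].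
  by rewrite rmorph0 -(mul0r 0) rhoZ ?scale0r ?nrm0//; exact: C0_cst0.
rewrite big_ord_recr/= bigcup_mkord big_ord_recr/= -bigcup_mkord.
apply: (le_trans (capacityU _ _ _)) => //; first exact: open_bigcup_lt.
by rewrite lerD2r.
Qed.

(** A lowered, almost optimal test function is supported in a compact set, which finitely many [U n]
    cover. The finite sum with an error stands in for a series that may diverge. *)
Lemma capacity_bigcup v (U : nat -> set X) (e : R) : (forall n, open (U n)) -> 0 < e ->
  exists N, cap v (\bigcup_n U n) <= \sum_(n < N) cap v (U n) + e.
Proof.
move=> oU e0; have e2 : 0 < e / 2 by rewrite divr_gt0.
have v1 : 0 < nrm v + 1 by rewrite ltr_wpDl ?nrm_ge0.
pose d := e / 2 / (nrm v + 1); have d0 : 0 < d by rewrite divr_gt0.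
have dv : d * nrm v <= e / 2.
  by rewrite /d mulrAC ler_pdivrMr// ler_wpM2l ?lerDl// ltW.
have [u uU ule] := capacity_adherent v (\bigcup_n U n) e2.
have := test_fun_threshold v d0 uU; set q := fun _ => _ => -[[q0 q01 qU] qd uq].
have u0 : C0r u by case: uU.
have [|N KN] := compact_bigcup_lt (C0r_level_compact d0 u0) oU.
  move=> x /= dx; apply: contrapT => nUx.
  by case: uU => _ _ /(_ x nUx) ux0; move: d0; rewrite ltNge -ux0 dx.
exists N; have : nrm (rhor q v) <= cap v (\bigcup_(n < N) U n).
  apply: capacity_ub; split=> // x nUx; apply/eqP; apply: contrapT => /negP.
  by move=> /qd /KN.
by have := capacity_bigcup_lt v N oU; lra.
Qed.

(** [K] is a superlevel set of an almost optimal test function [h]. A test function [k] of the rest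
    of [U] has support disjoint from that of the lowered [q], so the squared norms for [q] and [k]
    add up to at most [C ^+ 2]; as [q] nearly exhausts [C], little is left for [k]. *)
Lemma capacity_inner v (U : set X) (e : R) : open U -> 0 < e ->
  exists K, [/\ compact K, K `<=` U & cap v (U `\` K) < e].
Proof.
move=> oU e0; pose C := cap v U; have C0 : 0 <= C by exact: capacity_ge0.
have v1 : 0 < nrm v + 1 by rewrite ltr_wpDl ?nrm_ge0.
have C1 : 0 < C + 1 by rewrite ltr_wpDl.
(* With [Q] the norm for [q] and [C - Q <= t], one has [C ^+ 2 - Q ^+ 2 <= 2 * C * t], which this
   [t] keeps below [(e / 2) ^+ 2]. *)
pose t := e ^+ 2 / (8 * (C + 1)).
have t0 : 0 < t by rewrite divr_gt0 ?exprn_gt0// mulr_gt0.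
have tC : 2 * C * t <= (e / 2) ^+ 2.
  have -> : (e / 2) ^+ 2 = 2 * (C + 1) * t by rewrite /t; field; rewrite gt_eqF.
  by rewrite ler_pM2r// ler_pM2l// lerDl.
have t2 : 0 < t / 2 by rewrite divr_gt0.
pose d := t / 2 / (nrm v + 1); have d0 : 0 < d by rewrite divr_gt0.
have dv : d * nrm v <= t / 2.
  by rewrite /d mulrAC ler_pdivrMr// ler_wpM2l ?lerDl// ltW.
have [h hU hle] := capacity_adherent v U t2.
have := test_fun_threshold v d0 hU; set q := fun _ => _ => -[[q0 q01 qU] qd hq].
have h0 : C0r h by case: hU.
exists [set x | d <= h x]; split; first exact: C0r_level_compact.
  move=> x /= dx; apply: contrapT => nUx.
  by case: hU => _ _ /(_ x nUx) hx0; move: d0; rewrite ltNge -hx0 dx.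
suff : cap v (U `\` [set x | d <= h x]) <= e / 2 by lra.
apply: capacity_le => k [k0 k01 kU].
have qk x : q x * k x = 0.
  have [->|/qd Kx] := eqVneq (q x) 0; first by rewrite mul0r.
  by rewrite kU ?mulr0// => -[_]; apply.
have Uqk : test_fun U (fun x => q x + k x).
  split=> [|x|x nUx]; first exact: C0rD.
    have := qk x; have /andP[? ?] := q01 x; have /andP[? ?] := k01 x.
    by move=> /eqP; rewrite mulf_eq0 => /orP[] /eqP ?; apply/andP; lra.
  by rewrite qU// kU ?addr0// => -[].
have := capacity_ub v Uqk; rewrite -/C.
have -> : (fun x => toC (q x + k x)) = (fun x => toC (q x) + toC (k x)).
  by apply/funext => x; rewrite rmorphD.
have ge0 := @nrm_ge0.
have : nrm (rhor (fun x => q x + k x) v) ^+ 2 = nrm (rhor q v) ^+ 2 + nrm (rhor k v) ^+ 2.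
  rewrite -!rho_form_sqr//; last exact: C0rD.
  rewrite -rho_formD; [|exact: C0r_sqr..].
  by congr rho_form; apply/funext => x; rewrite sqrrD qk mul0rn addr0.
have -> : (fun x => toC (q x + k x)) = (fun x => toC (q x) + toC (k x)).
  by apply/funext => x; rewrite rmorphD.
move: (ge0 _ H (rhor q v)) (ge0 _ H (rhor k v)) (ge0 _ H (rho (fun x => toC (q x) + toC (k x)) v)).
move: hq hle; rewrite -/C.
move: (nrm (rhor q v)) (nrm (rhor k v)) (nrm (rhor h v)).
move: (nrm (rho (fun x => toC (q x) + toC (k x)) v)).
move=> T Q K S hq hle Q0 K0 T0 TE TC.
have QC : C - Q <= t by lra.
have QC' : Q <= C by nra.
have : (C - Q) * (C + Q) <= t * (2 * C) by apply: ler_pM; lra.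
rewrite -[K <= _]ler_sqr ?nnegrE//; last by rewrite divr_ge0// ltW.
nra.
Qed.

End Representation.

(** * Borel sets and the Lusin property *)

Lemma real_net {R : realType} (M e : R) : 0 < e ->
  exists s : seq R, forall a, `|a| <= M -> exists2 b, b \in s & `|a - b| <= e.
Proof.
move=> e0; pose N := (Num.truncn (2 * M / e)).+1.
exists [seq - M + k%:R * e | k <- iota 0 N] => a; rewrite ler_norml => /andP[Ma aM].
have aM0 : 0 <= (a + M) / e by rewrite divr_ge0 ?(ltW e0)//; lra.
have /andP[ka ak] := truncn_itv aM0; set k := Num.truncn _ in ka ak.
exists (- M + k%:R * e).
  apply/mapP; exists k => //; rewrite mem_iota /= add0n /N ltnS; apply: le_truncn.
  by rewrite ler_pM2r ?invr_gt0//; lra.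
rewrite ler_pdivlMr// in ka; rewrite ltr_pdivrMr// -natr1 in ak.
by rewrite ler_norml; apply/andP; split; lra.
Qed.

Lemma complex_net {R : realType} (M e : R) : 0 < e ->
  exists s : seq R[i], forall z, nrm z <= M -> exists2 w, w \in s & nrm (z - w) < e.
Proof.
move=> e0; have e3 : 0 < e / 3 by rewrite divr_gt0.
have [s sP] := real_net M e3.
exists [seq Complex a b | a <- s, b <- s] => z zM.
have [|a aS za] := sP (complex.Re z); first exact: le_trans (nrm_Re _) zM.
have [|b bS zb] := sP (complex.Im z); first exact: le_trans (nrm_Im _) zM.
exists (Complex a b); first exact: allpairs_f.
rewrite (le_lt_trans (nrm_ReIm _))//; case: z za zb {zM} => x y /= za zb; lra.
Qed.

Section BorelSets.
Context {R : realType} {X : metricType R}.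

Lemma borel_sigma_algebra : sigma_algebra setT (@borel_set R X).
Proof. exact: smallest_sigma_algebra. Qed.

Lemma borel_open (U : set X) : open U -> borel_set U.
Proof. exact: sub_sigma_algebra. Qed.

Lemma borel_setC (A : set X) : borel_set A -> borel_set (~` A).
Proof. by case: borel_sigma_algebra => _ + _; rewrite -setTD; apply. Qed.

Lemma borel_bigcup (A : nat -> set X) :
  (forall n, borel_set (A n)) -> borel_set (\bigcup_n A n).
Proof. by move=> bA; case: borel_sigma_algebra => _ _; apply. Qed.

Lemma borel_closed (F : set X) : closed F -> borel_set F.
Proof. by move=> cF; rewrite -(setCK F); apply: borel_setC; apply: borel_open; rewrite openC. Qed.

Lemma borel_set0 : borel_set (@set0 X).
Proof. by case: borel_sigma_algebra. Qed.

Lemma borel_setT : borel_set (@setT X).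
Proof. by rewrite -setC0; apply: borel_setC; exact: borel_set0. Qed.

Lemma borel_setU (A B : set X) : borel_set A -> borel_set B -> borel_set (A `|` B).
Proof.
move=> bA bB; have -> : A `|` B = \bigcup_n (if n is 0%N then A else B).
  by apply/seteqP; split=> [x [Ax|Bx]|x [[|n] _ h]]; [exists 0%N|exists 1%N|left|right].
by apply: borel_bigcup => -[].
Qed.

Lemma borel_setI (A B : set X) : borel_set A -> borel_set B -> borel_set (A `&` B).
Proof.
move=> bA bB; rewrite -(setCK (A `&` B)) setCI.
by apply: borel_setC; apply: borel_setU; apply: borel_setC.
Qed.

Lemma borel_setD (A B : set X) : borel_set A -> borel_set B -> borel_set (A `\` B).
Proof. by move=> bA bB; rewrite setDE; apply: borel_setI => //; apply: borel_setC. Qed.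

End BorelSets.

(** * Abstract capacities: continuity from above, regularity and Lusin approximation *)

Section Capacity.
Context {R : realType} {X : metricType R}.
Local Notation toC := (real_complex R).

(** What the approximation theory needs of [rho_capacity]. The axioms are stable under sums, so that
    one exceptional set can be small for several vectors simultaneously. *)
Record capacity (c : set X -> R) : Prop := Capacity {
  cap_ge0 : forall U, 0 <= c U ;
  cap_mono : forall U V, U `<=` V -> c U <= c V ;
  cap_bigcup : forall (U : nat -> set X) (e : R), (forall n, open (U n)) -> 0 < e ->
    exists N, c (\bigcup_n U n) <= \sum_(n < N) c (U n) + e ;
  cap_inner : forall (U : set X) (e : R), open U -> 0 < e ->
    exists K, [/\ compact K, K `<=` U & c (U `\` K) < e] }.

Lemma capacityD (c1 c2 : set X -> R) :
  capacity c1 -> capacity c2 -> capacity (fun U => c1 U + c2 U).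
Proof.
move=> h1 h2; split.
- by move=> U; rewrite addr_ge0 ?cap_ge0.
- by move=> U V UV; rewrite lerD ?cap_mono.
- move=> U e oU e0; have e2 : 0 < e / 2 by rewrite divr_gt0.
  have [N1 N1U] := cap_bigcup h1 oU e2; have [N2 N2U] := cap_bigcup h2 oU e2.
  exists (maxn N1 N2); rewrite big_split/=.
  have le_sum (c : set X -> R) m n : capacity c -> (m <= n)%N ->
      \sum_(i < m) c (U i) <= \sum_(i < n) c (U i).
    move=> hc mn; rewrite -!(big_mkord xpredT (fun i => c (U i))).
    rewrite (big_cat_nat _ mn)//= lerDl; apply: sumr_ge0 => i _; exact: cap_ge0.
  have := le_sum c1 _ _ h1 (leq_maxl N1 N2); have := le_sum c2 _ _ h2 (leq_maxr N1 N2).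
  by lra.
- move=> U e oU e0; have e2 : 0 < e / 2 by rewrite divr_gt0.
  have [K1 [cK1 K1U K1e]] := cap_inner h1 oU e2.
  have [K2 [cK2 K2U K2e]] := cap_inner h2 oU e2.
  exists (K1 `|` K2); split; [exact: compactU|by move=> x []; [exact: K1U|exact: K2U]|].
  have := cap_mono h1 (@setDS _ U _ _ (@subsetUl _ K1 K2)).
  have := cap_mono h2 (@setDS _ U _ _ (@subsetUr _ K1 K2)).
  by lra.
Qed.

Variable c : set X -> R.
Hypothesis c_cap : capacity c.

Lemma cap_set0 : c set0 = 0.
Proof.
apply/eqP; rewrite eq_le cap_ge0// andbT; apply/ler_addgt0Pl => e e0.
have [K [_ _ /ltW]] := cap_inner c_cap (@open0 X) e0.
by rewrite set0D addr0.
Qed.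

Lemma cap_bigcup_le (U : nat -> set X) (M : R) : (forall n, open (U n)) ->
  (forall N, \sum_(n < N) c (U n) <= M) -> c (\bigcup_n U n) <= M.
Proof.
move=> oU UM; apply/ler_addgt0Pr => e e0.
have [N /le_trans] := cap_bigcup c_cap oU e0; apply.
by rewrite lerD2r.
Qed.

Lemma capU (U V : set X) : open U -> open V -> c (U `|` V) <= c U + c V.
Proof.
move=> oU oV; pose F n := if n is n'.+1 then (if n' is 0 then V else set0) else U.
have -> : U `|` V = \bigcup_n F n.
  apply/seteqP; split=> [x [Ux|Vx]|x [[|[|n]] _ Fx]//]; [by exists 0|by exists 1|by left|by right].
apply: cap_bigcup_le => [[|[|n]]//=|]; first exact: open0.
case=> [|[|N]].
- by rewrite big_ord0 addr_ge0 ?cap_ge0.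
- by rewrite big_ord1/= lerDl cap_ge0.
- rewrite !big_ord_recl/= big1 ?addr0// => i _; exact: cap_set0.
Qed.

Lemma sum_pow2_le (e : R) N : 0 <= e -> \sum_(n < N) e / 2 ^+ n.+1 <= e.
Proof.
move=> e0; suff -> : \sum_(n < N) e / 2 ^+ n.+1 = e - e / 2 ^+ N.
  by rewrite gerBl divr_ge0// exprn_ge0.
elim: N => [|N IH]; first by rewrite big_ord0 expr0 divr1 subrr.
rewrite big_ord_recr/= IH exprS; field.
by rewrite expf_neq0//= pnatr_eq0.
Qed.

Lemma cap_bigcup_pow2 (U : nat -> set X) (e : R) : 0 <= e -> (forall n, open (U n)) ->
  (forall n, c (U n) <= e / 2 ^+ n.+1) -> c (\bigcup_n U n) <= e.
Proof.
move=> e0 oU Ue; apply: cap_bigcup_le => // N.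
by rewrite (le_trans _ (sum_pow2_le N e0))//; apply: ler_sum.
Qed.

(* If [O_N `\` W] decreases to the empty set, inner compact approximations
   [K_n] of the [O_n] have a finite subfamily with intersection inside [W]. *)
Lemma cap_continuous (O : nat -> set X) (W : set X) (e : R) :
  (forall n, open (O n)) -> (forall m n, (m <= n)%N -> O n `<=` O m) -> open W ->
  \bigcap_n O n `<=` W -> 0 < e -> exists N, c (O N) <= c W + e.
Proof.
move=> oO Odec oW OW e0.
have e2n n : 0 < e / 2 ^+ n.+1 by rewrite divr_gt0 ?exprn_gt0.
have /choice [K Kprop] n := cap_inner c_cap (oO n) (e2n n).
have cK n : compact (K n) by case: (Kprop n).
have clK n : closed (K n) by apply: metric_compact_closed.
have oD n : open (O n `\` K n).
  by rewrite setDE; apply: openI => //; rewrite openC.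
have [||N KN] := @compact_bigcup_lt _ (K 0%N) (fun n => W `|` ~` K n) (cK 0%N).
- by move=> n; apply: openU => //; rewrite openC.
- move=> x _; have [Wx|nWx] := pselect (W x); first by exists 0%N => //; left.
  have [n Onx] : exists n, ~ O n x.
    by apply: contrapT => /forallNP h; apply/nWx/OW => n _; apply: contrapT.
  by exists n => //; right => Knx; apply: Onx; case: (Kprop n) => _ + _; apply.
exists N; have : O N `<=` W `|` \bigcup_n (O n `\` K n).
  move=> x ONx; have [Wx|nWx] := pselect (W x); [by left|right].
  apply: contrapT => nD.
  have Kx n : (n <= N)%N -> K n x.
    move=> nN; apply: contrapT => nKx; apply: nD; exists n => //; split=> //.
    exact: Odec ONx.
  by have [//|n /= nN [//|]] := KN x (Kx 0%N _); apply; apply: Kx; exact: ltnW.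
move=> /(cap_mono c_cap) /le_trans; apply.
apply: (le_trans (capU _ _)) => //; first exact: bigcup_open.
rewrite lerD2l; apply: cap_bigcup_pow2 => // [|n]; first exact: ltW.
by apply: ltW; case: (Kprop n).
Qed.

(** Measuring only the gap between [F] and [U] makes the condition symmetric under complements. *)
Definition cap_regular (A : set X) : Prop := forall e : R, 0 < e ->
  exists F U, [/\ closed F, open U, F `<=` A, A `<=` U & c (U `\` F) <= e].

Lemma cap_regular_open (U : set X) : open U -> cap_regular U.
Proof.
move=> oU e e0; have [K [cK KU /ltW Ke]] := cap_inner c_cap oU e0.
by exists K, U; split => //; exact: metric_compact_closed.
Qed.

Lemma cap_regularC (A : set X) : cap_regular A -> cap_regular (~` A).
Proof.
move=> Areg e /Areg [F [U [cF oU FA AU UF]]].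
exists (~` U), (~` F); split=> //; rewrite ?closedC ?openC//.
- exact: subsetC.
- exact: subsetC.
- by rewrite setDE setCK setIC -setDE.
Qed.

(** Only finite unions of the [F n] are sure to be closed. What they miss in the union of the [U n]
    decreases, with intersection inside the union of the gaps, so [cap_continuous] makes some finite
    union good enough. *)
Lemma cap_regular_bigcup (A : nat -> set X) :
  (forall n, cap_regular (A n)) -> cap_regular (\bigcup_n A n).
Proof.
move=> Areg e e0; have e2 : 0 < e / 2 by rewrite divr_gt0.
have e2n n : 0 < e / 2 / 2 ^+ n.+1 by rewrite divr_gt0 ?exprn_gt0.
have /choice [F Fprop] n := Areg n _ (e2n n).
have /choice [U UF] := Fprop.
have oU n : open (U n) by case: (UF n).
have cF n : closed (F n) by case: (UF n).
have oUF n : open (U n `\` F n) by rewrite setDE; apply: openI => //; rewrite openC.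
have cFN N : closed (\bigcup_(n < N) F n).
  by rewrite bigcup_mkord; apply: closed_bigsetU => i _.
have oUFN N : open (\bigcup_n U n `\` \bigcup_(n < N) F n).
  by rewrite setDE; apply: openI; [exact: bigcup_open|rewrite openC].
have [|||N ON] := @cap_continuous (fun N => \bigcup_n U n `\` \bigcup_(n < N) F n)
  (\bigcup_n (U n `\` F n)) (e / 2) oUFN _ _ _ e2.
- by move=> m n mn; apply: setDS => x [k /= km Fkx]; exists k => //=; exact: leq_trans mn.
- exact: bigcup_open.
- move=> x h; have [[n _ Unx] _] := h 0%N I; exists n => //; split=> // Fnx.
  by have [_] := h n.+1 I; apply; exists n => /=.
exists (\bigcup_(n < N) F n), (\bigcup_n U n); split=> //.
- exact: bigcup_open.
- by move=> x [n _ Fnx]; exists n => //; case: (UF n) => _ _ + _ _; apply.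
- by move=> x [n _ Anx]; exists n => //; case: (UF n) => _ _ _ + _; apply.
- have : c (\bigcup_n (U n `\` F n)) <= e / 2.
    by apply: cap_bigcup_pow2 => // [|n]; [exact: ltW|case: (UF n)].
  by lra.
Qed.

Lemma cap_regular_borel (A : set X) : borel_set A -> cap_regular A.
Proof.
apply: smallest_sub; last by move=> U; exact: cap_regular_open.
split; first by apply: cap_regular_open; exact: open0.
- by move=> B; rewrite setTD; exact: cap_regularC.
- exact: cap_regular_bigcup.
Qed.

(** The conclusion of Lusin's theorem taken as a property; one [e] bounds both the capacity and the
    uniform error. *)
Definition Lusin (f : X -> R[i]) : Prop := forall e : R, 0 < e ->
  exists g U, [/\ C0 g, open U, c U <= e & forall x, ~ U x -> nrm (f x - g x) <= e].

Lemma C0_Lusin f : C0 f -> Lusin f.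
Proof.
move=> f0 e e0; exists f, set0; split=> //; first exact: open0.
  by rewrite cap_set0 ltW.
by move=> x _; rewrite subrr nrm0 ltW.
Qed.

Lemma LusinD f g : Lusin f -> Lusin g -> Lusin (fun x => f x + g x).
Proof.
move=> Lf Lg e e0; have e2 : 0 < e / 2 by rewrite divr_gt0.
have [f' [U [f0 oU cU Uf]]] := Lf _ e2; have [g' [V [g0 oV cV Vg]]] := Lg _ e2.
exists (fun x => f' x + g' x), (U `|` V); split; [exact: C0D|exact: openU| |].
  by rewrite (le_trans (capU oU oV))// (splitr e) lerD.
move=> x /not_orP [/Uf fx /Vg gx]; rewrite opprD addrACA (splitr e).
by rewrite (le_trans (nrmD _ _))// lerD.
Qed.

Lemma LusinZ (a : R[i]) f : Lusin f -> Lusin (fun x => a * f x).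
Proof.
move=> Lf e e0; have a1 : 0 < nrm a + 1 by rewrite ltr_wpDl ?nrm_ge0.
have m0 : 0 < Num.min e (e / (nrm a + 1)) by rewrite lt_min e0 divr_gt0.
have [f' [U [f0 oU cU Uf]]] := Lf _ m0.
exists (fun x => a * f' x), U; split=> //; first exact: C0Z.
  by rewrite (le_trans cU)// ge_min lexx.
move=> x /Uf; rewrite le_min => /andP[_].
rewrite -mulrBr nrmM ler_pdivlMr// mulrC; apply: le_trans.
by rewrite ler_wpM2r ?nrm_ge0// lerDl.
Qed.

Lemma Lusin_approx f :
  (forall e : R, 0 < e -> exists2 g, Lusin g & forall x, nrm (f x - g x) <= e) ->
  Lusin f.
Proof.
move=> fL e e0; have e2 : 0 < e / 2 by rewrite divr_gt0.
have [g Lg fg] := fL _ e2; have [h [U [h0 oU cU Ug]]] := Lg _ e2.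
exists h, U; split=> //; first by rewrite (le_trans cU)// ler_pdivrMr// ler_pMr// ler1n.
move=> x /Ug gh; rewrite (le_trans (nrm_triangle (g x) _ _))// (splitr e).
by rewrite lerD.
Qed.

(** [s] is the factor of the radial retraction onto the disc of radius [M]. It moves [g x] by the
    excess of its modulus over [M], which off [U] is at most the error already made; hence the start
    from [e / 2]. *)
Lemma Lusin_truncate f (M e : R) : Lusin f -> (forall x, nrm (f x) <= M) ->
  0 <= M -> 0 < e ->
  exists g U, [/\ C0 g, forall x, nrm (g x) <= M, open U, c U <= e &
                forall x, ~ U x -> nrm (f x - g x) <= e].
Proof.
move=> Lf fM; rewrite le_eqVlt => /predU1P[M0 e0|M0 e0].
  exists (fun=> 0), set0; split=> //.
  - exact: C0_cst0.
  - by move=> x; rewrite nrm0 -M0.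
  - exact: open0.
  - by rewrite cap_set0 ltW.
  - by move=> x _; rewrite subr0 (le_trans (fM x))// -M0 ltW.
have e2 : 0 < e / 2 by rewrite divr_gt0.
have [g [U [g0 oU cU Ug]]] := Lf _ e2.
have /C0_nrmP [gc ng0] := g0.
pose s x := M / Num.max M (nrm (g x)).
have maxpos x : 0 < Num.max M (nrm (g x)) by rewrite lt_max M0.
have s01 x : 0 <= s x <= 1.
  by rewrite /s divr_ge0 ?(ltW M0) ?(ltW (maxpos x))//= ler_pdivrMr// mul1r le_max lexx.
have sc : continuous s.
  move=> x; apply: cvgM; first exact: cvg_cst.
  apply: cvgV; first by rewrite gt_eqF.
  by apply: continuous_maxr; [move=> ?; exact: cvg_cst|exact: ng0.1].
have sg x : nrm (g x - toC (s x) * g x) = Num.max 0 (nrm (g x) - M).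
  have -> : g x - toC (s x) * g x = toC (1 - s x) * g x.
    by rewrite rmorphB/= mulrBl mul1r.
  have /andP[s0 s1] := s01 x.
  rewrite nrmM nrm_toC ger0_norm ?subr_ge0// /s; case: (leP M (nrm (g x))) => Mg.
    rewrite mulrBl mul1r divfK ?gt_eqF ?(lt_le_trans M0)//.
    by apply/esym/max_idPr; rewrite subr_ge0.
  rewrite divff ?gt_eqF// subrr mul0r; apply/esym/max_idPl.
  by rewrite subr_le0 ltW.
exists (fun x => toC (s x) * g x), U; split=> //.
- apply: (@C0_bounded_mul _ _ (fun x => toC (s x)) g 1) => //.
    exact: continuous_toC.
  by move=> x; have /andP[? ?] := s01 x; rewrite nrm_toC ger0_norm.
- move=> x; have /andP[? ?] := s01 x; rewrite nrmM nrm_toC ger0_norm// /s.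
  by rewrite mulrAC ler_pdivrMr// ler_wpM2l ?(ltW M0)// le_max lexx orbT.
- by rewrite (le_trans cU)// ler_pdivrMr// ler_pMr// ler1n.
move=> x /Ug fg; rewrite (le_trans (nrm_triangle (g x) _ _))// (splitr e) lerD//.
rewrite sg ge_max (le_trans _ fg) ?nrm_ge0//=.
by have := fM x; have := nrm_sub_ge (g x) (f x); rewrite (nrmC (g x)); lra.
Qed.

Hypothesis Xproper : proper_metric X.

Lemma Lusin_indic (A : set X) : borel_set A -> Lusin \1_A.
Proof.
move=> /cap_regular_borel Areg e e0; have e2 : 0 < e / 2 by rewrite divr_gt0.
have [F [U [cF oU FA AU UF]]] := Areg _ e2.
(* [F] need not be compact; [K] carries the whole space up to capacity [e / 2], and the bump is
   built on [F] inside [K]. *)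
have [K [cK _ Ke]] := cap_inner c_cap (@openT X) e2.
have cFK : compact (F `&` K) by rewrite setIC; exact: compact_closedI.
have [|b [b0 b01 b1 bU]] := bump_fun Xproper cFK oU.
  by move=> x [Fx _]; exact/AU/FA.
have oUF : open (U `\` F) by rewrite setDE; apply: openI; rewrite ?openC.
have oK : open (setT `\` K) by rewrite setTD openC; exact: metric_compact_closed.
exists (fun x => toC (b x)), ((U `\` F) `|` (setT `\` K)); split.
- exact: C0_toC.
- exact: openU.
- by rewrite (le_trans (capU oUF oK))// (splitr e) lerD// ltW.
move=> x /not_orP [nUF nK].
have Kx : K x by apply: contrapT => nKx; apply: nK.
have [Fx|nFx] := pselect (F x).
  by rewrite b1// indicE mem_set ?subrr ?nrm0 ?ltW//; exact: FA.
have nUx : ~ U x by move=> Ux; apply: nUF.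
by rewrite bU// indicE memNset ?subrr ?nrm0 ?ltW// => /AU.
Qed.

(** Builds a simple function [g] by induction on the list of values: each new [z] is assigned only
    to the points that no value treated before comes within [e] of. That [g] vanishes off [B] is
    what lets the induction add the next term. *)
Lemma Lusin_grid f (s : seq R[i]) (e : R) :
  (forall U : set R[i]^o, open U -> borel_set (f @^-1` U)) -> 0 < e ->
  let B := [set x | exists2 z, z \in s & nrm (f x - z) < e] in
  exists g, [/\ borel_set B, Lusin g, forall x, ~ B x -> g x = 0 &
    forall x, B x -> nrm (f x - g x) < e].
Proof.
move=> fb e0; elim: s => [|z s [g [bB Lg g0 gB]]] /=.
  exists (fun=> 0); split=> //; last by move=> x [].
    rewrite [X in borel_set X](_ : _ = set0); first exact: borel_set0.
    by apply/seteqP; split=> x // [].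
  by apply: C0_Lusin; exact: C0_cst0.
set B := [set x | _] in bB g0 gB; set B' := [set x | _].
pose A := [set x | nrm (f x - z) < e].
have bA : borel_set A.
  have -> : A = f @^-1` (ball (z : R[i]^o) (toC e)).
    by apply/seteqP; split=> x; rewrite /A/= -ball_normE/= nrm_ltP nrmC.
  by apply: fb; apply: ball_open; rewrite ltcR.
have BE : B' = B `|` (A `\` B).
  apply/seteqP; split=> x.
    move=> [w]; rewrite inE => /predU1P[->|ws] fw; last by left; exists w.
    by have [?|?] := pselect (B x); [left|right].
  by move=> [[w ws fw]|[Ax _]]; [exists w; rewrite // inE ws orbT|exists z; rewrite ?mem_head].
have bD : borel_set (A `\` B) by exact: borel_setD.
exists (fun x => g x + z * \1_(A `\` B) x); split.
- by rewrite BE; exact: borel_setU.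
- by apply: LusinD => //; apply: LusinZ; exact: Lusin_indic.
- move=> x nBx; have /not_orP [/g0 -> nD] : ~ (B `|` (A `\` B)) x by rewrite -BE.
  by rewrite indicE memNset ?mulr0 ?addr0.
move=> x Bx; have [{}Bx|[Ax nBx]] : (B `|` (A `\` B)) x by rewrite -BE.
  by rewrite indicE memNset ?mulr0 ?addr0; [exact: gB|move=> -[_]].
by rewrite g0// indicE mem_set ?mulr1 ?add0r.
Qed.

Lemma Lusin_bounded_borel f : bounded_borel f -> Lusin f.
Proof.
move=> [[M fM] fb]; apply: Lusin_approx => e e0.
have [s sP] := complex_net (complex.Re M) e0.
have [g [_ Lg _ gB]] := Lusin_grid s fb e0.
exists g => // x; apply/ltW/gB/sP.
by have := fM x; rewrite nrmE lecE => /andP[].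
Qed.

End Capacity.

(** * The Borel functional calculus *)

Lemma nrm_eps0 {R : realType} {V : normedZmodType R[i]} (v : V) (C : R) :
  (forall e : R, 0 < e -> nrm v <= C * e) -> v = 0.
Proof.
move=> vC; apply: le_eps_nrm0 => e e0.
have C1 : 0 < `|C| + 1 by rewrite ltr_wpDl.
rewrite (le_trans (vC _ (divr_gt0 e0 C1)))//.
rewrite mulrCA ler_piMr//; first exact: ltW.
by rewrite ler_pdivrMr// mul1r (le_trans (ler_norm _))// lerDl.
Qed.

Section FunctionalCalculus.
Context {R : realType} {X : metricType R} {H : hilbertSpace R}.
Hypothesis Xproper : proper_metric X.
Variable rho : (X -> R[i]) -> H -> H.
Hypothesis rho_star : star_representation (@C0 R X) rho.
Local Notation toC := (real_complex R).
Local Notation cap := (rho_capacity rho).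
Implicit Types (f g : X -> R[i]) (v w : H).

Lemma rho_capacityP v : capacity (cap v).
Proof.
split.
- by move=> U; exact: capacity_ge0.
- by move=> U V; exact: capacity_mono.
- by move=> U e; exact: capacity_bigcup.
- by move=> U e; exact: capacity_inner.
Qed.

(** Continuous approximants [g n] replace the [f_ n], so that the sets [D m n] where two of them
    differ noticeably are open. Pointwise convergence puts the intersection of the tails [O N]
    inside the exceptional set [W], and [cap_continuous] applies. *)
Lemma Egorov (c : set X -> R) (f_ : nat -> X -> R[i]) f (e : R) : capacity c ->
  (forall n, Lusin c (f_ n)) ->
  (forall x, (f_ n x : R[i]^o) @[n --> \oo] --> (f x : R[i]^o)) -> 0 < e ->
  exists N g W, [/\ C0 g, open W, c W <= e,
    forall x, ~ W x -> nrm (f x - g x) <= e &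
    forall n x, (N <= n)%N -> ~ W x -> nrm (f_ n x - g x) <= e].
Proof.
(* Off [W], [d] between [f_ m] and [f_ n] and [d] for each approximant make the threshold [3 * d] of
   [D]; the last comparison of [f_ n] with [g N] adds one more [d]. *)
move=> c_cap Lf f_cvg e0; pose d := e / 4; have d0 : 0 < d by rewrite divr_gt0.
have dn n : 0 < d / 2 ^+ n.+1 by rewrite divr_gt0 ?exprn_gt0.
have dnd n : d / 2 ^+ n.+1 <= d.
  by rewrite ler_pdivrMr ?exprn_gt0// ler_peMr ?(ltW d0)// exprn_ege1// ler1n.
have /choice [g gP] n := Lf n _ (dn n).
have /choice [U UP] := gP.
have g0 n : C0 (g n) by case: (UP n).
have oU n : open (U n) by case: (UP n).
pose W := \bigcup_n U n.
have oW : open W by exact: bigcup_open.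
have cW : c W <= d by apply: cap_bigcup_pow2 => // [|n]; [exact: ltW|case: (UP n)].
have fg n x : ~ W x -> nrm (f_ n x - g n x) <= d.
  move=> nWx; apply: le_trans (dnd n); case: (UP n) => _ _ _; apply => Ux.
  by apply: nWx; exists n.
pose D m n := [set x | 3 * d < nrm (g m x - g n x)].
have oD m n : open (D m n).
  have /C0_nrmP [_ [hc _]] := C0B (g0 m) (g0 n).
  by apply: (@open_comp _ _ _ [set t | 3 * d < t]) => [x _|]; [exact: hc|exact: open_gt].
pose O N := \bigcup_(m in [set m | (N <= m)%N]) \bigcup_(n in [set n | (N <= n)%N]) D m n.
have oO N : open (O N) by apply: bigcup_open => m _; exact: bigcup_open.
have [||N ON] := @cap_continuous _ _ c c_cap O W d oO _ oW _ d0.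
- move=> m n mn x [i /= ni [j /= nj Dx]]; exists i; first exact: leq_trans ni.
  by exists j => //; exact: leq_trans nj.
- move=> x Ox; apply: contrapT => nWx.
  have /cvg_nrmP /(_ (d / 2)) := f_cvg x; rewrite divr_gt0// => /(_ isT) [N Nf].
  have [m /= Nm [n /= Nn]] := Ox N I; rewrite /D/= ltNge => /negP; apply.
  have fmn : nrm (f_ m x - f_ n x) <= d.
    rewrite (le_trans (nrm_triangle (f x) _ _))// (splitr d) lerD//; last rewrite nrmC.
      by apply/ltW; exact: Nf.
    by apply/ltW; exact: Nf.
  rewrite (le_trans (nrm_triangle (f_ m x) _ _))//.
  rewrite (le_trans (lerD (lexx _) (nrm_triangle (f_ n x) _ _)))//.
  by have := fg m x nWx; have := fg n x nWx; rewrite (nrmC (g m x)); lra.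
have fng n x : (N <= n)%N -> ~ (W `|` O N) x -> nrm (f_ n x - g N x) <= e.
  move=> Nn /not_orP [nWx nOx].
  have : nrm (g n x - g N x) <= 3 * d.
    by rewrite leNgt; apply/negP => Dx; apply: nOx; exists n => //; exists N => /=.
  move=> h; rewrite (le_trans (nrm_triangle (g n x) _ _))//.
  by have := fg n x nWx; move: h; rewrite /d; lra.
exists N, (g N), (W `|` O N); split=> //; first exact: openU.
- by rewrite (le_trans (capU c_cap oW (oO N)))//; move: ON cW; rewrite /d; lra.
- move=> x nWx; apply/ler_addgt0Pr => t t0.
  have /cvg_nrmP /(_ t t0) [N' N'f] := f_cvg x.
  have := fng _ x (leq_maxl N N') nWx; have := N'f _ (leq_maxr N N').
  move=> h1 h2; rewrite (le_trans (nrm_triangle (f_ (maxn N N') x) _ _))// addrC lerD//.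
  by rewrite nrmC ltW.
Qed.

(** The domain on which the calculus is built. It contains [C0] and the bounded Borel functions and
    is closed under sums, products, conjugation and bounded pointwise limits; quantifying over all
    capacities makes it independent of the vector. *)
Definition quasicontinuous f : Prop :=
  (exists2 M : R, 0 <= M & forall x, nrm (f x) <= M) /\
  forall c, capacity c -> Lusin c f.

Lemma bounded_borel_quasicontinuous f : bounded_borel f -> quasicontinuous f.
Proof.
move=> bf; split; last by move=> c c_cap; exact: Lusin_bounded_borel.
have [[M fM] _] := bf; exists `|complex.Re M| => // x.
by have := fM x; rewrite nrmE lecE => /andP[_ /= /le_trans]; apply; exact: ler_norm.
Qed.

Lemma C0_quasicontinuous f : C0 f -> quasicontinuous f.
Proof.
by move=> f0; split; [exact: C0_bounded|move=> c c_cap; exact: C0_Lusin].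
Qed.

Lemma quasicontinuous_lim (f_ : nat -> X -> R[i]) f (M : R) : 0 <= M ->
  (forall n, quasicontinuous (f_ n)) -> (forall n x, nrm (f_ n x) <= M) ->
  (forall x, (f_ n x : R[i]^o) @[n --> \oo] --> (f x : R[i]^o)) -> quasicontinuous f.
Proof.
move=> M0 fi fM f_cvg; split.
  exists M => // x; apply/ler_addgt0Pl => e e0.
  have /cvg_nrmP /(_ e e0) [N /(_ N (leqnn N))] := f_cvg x.
  by have := nrm_sub_ge (f x) (f_ N x); have := fM N x; rewrite (nrmC (f x)); lra.
move=> c c_cap e e0.
have [|N [g [W [g0 oW cW fg _]]]] := Egorov c_cap _ f_cvg e0.
  by move=> n; case: (fi n) => _; apply.
by exists g, W.
Qed.

Lemma quasicontinuousD f g : quasicontinuous f -> quasicontinuous g -> quasicontinuous (fun x => f x + g x).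
Proof.
move=> [[M M0 fM] Lf] [[N N0 gN] Lg]; split.
  exists (M + N); first exact: addr_ge0.
  by move=> x; rewrite (le_trans (nrmD _ _))// lerD.
by move=> c c_cap; apply: LusinD => //; [exact: Lf|exact: Lg].
Qed.

Lemma quasicontinuousZ (a : R[i]) f : quasicontinuous f -> quasicontinuous (fun x => a * f x).
Proof.
move=> [[M M0 fM] Lf]; split; last by move=> c c_cap; apply: LusinZ; exact: Lf.
exists (nrm a * M); first by rewrite mulr_ge0// nrm_ge0.
by move=> x; rewrite nrmM ler_wpM2l// nrm_ge0.
Qed.

(** The bound [M] on the approximant is part of the data because the exceptional set contributes its
    capacity times the sup norm. *)
Definition lusin_pair (c : set X -> R) f (M e : R) g U : Prop :=
  [/\ C0 g, forall x, nrm (g x) <= M, open U, c U <= e &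
      forall x, ~ U x -> nrm (f x - g x) <= e].

Lemma lusin_pair_exists c f (M e : R) : capacity c -> quasicontinuous f ->
  0 <= M -> (forall x, nrm (f x) <= M) -> 0 < e -> exists g U, lusin_pair c f M e g U.
Proof. by move=> c_cap [_ Lf] M0 fM e0; apply: Lusin_truncate => //; exact: Lf. Qed.

Lemma lusin_pair_le c c' f (M M' e e' : R) g U :
  (forall V, c' V <= c V) -> M <= M' -> e <= e' ->
  lusin_pair c f M e g U -> lusin_pair c' f M' e' g U.
Proof.
move=> cc MM ee [g0 gM oU cU fg]; split=> //.
- by move=> x; rewrite (le_trans (gM x)).
- by rewrite (le_trans (cc U))// (le_trans cU).
- by move=> x /fg /le_trans; apply.
Qed.

(** The difference of the approximants is at most [2 * e] off a set of capacity at most [2 * e] and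
    at most [M + M'] on it; [capacity_key] combines the two. *)
Lemma lusin_pair_close f (M M' e : R) g g' U U' v : 0 <= M -> 0 <= M' -> 0 < e ->
  lusin_pair (cap v) f M e g U -> lusin_pair (cap v) f M' e g' U' ->
  nrm (rho g v - rho g' v) <= 2 * (nrm v + M + M') * e.
Proof.
move=> M0 M'0 e0 [g0 gM oU cU fg] [g'0 g'M oU' cU' fg'].
have v_cap := rho_capacityP v.
rewrite -rhoB//.
have := @capacity_key _ _ _ _ rho_star v (U `|` U') (fun x => g x - g' x) (2 * e) (M + M').
have e20 : 0 <= 2 * e by rewrite mulr_ge0// ltW.
move=> /(_ (C0B g0 g'0) e20 (addr_ge0 M0 M'0)) h.
apply: (le_trans (h _ _)).
- by move=> x; rewrite (le_trans (nrmB _ _))// lerD.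
- move=> x /not_orP [/fg fgx /fg' fg'x]; rewrite (le_trans (nrm_triangle (f x) _ _))//.
  by rewrite nrmC; lra.
have : cap v (U `|` U') <= 2 * e by have := capU v_cap oU oU'; lra.
move=> /(ler_wpM2l (addr_ge0 M0 M'0)); lra.
Qed.

Definition borel_value f v w : Prop :=
  exists2 M : R, 0 <= M & forall e : R, 0 < e ->
    exists g U, lusin_pair (cap v) f M e g U /\ nrm (w - rho g v) <= e.

(** Frees the value from the approximants that define it: every other family, with its own bound
    [M], converges to [w] at a linear rate whose constant does not depend on [e]. *)
Lemma borel_value_close f v w (M : R) : 0 <= M -> borel_value f v w ->
  exists C : R, forall e g U, 0 < e -> lusin_pair (cap v) f M e g U ->
    nrm (w - rho g v) <= C * e.
Proof.
move=> M0 [M' M'0 fw]; exists (1 + 2 * (nrm v + M' + M)) => e g U e0 gU.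
have [g' [U' [g'U' wg']]] := fw _ e0.
rewrite (le_trans (nrm_triangle (rho g' v) _ _))// mulrDl mul1r lerD//.
exact: lusin_pair_close g'U' gU.
Qed.

Lemma borel_value_exists f v : quasicontinuous f -> exists w, borel_value f v w.
Proof.
move=> fi; have [[M M0 fM] _] := fi; have v_cap := rho_capacityP v.
have n0 n : 0 < (n.+1%:R : R)^-1 by rewrite invr_gt0 ltr0n.
have /choice [g gP] n := lusin_pair_exists v_cap fi M0 fM (n0 n).
have /choice [U gU] := gP.
have inv_small (e : R) : 0 < e -> exists N, forall n, (N <= n)%N -> (n.+1%:R : R)^-1 < e.
  move=> e0; exists (Num.truncn e^-1) => n Nn.
  rewrite invf_plt ?posrE ?ltr0n//; have /andP[_ h] : (Num.truncn e^-1)%:R <= e^-1 < (Num.truncn e^-1).+1%:R.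
    by rewrite truncn_itv// ltW// invr_gt0.
  by rewrite (lt_le_trans h)// ler_nat ltnS.
have [|w wP] := @complete_nrmP _ _ (fun n => rho (g n) v).
  move=> e e0; have C0 : 0 < 2 * (nrm v + M + M) + 1.
    by have := nrm_ge0 v; lra.
  have [N Ne] := inv_small _ (divr_gt0 e0 C0); exists N => m n Nm Nn.
  have lt1 := Ne N (leqnn N); rewrite ltr_pdivlMr// in lt1.
  apply: le_lt_trans lt1; rewrite mulrC.
  apply: (@le_trans _ _ (2 * (nrm v + M + M) * (N.+1%:R)^-1)).
    apply: lusin_pair_close => //.
      by apply: lusin_pair_le (gU m) => //; rewrite lef_pV2 ?posrE ?ltr0n// ler_nat.
    by apply: lusin_pair_le (gU n) => //; rewrite lef_pV2 ?posrE ?ltr0n// ler_nat.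
  by rewrite ler_wpM2r ?invr_ge0// lerDl.
exists w; exists M => // e e0; have [N Ne] := inv_small _ e0.
move/cvg_nrmP: wP => /(_ e e0) [N' N'w]; pose n := maxn N N'.
exists (g n), (U n); split.
  by apply: lusin_pair_le (gU n) => //; apply: ltW; apply: Ne; exact: leq_maxl.
by rewrite nrmC ltW//; apply: N'w; exact: leq_maxr.
Qed.

Definition borel_calculus f v : H := xget 0 (borel_value f v).
Local Notation phi := borel_calculus.

Lemma borel_calculusP f v : quasicontinuous f -> borel_value f v (phi f v).
Proof. by move=> /(borel_value_exists v) [w fw]; exact: (xgetPex 0 (ex_intro _ w fw)). Qed.

Lemma borel_calculus_close f v (M : R) : quasicontinuous f -> 0 <= M ->
  exists C : R, forall e g U, 0 < e -> lusin_pair (cap v) f M e g U ->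
    nrm (phi f v - rho g v) <= C * e.
Proof. by move=> /(borel_calculusP v) fv M0; exact: borel_value_close. Qed.

(** For linearity, where the same approximant must serve [v], [w] and [a *: v + w]. *)
Lemma borel_calculus_approx3 f (M : R) v1 v2 v3 : quasicontinuous f -> 0 <= M ->
  (forall x, nrm (f x) <= M) ->
  exists C : R, 0 <= C /\ forall e : R, 0 < e -> exists g U,
    [/\ lusin_pair (fun V => cap v1 V + cap v2 V + cap v3 V) f M e g U,
       nrm (phi f v1 - rho g v1) <= C * e, nrm (phi f v2 - rho g v2) <= C * e &
       nrm (phi f v3 - rho g v3) <= C * e].
Proof.
move=> fi M0 fM.
have [C1 f1] := borel_calculus_close v1 fi M0.
have [C2 f2] := borel_calculus_close v2 fi M0.
have [C3 f3] := borel_calculus_close v3 fi M0.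
have c_cap := capacityD (capacityD (rho_capacityP v1) (rho_capacityP v2)) (rho_capacityP v3).
exists (`|C1| + `|C2| + `|C3|); split; first by rewrite !addr_ge0.
move=> e e0; have [g [U gU]] := lusin_pair_exists c_cap fi M0 fM e0.
exists g, U; split=> //.
- apply: (le_trans (f1 e g U e0 _)).
    by apply: lusin_pair_le gU => // V; rewrite -addrA lerDl addr_ge0 ?capacity_ge0.
  by rewrite ler_pM2r//; have := ler_norm C1; have := normr_ge0 C2; have := normr_ge0 C3; lra.
- apply: (le_trans (f2 e g U e0 _)).
    by apply: lusin_pair_le gU => // V; rewrite addrAC lerDr addr_ge0 ?capacity_ge0.
  by rewrite ler_pM2r//; have := ler_norm C2; have := normr_ge0 C1; have := normr_ge0 C3; lra.
- apply: (le_trans (f3 e g U e0 _)).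
    by apply: lusin_pair_le gU => // V; rewrite lerDr addr_ge0 ?capacity_ge0.
  by rewrite ler_pM2r//; have := ler_norm C3; have := normr_ge0 C1; have := normr_ge0 C2; lra.
Qed.

Lemma borel_calculus_lin f : quasicontinuous f -> linear (phi f).
Proof.
move=> fi a v w; have [[M M0 fM] _] := fi.
have [C [C0 happ]] := borel_calculus_approx3 (a *: v + w) v w fi M0 fM.
apply/eqP; rewrite -subr_eq0; apply/eqP.
apply: (@nrm_eps0 _ _ _ (C + (nrm a * C + C))) => e /happ [g [U [[g0 _ _ _ _] h1 h2 h3]]].
have -> : phi f (a *: v + w) - (a *: phi f v + phi f w) =
    (phi f (a *: v + w) - rho g (a *: v + w)) -
    (a *: (phi f v - rho g v) + (phi f w - rho g w)).
  rewrite (rho_lin rho_star g0) scalerBr [in RHS]addrACA -opprD opprB addrA.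
  by rewrite subrK.
rewrite (le_trans (nrmB _ _))// mulrDl lerD//.
rewrite (le_trans (nrmD _ _))// mulrDl lerD// nrmZ -mulrA.
by rewrite ler_wpM2l ?nrm_ge0.
Qed.

(** The estimate of [capacity_key] survives the passage to the limit. With [W] empty it is
    contractivity; with the exceptional set of [Egorov] it gives convergence. *)
Lemma borel_calculus_bound f (d M : R) (W : set X) v : quasicontinuous f ->
  0 <= d -> 0 <= M -> open W ->
  (forall x, nrm (f x) <= M) -> (forall x, ~ W x -> nrm (f x) <= d) ->
  nrm (phi f v) <= d * nrm v + M * cap v W.
Proof.
move=> fi d0 M0 oW fM fd.
have [C fC] := borel_calculus_close v fi M0.
have v_cap := rho_capacityP v.
apply/ler_addgt0Pr => t t0.
have D0 : 0 < `|C| + nrm v + M + 1 by have := nrm_ge0 v; have := normr_ge0 C; lra.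
pose e := t / (`|C| + nrm v + M + 1); have e0 : 0 < e by rewrite divr_gt0.
have [g [U gU]] := lusin_pair_exists v_cap fi M0 fM e0.
have := fC e g U e0 gU; case: gU => g0 gM oU cU fg fgC.
have key : nrm (rho g v) <= (d + e) * nrm v + M * cap v (W `|` U).
  apply: capacity_key => //; first by rewrite addr_ge0// ltW.
  move=> x /not_orP [/fd fx /fg fgx].
  by have := nrm_sub_ge (g x) (f x); rewrite (nrmC (g x)); lra.
have := ler_wpM2l M0 (capU v_cap oW oU); have := ler_wpM2l M0 cU.
have := nrm_sub_ge (phi f v) (rho g v).
have : e * (`|C| + nrm v + M) <= t.
  by rewrite -[leRHS](divfK (lt0r_neq0 D0)) -/e ler_pM2l// lerDl.
have : C * e <= `|C| * e by rewrite ler_pM2r// ler_norm.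
lra.
Qed.

Lemma borel_calculus_contractive f (M : R) v : quasicontinuous f ->
  0 <= M -> (forall x, nrm (f x) <= M) -> nrm (phi f v) <= M * nrm v.
Proof.
move=> fi M0 fM; have := @borel_calculus_bound f M M set0 v fi M0 M0 (@open0 X) fM.
by rewrite (cap_set0 (rho_capacityP v)) mulr0 addr0; apply.
Qed.

Lemma borel_calculus_bounded f : quasicontinuous f -> bounded_operator (phi f).
Proof.
move=> fi; split; first exact: borel_calculus_lin.
have [[M M0 fM] _] := fi; apply: (lin_bound_continuous (borel_calculus_lin fi) M0).
by move=> v; exact: borel_calculus_contractive.
Qed.

Lemma borel_calculus_C0 f : C0 f -> phi f = rho f.
Proof.
move=> f0; have fi := C0_quasicontinuous f0; have [[M M0 fM] _] := fi.
apply/funext => v; have [C fC] := borel_calculus_close v fi M0.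
apply/eqP; rewrite -subr_eq0; apply/eqP.
apply: (@nrm_eps0 _ _ _ C) => e e0; apply: (fC e f set0) => //; split=> //.
- exact: open0.
- by rewrite (cap_set0 (rho_capacityP v)) ltW.
- by move=> x _; rewrite subrr nrm0 ltW.
Qed.

Lemma borel_calculusD f g : quasicontinuous f -> quasicontinuous g ->
  phi (fun x => f x + g x) = (fun v => phi f v + phi g v).
Proof.
move=> fi gi; have [[M M0 fM] _] := fi; have [[N N0 gN] _] := gi; apply/funext => v.
have v_cap := rho_capacityP v.
have [C1 fC] := borel_calculus_close v fi M0.
have [C2 gC] := borel_calculus_close v gi N0.
have [C fgC] := borel_calculus_close v (quasicontinuousD fi gi) (addr_ge0 M0 N0).
apply/eqP; rewrite -subr_eq0; apply/eqP.
apply: (@nrm_eps0 _ _ _ (C * 2 + (C1 + C2))) => e e0.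
have [f' [U fU]] := lusin_pair_exists v_cap fi M0 fM e0.
have [g' [V gV]] := lusin_pair_exists v_cap gi N0 gN e0.
have := fC e f' U e0 fU; have := gC e g' V e0 gV.
case: fU gV => f'0 f'M oU cU ff' [g'0 g'N oV cV gg'] gle fle.
have := fgC (2 * e) (fun x => f' x + g' x) (U `|` V); rewrite mulr_gt0// => /(_ isT) h.
have {}h : nrm (phi (fun x => f x + g x) v - rho (fun x => f' x + g' x) v) <= C * (2 * e).
  apply: h; split; [exact: C0D| |exact: openU| |].
  - by move=> x; rewrite (le_trans (nrmD _ _))// lerD.
  - by have := capU v_cap oU oV; lra.
  move=> x /not_orP [/ff' fx /gg' gx]; rewrite opprD addrACA.
  by rewrite (le_trans (nrmD _ _))//; lra.
move: h; rewrite (rhoD rho_star)// => h.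
rewrite (le_trans (nrm_triangle (rho f' v + rho g' v) _ _))// mulrDl lerD//.
  by rewrite -mulrA.
rewrite opprD addrACA (le_trans (nrmD _ _))// mulrDl lerD// nrmC//.
Qed.

Lemma borel_calculusZ (a : R[i]) f : quasicontinuous f ->
  phi (fun x => a * f x) = (fun v => a *: phi f v).
Proof.
move=> fi; have [[M M0 fM] _] := fi; apply/funext => v.
have v_cap := rho_capacityP v.
have a0 := nrm_ge0 a; have aM0 : 0 <= nrm a * M by exact: mulr_ge0.
have [C1 fC] := borel_calculus_close v fi M0.
have [C afC] := borel_calculus_close v (quasicontinuousZ a fi) aM0.
apply/eqP; rewrite -subr_eq0; apply/eqP.
apply: (@nrm_eps0 _ _ _ (C * (nrm a + 1) + nrm a * C1)) => e e0.
have [f' [U fU]] := lusin_pair_exists v_cap fi M0 fM e0.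
have := fC e f' U e0 fU; case: fU => f'0 f'M oU cU ff' fle.
have e'0 : 0 < (nrm a + 1) * e by rewrite mulr_gt0// ltr_wpDl.
have := afC _ (fun x => a * f' x) U e'0; rewrite (rhoZ rho_star)// => h.
have {}h : nrm (phi (fun x => a * f x) v - a *: rho f' v) <= C * ((nrm a + 1) * e).
  apply: h; split; [exact: C0Z| |exact: oU| |].
  - by move=> x; rewrite nrmM ler_wpM2l.
  - by rewrite (le_trans cU)// ler_peMl ?(ltW e0)// lerDr.
  move=> x /ff' fx; rewrite -mulrBr nrmM.
  by have := ler_wpM2l a0 fx; lra.
rewrite (le_trans (nrm_triangle (a *: rho f' v) _ _))// mulrDl lerD//.
  by rewrite -mulrA.
by rewrite -scalerBr nrmZ -mulrA ler_wpM2l// nrmC.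
Qed.

Lemma borel_calculus_approx1 c f (M : R) v : capacity c -> (forall V, cap v V <= c V) ->
  quasicontinuous f -> 0 <= M -> (forall x, nrm (f x) <= M) ->
  exists C : R, 0 <= C /\ forall e : R, 0 < e -> exists g U,
    lusin_pair c f M e g U /\ nrm (phi f v - rho g v) <= C * e.
Proof.
move=> c_cap vc fi M0 fM; have [C fC] := borel_calculus_close v fi M0.
exists `|C|; split=> // e e0; have [g [U gU]] := lusin_pair_exists c_cap fi M0 fM e0.
exists g, U; split=> //; apply: (le_trans (fC e g U e0 _)).
  exact: lusin_pair_le gU.
by rewrite ler_pM2r// ler_norm.
Qed.

(** In the factor [M + N + 2], the product rule for differences accounts for [M + N] and the two
    exceptional sets for 2. *)
Lemma lusin_pairM c f g (M N e : R) f' g' U V : capacity c -> 0 <= M -> 0 <= N -> 0 < e ->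
  (forall x, nrm (f x) <= M) ->
  lusin_pair c f M e f' U -> lusin_pair c g N e g' V ->
  lusin_pair c (fun x => f x * g x) (M * N) ((M + N + 2) * e)
    (fun x => f' x * g' x) (U `|` V).
Proof.
move=> c_cap M0 N0 e0 fM [f'0 f'M oU cU ff'] [g'0 g'N oV cV gg']; split.
- exact: C0M.
- by move=> x; rewrite nrmM ler_pM ?nrm_ge0.
- exact: openU.
- rewrite (le_trans (capU c_cap oU oV))//; have : 0 <= (M + N) * e by rewrite mulr_ge0 ?addr_ge0// ltW.
  lra.
move=> x /not_orP [/ff' fx /gg' gx].
have -> : f x * g x - f' x * g' x = f x * (g x - g' x) + (f x - f' x) * g' x.
  by rewrite mulrBr mulrBl addrA subrK.
rewrite (le_trans (nrmD _ _))// !nrmM.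
have : nrm (f x) * nrm (g x - g' x) <= M * e by rewrite ler_pM ?nrm_ge0.
have : nrm (f x - f' x) * nrm (g' x) <= e * N by rewrite ler_pM ?nrm_ge0.
lra.
Qed.

Lemma quasicontinuousM f g : quasicontinuous f -> quasicontinuous g -> quasicontinuous (fun x => f x * g x).
Proof.
move=> [[M M0 fM] Lf] [[N N0 gN] Lg]; split.
  by exists (M * N); [exact: mulr_ge0|move=> x; rewrite nrmM ler_pM ?nrm_ge0].
move=> c c_cap e e0.
have D0 : 0 < M + N + 2 by lra.
have d0 : 0 < e / (M + N + 2) by rewrite divr_gt0.
have [f' [U fU]] := Lusin_truncate c_cap (Lf c c_cap) fM M0 d0.
have [g' [V gV]] := Lusin_truncate c_cap (Lg c c_cap) gN N0 d0.
have := lusin_pairM c_cap M0 N0 d0 fM fU gV.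
rewrite [(M + N + 2) * _]mulrC divfK ?gt_eqF// => -[? ? ? ? ?].
by exists (fun x => f' x * g' x), (U `|` V).
Qed.

Lemma borel_calculusM f g : quasicontinuous f -> quasicontinuous g ->
  phi (fun x => f x * g x) = phi f \o phi g.
Proof.
move=> fi gi; have [[M M0 fM] _] := fi; have [[N N0 gN] _] := gi; apply/funext => v /=.
set u := phi g v.
(* The approximant of [f] acts on [u = phi g v], whereas the product of the approximants acts on
   [v]; hence both capacities. *)
have c_cap := capacityD (rho_capacityP v) (rho_capacityP u).
have vc V : cap v V <= cap v V + cap u V by rewrite lerDl capacity_ge0.
have uc V : cap u V <= cap v V + cap u V by rewrite lerDr capacity_ge0.
have [C1 [C10 fC]] := borel_calculus_approx1 c_cap uc fi M0 fM.
have [C2 [C20 gC]] := borel_calculus_approx1 c_cap vc gi N0 gN.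
have [C fgC] := borel_calculus_close v (quasicontinuousM fi gi) (mulr_ge0 M0 N0).
apply/eqP; rewrite -subr_eq0; apply/eqP.
apply: (@nrm_eps0 _ _ _ (C * (M + N + 2) + (C1 + M * C2))) => e e0.
have [f' [U [fU fle]]] := fC e e0; have [g' [V [gV gle]]] := gC e e0.
have e'0 : 0 < (M + N + 2) * e by rewrite mulr_gt0//; lra.
have := fgC _ _ _ e'0 (lusin_pair_le vc (lexx _) (lexx _) (lusin_pairM c_cap M0 N0 e0 fM fU gV)).
have f'0 : C0 f' by case: fU. have g'0 : C0 g' by case: gV.
have f'M : forall x, nrm (f' x) <= M by case: fU.
rewrite (rhoM rho_star)// => h.
rewrite (le_trans (nrm_triangle (rho f' (rho g' v)) _ _))// mulrDl lerD//.
  by rewrite -mulrA.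
rewrite (le_trans (nrm_triangle (rho f' u) _ _))// addrC mulrDl lerD//.
  by rewrite nrmC.
rewrite -(linB (rho_lin rho_star f'0)) -mulrA.
rewrite (le_trans (rho_contractive rho_star _ f'0 M0 f'M))//.
by rewrite ler_wpM2l// nrmC.
Qed.

Lemma quasicontinuous_conj f : quasicontinuous f -> quasicontinuous (fun x => (f x)^*).
Proof.
move=> [[M M0 fM] Lf]; split; first by exists M => // x; rewrite nrm_conj.
move=> c c_cap e e0; have [g [U [g0 oU cU fg]]] := Lf c c_cap e e0.
exists (fun x => (g x)^*), U; split=> //; first exact: C0_conj.
by move=> x /fg; rewrite -rmorphB nrm_conj.
Qed.

Lemma borel_calculus_adj f : quasicontinuous f ->
  is_adjoint (phi f) (phi (fun x => (f x)^*)).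
Proof.
move=> fi v w; have [[M M0 fM] _] := fi.
have c_cap := capacityD (rho_capacityP v) (rho_capacityP w).
have vc V : cap v V <= cap v V + cap w V by rewrite lerDl capacity_ge0.
have wc V : cap w V <= cap v V + cap w V by rewrite lerDr capacity_ge0.
have [C1 [C10 fC]] := borel_calculus_approx1 c_cap vc fi M0 fM.
have [C fcC] := borel_calculus_close w (quasicontinuous_conj fi) M0.
apply/eqP; rewrite -subr_eq0; apply/eqP.
apply: (@nrm_eps0 _ _ _ (C1 * nrm w + nrm v * C)) => e e0.
have [g [U [gU gle]]] := fC e e0; have g0 : C0 g by case: gU.
have := fcC e (fun x => (g x)^*) U e0.
have gcU : lusin_pair (cap w) (fun x => (f x)^*) M e (fun x => (g x)^*) U.
  case: gU => _ gM oU cU fg; split=> //.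
  - exact: C0_conj.
  - by move=> x; rewrite nrm_conj.
  - exact: le_trans (wc U) cU.
  - by move=> x /fg; rewrite -rmorphB nrm_conj.
move=> /(_ gcU) gcle.
rewrite (le_trans (nrm_triangle (inner H (rho g v) w) _ _))// mulrDl lerD//.
  rewrite -innerBl (le_trans (Cauchy_Schwarz _ _))// mulrAC.
  by rewrite ler_wpM2r ?nrm_ge0.
rewrite (rho_adj rho_star)// -innerBr (le_trans (Cauchy_Schwarz _ _))// -mulrA.
by rewrite ler_wpM2l ?nrm_ge0// nrmC.
Qed.

(** By [Egorov], [f_ n] and [f] are eventually both within [d] of one [g] off [W], so their
    difference is at most [2 * d] there and at most [M + N] on [W]. *)
Lemma borel_calculus_cvg (f_ : nat -> X -> R[i]) f (M : R) v : 0 <= M ->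
  (forall n, quasicontinuous (f_ n)) -> (forall n x, nrm (f_ n x) <= M) ->
  (forall x, (f_ n x : R[i]^o) @[n --> \oo] --> (f x : R[i]^o)) ->
  phi (f_ n) v @[n --> \oo] --> phi f v.
Proof.
move=> M0 f_i f_M f_cvg; have fi := quasicontinuous_lim M0 f_i f_M f_cvg.
have [[N N0 fN] _] := fi; apply/cvg_nrmP => e e0.
have D0 : 0 < 2 * nrm v + (M + N) + 1 by have := nrm_ge0 v; lra.
pose d := e / (2 * nrm v + (M + N) + 1); have d0 : 0 < d by rewrite divr_gt0.
have v_cap := rho_capacityP v.
have [|K [g [W [g0 oW cW fg f_g]]]] := Egorov v_cap _ f_cvg d0.
  by move=> n; case: (f_i n) => _; apply.
exists K => n Kn.
have -> : phi (f_ n) v - phi f v = phi (fun x => f_ n x + -1 * f x) v.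
  rewrite borel_calculusD//; last exact: quasicontinuousZ.
  by rewrite borel_calculusZ// scaleN1r.
have d20 : 0 <= 2 * d by rewrite mulr_ge0// ltW.
have := @borel_calculus_bound (fun x => f_ n x + -1 * f x) (2 * d) (M + N) W v.
move=> /(_ (quasicontinuousD (f_i n) (quasicontinuousZ (-1) fi)) d20 (addr_ge0 M0 N0) oW) h.
apply: le_lt_trans (h _ _) _.
- by move=> x; rewrite mulN1r (le_trans (nrmB _ _))// lerD.
- move=> x nWx; rewrite mulN1r (le_trans (nrm_triangle (g x) _ _))//.
  by have := fg x nWx; have := f_g n x Kn nWx; rewrite (nrmC (f x)); lra.
have := ler_wpM2l (addr_ge0 M0 N0) cW.
have : d * (2 * nrm v + (M + N)) < e.
  by rewrite -[ltRHS](divfK (lt0r_neq0 D0)) -/d ltr_pM2l// ltrDl.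
lra.
Qed.

End FunctionalCalculus.

Lemma borel_extension_exists {R : realType} {X : metricType R} (H : xmodule X) :
  proper_metric X -> exists phi, borel_extension H phi.
Proof.
move=> Xproper; have rho_star := rep_star H.
have bi (f : X -> R[i]) : bounded_borel f -> quasicontinuous f by exact: (bounded_borel_quasicontinuous Xproper).
exists (borel_calculus (rep H)); split.
- split.
  + by move=> f /bi; exact: borel_calculus_bounded.
  + by move=> f g /bi fi /bi gi; exact: borel_calculusD.
  + by move=> c f /bi fi; exact: borel_calculusZ.
  + by move=> f g /bi fi /bi gi; exact: borel_calculusM.
  + by move=> f /bi; exact: borel_calculus_adj.
- by move=> f; exact: borel_calculus_C0.
- move=> f_ f M f_b f_M f_cvg v.
  apply: (@borel_calculus_cvg _ _ _ _ _ _ f_ f `|complex.Re M|) => // [n|n x]; first exact: bi.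
  by have := f_M n x; rewrite nrmE lecE => /andP[_ /= /le_trans]; apply; exact: ler_norm.
Qed.

(** * Spectral projections and compact operators *)

Section BorelModule.
Context {R : realType} {X : metricType R} (H : xmodule X).
Hypothesis Xproper : proper_metric X.
Local Notation toC := (real_complex R).
Local Notation phi := (borel_rep H).

Lemma borel_repP : borel_extension H phi.
Proof.
have [psi psiP] := borel_extension_exists H Xproper.
exact: (xgetPex _ (ex_intro _ psi psiP)).
Qed.

Lemma bounded_borel_indic (A : set X) :
  borel_set A -> bounded_borel (\1_A : X -> R[i]).
Proof.
move=> bA; split.
  by exists 1 => x; rewrite indicE; case: (x \in A); rewrite ?normr1 ?normr0.
move=> U _; have -> : (\1_A : X -> R[i]) @^-1` U =
    ((A `&` [set _ | U 1]) `|` (~` A `&` [set _ | U 0])).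
  apply/seteqP; split=> x; rewrite /= indicE.
    by have [Ax|nAx] := pselect (A x); [rewrite mem_set//; left|rewrite memNset//; right].
  by move=> [[Ax ?]|[nAx ?]]; [rewrite mem_set|rewrite memNset].
have cst (P : Prop) : borel_set [set _ : X | P].
  have [p|np] := pselect P.
    rewrite [X in borel_set X](_ : _ = setT); first exact: borel_setT.
    by apply/seteqP; split.
  rewrite [X in borel_set X](_ : _ = set0); first exact: borel_set0.
  by apply/seteqP; split.
by apply: borel_setU; apply: borel_setI => //; exact: borel_setC.
Qed.

Lemma C0_bounded_borel (f : X -> R[i]) : C0 f -> bounded_borel f.
Proof.
move=> f0; have [M M0 fM] := C0_bounded f0; split.
  by exists (toC M) => x; rewrite nrm_leP.
by move=> U oU; apply: borel_open; apply: open_comp => // x _; exact: f0.1.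
Qed.

Lemma phiM f g : bounded_borel f -> bounded_borel g ->
  phi (fun x => f x * g x) = phi f \o phi g.
Proof. by case: borel_repP => -[_ _ _ + _] _ _; apply. Qed.

Lemma phiD f g : bounded_borel f -> bounded_borel g ->
  phi (fun x => f x + g x) = (fun v => phi f v + phi g v).
Proof. by case: borel_repP => -[_ + _ _ _] _ _; apply. Qed.

Lemma phi_C0 f : C0 f -> phi f = rep H f.
Proof. by case: borel_repP => _ + _; apply. Qed.

Lemma chi_bounded (A : set X) : borel_set A -> bounded_operator (chi H A).
Proof.
by move=> /bounded_borel_indic; case: borel_repP => -[+ _ _ _ _] _ _; apply.
Qed.

Lemma chi_lin (A : set X) : borel_set A -> linear (chi H A).
Proof. by move=> /chi_bounded[]. Qed.

Lemma chi_chi (A B : set X) v : borel_set A -> borel_set B ->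
  chi H A (chi H B v) = chi H (A `&` B) v.
Proof.
move=> bA bB; have := phiM (bounded_borel_indic bA) (bounded_borel_indic bB).
rewrite /chi => /(congr1 (@^~ v)) /= <-; congr (phi _ v).
by apply/funext => x; rewrite !indicE in_setI -natrM mulnb.
Qed.

Lemma chi_adj (A : set X) v w : borel_set A ->
  inner H (chi H A v) w = inner H v (chi H A w).
Proof.
move=> /bounded_borel_indic bA; case: borel_repP => -[_ _ _ _ +] _ _.
move=> /(_ _ bA v w) ->; rewrite /chi; congr (inner H v (phi _ w)).
by apply/funext => x; rewrite indicE conjC_nat.
Qed.

Lemma chi_le (A : set X) v : borel_set A -> nrm (chi H A v) <= nrm v.
Proof.
move=> bA; have [v0|v0] := eqVneq (nrm (chi H A v)) 0; first by rewrite v0 nrm_ge0.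
have vpos : 0 < nrm (chi H A v) by rewrite lt_neqAle eq_sym v0 nrm_ge0.
rewrite -(ler_pM2l vpos); apply: le_trans (Cauchy_Schwarz _ _).
have := inner_nrm (chi H A v); rewrite [in LHS]innerC chi_adj// chi_chi// setIid.
rewrite -innerC => ->; rewrite nrm_toC expr2 ger0_norm//.
by rewrite mulr_ge0 ?nrm_ge0.
Qed.

Lemma chi_rep (A : set X) f v : borel_set A -> C0 f ->
  (forall x, ~ A x -> f x = 0) -> chi H A (rep H f v) = rep H f v.
Proof.
move=> bA f0 fA; have := phiM (bounded_borel_indic bA) (C0_bounded_borel f0).
rewrite /chi -(phi_C0 f0) => /(congr1 (@^~ v)) /= <-; congr (phi _ v).
apply/funext => x; rewrite indicE; have [Ax|nAx] := pselect (A x).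
  by rewrite mem_set// mul1r.
by rewrite fA// mulr0.
Qed.

Lemma rep_chi (A : set X) f v : borel_set A -> C0 f ->
  (forall x, A x -> f x = 1) -> rep H f (chi H A v) = chi H A v.
Proof.
move=> bA f0 fA; have := phiM (C0_bounded_borel f0) (bounded_borel_indic bA).
rewrite /chi -(phi_C0 f0) => /(congr1 (@^~ v)) /= <-; congr (phi _ v).
apply/funext => x; rewrite indicE; have [Ax|nAx] := pselect (A x).
  by rewrite mem_set// mulr1 fA.
by rewrite memNset// mulr0.
Qed.

(** Follows from non-degeneracy: the identity holds on the vectors [rep H f w], and contractivity
    extends it to limits of their combinations. *)
Lemma chi_setT v : chi H setT v = v.
Proof.
have lT := chi_lin (@borel_setT R X).
apply/eqP; rewrite -subr_eq0; apply/eqP; apply: (@nrm_eps0 _ _ _ 2) => e e0.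
have /dense_nrmP /(_ v e e0) [a [n [c [u [uP ->]]]]] := @rep_nondegenerate _ _ H.
set s := \sum_i _ => /ltW ve.
have -> : chi H setT v - v = chi H setT (v - s) - (v - s).
  rewrite (linB lT) opprB addrA; congr (_ - v).
  rewrite [X in _ - X](_ : _ = s) ?subrK// lin_sum//; apply: eq_bigr => i _.
  rewrite (linZ lT); have [f f0 [w ->]] := uP i.
  by rewrite (chi_rep _ (@borel_setT R X) f0)// => x [].
rewrite (le_trans (nrmB _ _))//; have := chi_le (v - s) (@borel_setT R X).
by rewrite (nrmC v); lra.
Qed.

Lemma chi_set0 v : chi H set0 v = 0.
Proof.
have b0 : bounded_borel (\1_set0 : X -> R[i]) by apply: bounded_borel_indic; exact: borel_set0.
have : chi H set0 v = chi H set0 v + chi H set0 v.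
  have := phiD b0 b0 => /(congr1 (@^~ v)) /= <-; congr (phi _ v).
  by apply/funext => x; rewrite indicE in_set0 addr0.
by move=> /eqP; rewrite -subr_eq subrr eq_sym => /eqP.
Qed.

Lemma chi_setU0 (A B : set X) v : borel_set A -> borel_set B ->
  chi H A v = 0 -> chi H B v = 0 -> chi H (A `|` B) v = 0.
Proof.
move=> bA bB Av Bv; have bAC := borel_setC bA.
have bBA : borel_set (~` A `&` B) by exact: borel_setI.
have := phiD (bounded_borel_indic bA) (bounded_borel_indic bBA).
move=> /(congr1 (@^~ v)) /=; rewrite -!/(chi H _ v) Av add0r -chi_chi// Bv.
rewrite (lin0 (chi_lin bAC)) => <-; congr (phi _ v).
apply/funext => x; rewrite !indicE in_setU in_setI in_setC.
by case: (x \in A); case: (x \in B); rewrite /= ?addr0 ?add0r.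
Qed.

(** The finite unions [B N] converge pointwise, so compatibility with bounded limits applies. This
    is the countable additivity that makes the adapted bases total. *)
Lemma chi_bigcup0 (A : nat -> set X) v : (forall n, borel_set (A n)) ->
  (forall n, chi H (A n) v = 0) -> chi H (\bigcup_n A n) v = 0.
Proof.
move=> bA Av; pose B N := \bigcup_(n < N) A n.
have bB N : borel_set (B N) /\ chi H (B N) v = 0.
  elim: N => [|N [bN vN]].
    rewrite /B [X in chi H X](_ : _ = set0) ?[X in borel_set X](_ : _ = set0).
    - by split; [exact: borel_set0|exact: chi_set0].
    - by apply/seteqP; split=> x // [].
    - by apply/seteqP; split=> x // [].
  have -> : B N.+1 = B N `|` A N by rewrite /B !bigcup_mkord big_ord_recr.
  by split; [exact: borel_setU|exact: chi_setU0].
have := borel_repP => -[_ _ /(_ (fun N => \1_(B N)) (\1_(\bigcup_n A n)) 1)] h.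
apply: cvg_nrm_unique (h _ _ _ v) _.
- by move=> N; apply: bounded_borel_indic; exact: (bB N).1.
- by move=> N x; rewrite indicE; case: (x \in B N); rewrite ?normr1 ?normr0.
- move=> x; apply/cvg_nrmP => e e0; rewrite indicE.
  have [Ax|nAx] := pselect ((\bigcup_n A n) x); last first.
    exists 0%N => n _; rewrite indicE !memNset ?subrr ?nrm0// => -[m _ Amx].
    by apply: nAx; exists m.
  rewrite mem_set//; have [m _ Amx] := Ax; exists m.+1 => n mn.
  by rewrite indicE mem_set ?subrr ?nrm0//; exists m.
- apply/cvg_nrmP => e e0; exists 0%N => n _; have [_ ] := bB n.
  by rewrite /chi => ->; rewrite subrr nrm0.
Qed.

End BorelModule.

(** * Total boundedness and compact operators *)

Section TotallyBounded.
Context {R : realType}.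
Local Notation toC := (real_complex R).

(** The centres [s] may lie outside [A], so the property passes to subsets at once. *)
Definition tot_bdd (V : normedModType R[i]) (A : set V) : Prop :=
  forall e : R, 0 < e -> exists s : seq V, forall a, A a ->
    exists2 b, b \in s & nrm (a - b) < e.

Lemma tot_bdd_sub (V : normedModType R[i]) (A B : set V) :
  A `<=` B -> tot_bdd B -> tot_bdd A.
Proof. by move=> AB Bt e /Bt [s sP]; exists s => a /AB; exact: sP. Qed.

Lemma tot_bdd_approx (V : normedModType R[i]) (A : set V) :
  (forall e : R, 0 < e -> exists2 B, tot_bdd B & forall a, A a ->
    exists2 b, B b & nrm (a - b) <= e) -> tot_bdd A.
Proof.
move=> AB e e0; have e2 : 0 < e / 2 by rewrite divr_gt0.
have [B Bt Be] := AB _ e2; have [s sP] := Bt _ e2; exists s => a /Be [b Bb ab].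
have [c cs bc] := sP b Bb; exists c => //.
by rewrite (le_lt_trans (nrm_triangle b _ _))// (splitr e) ler_ltD.
Qed.

Lemma tot_bdd_image (V W : normedModType R[i]) (T : V -> W) (C : R) (A : set V) :
  (forall u v, nrm (T u - T v) <= C * nrm (u - v)) -> tot_bdd A -> tot_bdd (T @` A).
Proof.
move=> TC At e e0; have C1 : 0 < `|C| + 1 by rewrite ltr_wpDl.
have [s sP] := At _ (divr_gt0 e0 C1); exists (map T s) => _ [a /sP [b bs ab] <-].
exists (T b); first exact: map_f.
rewrite (le_lt_trans (TC _ _))//; rewrite ltr_pdivlMr// mulrC in ab.
apply: le_lt_trans ab; rewrite ler_wpM2r ?nrm_ge0//.
by rewrite (le_trans (ler_norm _))// lerDl.
Qed.

Lemma tot_bddD (V : normedModType R[i]) (A B : set V) :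
  tot_bdd A -> tot_bdd B -> tot_bdd [set a + b | a in A & b in B].
Proof.
move=> At Bt e e0; have e2 : 0 < e / 2 by rewrite divr_gt0.
have [s sP] := At _ e2; have [t tP] := Bt _ e2.
exists [seq x + y | x <- s, y <- t] => _ [a /sP [x xs ax] [b /tP [y yt bY] <-]].
exists (x + y); first exact: allpairs_f.
by rewrite opprD addrACA (le_lt_trans (nrmD _ _))// (splitr e) ltrD.
Qed.

Lemma tot_bdd_span (V : normedModType R[i]) n (e : 'I_n -> V) (M : R) :
  tot_bdd [set \sum_i c i *: e i | c in [set c | forall i, nrm (c i) <= M]].
Proof.
elim: n e => [|n IH] e.
  move=> d d0; exists [:: 0] => _ [c _ <-]; exists 0; first exact: mem_head.
  by rewrite big_ord0 subrr nrm0.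
have line : tot_bdd [set c *: e ord_max | c in [set c | nrm c <= M]].
  move=> d d0; have e1 : 0 < nrm (e ord_max) + 1 by rewrite ltr_wpDl ?nrm_ge0.
  have [s sP] := complex_net M (divr_gt0 d0 e1).
  exists [seq c *: e ord_max | c <- s] => _ [c /sP [b bs cb] <-].
  exists (b *: e ord_max); first exact: map_f.
  rewrite -scalerBl nrmZ; rewrite ltr_pdivlMr// in cb; apply: le_lt_trans cb.
  by rewrite ler_wpM2l ?nrm_ge0// lerDl.
apply: tot_bdd_sub (tot_bddD (IH (fun i => e (widen_ord (leqnSn n) i))) line).
move=> _ [c cM <-]; rewrite big_ord_recr/=.
exists (\sum_i c (widen_ord (leqnSn n) i) *: e (widen_ord (leqnSn n) i)).
  by exists (fun i => c (widen_ord (leqnSn n) i)) => // i; exact: cM.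
by exists (c ord_max *: e ord_max) => //; exists (c ord_max) => //; exact: cM.
Qed.

(** For the converse, an ultrafilter on the closure contains one of finitely many balls of any given
    radius; it is therefore Cauchy, and completeness provides the limit. *)
Lemma tot_bdd_compact (V : completeNormedModType R[i]) (A : set V) :
  compact (closure A) <-> tot_bdd A.
Proof.
split=> [cA e e0|At].
  move: cA; rewrite compact_cover => /(_ V setT (fun v => ball v (toC e))).
  case=> [v _|v _|D _ DA]; first by apply: ball_open; rewrite ltcR.
    by exists v => //; apply: ballxx; rewrite ltcR.
  exists (finmap.enum_fset D) => a Aa; have [b /= bD ab] := DA a (subset_closure Aa).
  by exists b => //; move: ab; rewrite -ball_normE/= nrm_ltP nrmC.
rewrite compact_ultra => F FU FA.
have Fcauchy : cauchy_ex F.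
  move=> _ /posC [e e0 ->]; have e2 : 0 < e / 2 by rewrite divr_gt0.
  have [s sP] := At _ e2.
  have : F (\bigcup_(b in [set` s]) ball b (toC e)).
    apply: filterS FA => v /closure_nrmP /(_ _ e2) [a Aa av].
    have [b bs ab] := sP a Aa; exists b => //; rewrite -ball_normE/= nrm_ltP.
    rewrite (le_lt_trans (nrm_triangle a _ _))// (splitr e) ltrD//.
    by rewrite nrmC.
  elim: s {sP} => [|b s IH] Fs.
    have : F set0 by apply: filterS Fs => x [].
    by move=> /filter_ex [].
  have [Fb|Fb] := in_ultra_setVsetC (ball b (toC e)) FU; first by exists b.
  apply: IH; apply: filterS (filterI Fs Fb) => x [[c /= ]].
  by rewrite inE => /predU1P[->|cs] cx nbx //; exists c.
have Fp : F --> lim F by apply: cauchy_cvg; exact: cauchy_exP.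
exists (lim F); split=> //.
apply: (@closed_closure _ A) => U /Fp FUU.
have : F (closure A `&` U) by exact: filterI.
exact: filter_ex.
Qed.

(** Compactness for maps between two spaces, as the factorisations through [V] and [W] require;
    [compact_operator] concerns a single space. *)
Definition tb_op (V W : normedModType R[i]) (T : V -> W) : Prop :=
  tot_bdd [set T v | v in [set v | nrm v <= 1]].

Lemma compact_operatorP (V : completeNormedModType R[i]) (T : V -> V) :
  compact_operator T <-> bounded_operator T /\ tb_op T.
Proof.
rewrite /compact_operator /tb_op.
have -> : [set v : V | `|v| <= 1] = [set v | nrm v <= 1].
  by apply/seteqP; split=> v /=; rewrite nrm_le1.
by split=> -[bT /tot_bdd_compact].
Qed.

Lemma tb_op_compl (U V W : normedModType R[i]) (T : U -> V) (S : V -> W) :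
  tb_op T -> linear S -> continuous S -> tb_op (S \o T).
Proof.
move=> Tt Sl Sc; have [C _ SC] := lin_continuous_bound Sl Sc.
rewrite /tb_op -[X in tot_bdd X](image_comp T S).
by apply: (@tot_bdd_image _ _ S C) => // u v; rewrite -(linB Sl).
Qed.

Lemma tb_op_compr (U V W : normedModType R[i]) (T : V -> W) (S : U -> V) :
  tb_op T -> linear T -> linear S -> continuous S -> tb_op (T \o S).
Proof.
move=> Tt Tl Sl Sc; have [C C0 SC] := lin_continuous_bound Sl Sc.
apply: tot_bdd_sub (@tot_bdd_image _ _ (fun w => toC C *: w) C _ _ Tt).
  move=> _ [u /= u1 <-]; exists (T (toC C^-1 *: S u)).
    exists (toC C^-1 *: S u) => //=; rewrite nrmZ nrm_toC ger0_norm ?invr_ge0 ?(ltW C0)//.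
    rewrite ler_pdivrMl// mulr1 (le_trans (SC u))// ler_piMr//; exact: ltW.
  by rewrite (linZ Tl) scalerA -rmorphM/= divff ?gt_eqF// rmorph1 scale1r.
by move=> v w; rewrite -scalerBr nrmZ nrm_toC gtr0_norm.
Qed.

Lemma tb_op_approx (V W : normedModType R[i]) (T : V -> W) :
  (forall e : R, 0 < e -> exists2 S, tb_op S & forall v, nrm v <= 1 -> nrm (T v - S v) <= e) ->
  tb_op T.
Proof.
move=> TS; apply: tot_bdd_approx => e /TS [S St TSe].
by exists [set S v | v in [set v | nrm v <= 1]] => // _ [v v1 <-]; exists (S v); [exists v|exact: TSe].
Qed.

Lemma tb_op_finite_rank (V W : normedModType R[i]) (T : V -> W) n (e : 'I_n -> W)
    (c : V -> 'I_n -> R[i]) (M : R) :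
  (forall v, T v = \sum_i c v i *: e i) ->
  (forall v i, nrm v <= 1 -> nrm (c v i) <= M) -> tb_op T.
Proof.
move=> TE cM; apply: tot_bdd_sub (tot_bdd_span e M) => _ [v /= v1 <-].
by exists (c v) => //= i; exact: cM.
Qed.

End TotallyBounded.

(** * Orthonormal bases *)

Section OrthogonalSystems.
Context {R : realType}.
Local Notation toC := (real_complex R).

(* Vectors with [b k = false] vanish; this lets one index set serve several
   orthonormal families. *)
Definition orthosys (H : hilbertSpace R) (b : nat -> bool) (e : nat -> H) : Prop :=
  forall j k, inner H (e j) (e k) = ((j == k) && b j)%:R.

Definition total_system (H : hilbertSpace R) (e : nat -> H) : Prop :=
  forall v, (forall k, inner H v (e k) = 0) -> v = 0.

Section System.
Context {H : hilbertSpace R} (b : nat -> bool) (e : nat -> H).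
Hypothesis e_orth : orthosys b e.

Lemma orthosys0 k : ~~ b k -> e k = 0.
Proof.
move=> /negPf bk; apply: nrm0_eq0; apply/eqP; rewrite -sqrf_eq0; apply/eqP.
by apply: (@complexI R); rewrite -inner_nrm e_orth bk andbF.
Qed.

Lemma inner_sum_orthosys (c : nat -> R[i]) m n k : (m <= k < n)%N ->
  inner H (\sum_(m <= j < n) c j *: e j) (e k) = c k * (b k)%:R.
Proof.
move=> kmn; rewrite inner_suml (bigD1_seq k) ?mem_index_iota ?iota_uniq//=.
rewrite innerZl e_orth eqxx/= big1 ?addr0// => j jk.
by rewrite innerZl e_orth (negPf jk) mulr0.
Qed.

Lemma nrm_sum_orthosys (c : nat -> R[i]) m n :
  nrm (\sum_(m <= j < n) c j *: e j) ^+ 2 =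
  \sum_(m <= j < n) nrm (c j) ^+ 2 * (b j)%:R.
Proof.
apply: (@complexI R); rewrite -inner_nrm.
set s := \sum_(m <= j < n) c j *: e j.
have innerr (u : H) : inner H u s = \sum_(m <= j < n) (c j)^* * inner H u (e j).
  rewrite innerC inner_suml rmorph_sum; apply: eq_bigr => j _.
  by rewrite innerZl rmorphM/= -innerC.
rewrite innerr rmorph_sum; apply: eq_big_nat => j jmn /=.
rewrite inner_sum_orthosys// mulrA [_ * c j]mulrC mul_conjE rmorphM/=.
by case: (b j); [rewrite !mulr1 expr2 rmorphM|rewrite !mulr0].
Qed.

Lemma Bessel v n : \sum_(0 <= k < n) nrm (inner H v (e k)) ^+ 2 <= nrm v ^+ 2.
Proof.
pose c k := inner H v (e k); pose s := \sum_(0 <= j < n) c j *: e j.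
have cb k : c k * (b k)%:R = c k.
  rewrite /c; case bk: (b k); first by rewrite mulr1.
  by rewrite orthosys0 ?bk// inner0r mul0r.
have sv : inner H s (v - s) = 0.
  rewrite inner_suml big_nat big1// => k /andP[_ kn].
  rewrite innerZl innerC innerBl -/(c k) inner_sum_orthosys// cb subrr conjC0 mulr0//.
have := nrmD_orth sv; rewrite addrC subrK => ->.
rewrite nrm_sum_orthosys.
have -> : \sum_(0 <= k < n) nrm (inner H v (e k)) ^+ 2 =
          \sum_(0 <= j < n) nrm (c j) ^+ 2 * (b j)%:R.
  apply: eq_bigr => k _; rewrite -/(c k); case bk: (b k); first by rewrite mulr1.
  by rewrite /c orthosys0 ?bk// inner0r nrm0 expr0n mul0r.
by rewrite lerDl sqr_ge0.
Qed.

End System.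

Section Unitary.
Context {H K : hilbertSpace R} (b : nat -> bool) (e : nat -> H) (e' : nat -> K).
Hypotheses (e_orth : orthosys b e) (e'_orth : orthosys b e').

(** Differences of partial sums are controlled by those of the Bessel sums [a n], which are
    nondecreasing and bounded. *)
Lemma orthosys_series_cvg v :
  exists l : K, (\sum_(0 <= k < n) inner H v (e k) *: e' k) @[n --> \oo] --> l.
Proof.
apply: complete_nrmP => d d0.
pose a n := \sum_(0 <= k < n) nrm (inner H v (e k)) ^+ 2.
have a_mono m n : (m <= n)%N -> a m <= a n.
  move=> mn; rewrite /a (big_cat_nat _ mn)//= lerDl.
  by apply: sumr_ge0 => i _; exact: sqr_ge0.
have sup_a : has_sup (range a).
  by split; [exists (a 0%N); exists 0%N|exists (nrm v ^+ 2) => _ [n _ <-]; exact: Bessel].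
have [_ [N _ <-] Na] := sup_adherent (exprn_gt0 2 d0) sup_a.
have close m n : (N <= m)%N -> (m <= n)%N ->
    nrm (\sum_(0 <= k < n) inner H v (e k) *: e' k -
         \sum_(0 <= k < m) inner H v (e k) *: e' k) < d.
  move=> Nm mn; rewrite (big_cat_nat _ mn)//= addrAC subrr add0r.
  rewrite -ltr_sqr ?nnegrE ?nrm_ge0 ?(ltW d0)// (nrm_sum_orthosys e'_orth).
  apply: (@le_lt_trans _ _ (a n - a m)).
    rewrite (_ : a n - a m = \sum_(m <= k < n) nrm (inner H v (e k)) ^+ 2); last first.
      by rewrite /a (big_cat_nat _ mn)//= addrAC subrr add0r.
    apply: ler_sum => k _.
    by case: (b k); rewrite ?mulr1 ?mulr0// sqr_ge0.
  have : a n <= sup (range a) by apply: ub_le_sup; [case: sup_a|exists n].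
  by have := a_mono _ _ Nm; lra.
exists N => m n Nm Nn; have [mn|/ltnW nm] := leqP m n; last exact: close.
by rewrite nrmC; exact: close.
Qed.

End Unitary.

(** [V] and [W] carry the coefficients of one system over to the other. Totality means that a vector
    is determined by its coefficients, so they are inverse to each other; the common mask [b] makes
    the zero vectors match. *)
Lemma orthosys_unitary (H K : hilbertSpace R) b (e : nat -> H) (e' : nat -> K) :
  orthosys b e -> orthosys b e' -> total_system e -> total_system e' ->
  exists (V : H -> K) (W : K -> H),
    [/\ cancel V W, cancel W V,
        forall v w, inner K (V v) w = inner H v (W w),
        forall v k, inner K (V v) (e' k) = inner H v (e k) &
        forall w k, inner H (W w) (e k) = inner K w (e' k)].
Proof.
move=> eo e'o et e't.
have coef (H1 K1 : hilbertSpace R) (f : nat -> H1) (f' : nat -> K1) v l k :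
    orthosys b f -> orthosys b f' ->
    (\sum_(0 <= k < n) inner H1 v (f k) *: f' k) @[n --> \oo] --> l ->
    inner K1 l (f' k) = inner H1 v (f k).
  move=> fo f'o lP; have h := inner_cvg (w := f' k) lP; apply: (cvg_nrm_unique h).
  apply/cvg_nrmP => d d0; exists k.+1 => n kn.
  rewrite (inner_sum_orthosys f'o (fun k => inner H1 v (f k)))//.
  case bk: (b k); first by rewrite mulr1 subrr nrm0.
  by rewrite (orthosys0 fo) ?bk// inner0r mul0r subrr nrm0.
have /choice [V VP] := orthosys_series_cvg eo e'o.
have /choice [W WP] := orthosys_series_cvg e'o eo.
have Vk v k : inner K (V v) (e' k) = inner H v (e k) by exact: coef.
have Wk w k : inner H (W w) (e k) = inner K w (e' k) by exact: coef.
have ext (H1 : hilbertSpace R) (f : nat -> H1) u v : total_system f ->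
    (forall k, inner H1 u (f k) = inner H1 v (f k)) -> u = v.
  move=> ft uv; apply/eqP; rewrite -subr_eq0; apply/eqP/ft => k.
  by rewrite innerBl uv subrr.
exists V, W; split=> // [v|w|v w].
- by apply: ext et _ => k; rewrite Wk Vk.
- by apply: ext e't _ => k; rewrite Vk Wk.
have h1 := inner_cvg (w := w) (VP v).
have /cvg_nrmP h2 := inner_cvg (w := v) (WP w).
apply: (cvg_nrm_unique h1); apply/cvg_nrmP => d d0; have [N Nd] := h2 d d0.
exists N => n /Nd; rewrite [inner H v (W w)]innerC -[X in nrm X]conjCK rmorphB/=.
rewrite nrm_conj; congr (nrm (_ - _) < d).
rewrite !inner_suml rmorph_sum; apply: eq_bigr => k _ /=.
by rewrite !innerZl rmorphM/= -!innerC mulrC.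
Qed.

(** * Gram-Schmidt orthonormalisation *)

Section GramSchmidt.
Context {H : hilbertSpace R}.

(** If [d] depends on [s], then [r = 0] and the step returns 0. Such zeros stay in the sequence, so
    every input vector keeps its index, and they are removed only in [projection_basis]. *)
Definition gs_step (s : seq H) (d : H) : H :=
  let r := d - \sum_(u <- s) inner H d u *: u in toC (nrm r)^-1 *: r.

Fixpoint gs_prefix (d : nat -> H) n : seq H :=
  if n is m.+1 then rcons (gs_prefix d m) (gs_step (gs_prefix d m) (d m)) else [::].

Definition gram_schmidt (d : nat -> H) n : H := gs_step (gs_prefix d n) (d n).

Variable d : nat -> H.
Local Notation e := (gram_schmidt d).

Lemma gs_prefixE n : gs_prefix d n = [seq e k | k <- index_iota 0 n].
Proof.
elim: n => // n IH; rewrite [LHS]/= -/(gram_schmidt d n) {1}IH /index_iota !subn0.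
by rewrite -[in RHS]addn1 iotaD map_cat add0n cats1.
Qed.

Definition gs_residue n : H := d n - \sum_(0 <= k < n) inner H (d n) (e k) *: e k.

Lemma gram_schmidtE n : e n = toC (nrm (gs_residue n))^-1 *: gs_residue n.
Proof. by rewrite /gram_schmidt /gs_step gs_prefixE big_map. Qed.

Lemma gs_residueE n : gs_residue n = toC (nrm (gs_residue n)) *: e n.
Proof.
rewrite [in RHS]gram_schmidtE scalerA -rmorphM/=.
have [r0|r0] := eqVneq (nrm (gs_residue n)) 0; last by rewrite divff// rmorph1 scale1r.
by rewrite (nrm0_eq0 r0) scaler0.
Qed.

Lemma inner_gram_schmidt n : inner H (e n) (e n) = (e n != 0)%:R.
Proof.
have [->|en0] := eqVneq (e n) 0; first by rewrite inner0r.
have r0 : nrm (gs_residue n) != 0.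
  apply: contra_neq en0 => r0.
  by rewrite gram_schmidtE (nrm0_eq0 r0) scaler0.
rewrite inner_nrm gram_schmidtE nrmZ nrm_toC ger0_norm ?invr_ge0 ?nrm_ge0//.
by rewrite mulVf// expr1n.
Qed.

Lemma gram_schmidt_orthosys : orthosys (fun k => e k != 0) e.
Proof.
suff orth n j k : (j < n)%N -> (k < n)%N -> inner H (e j) (e k) = ((j == k) && (e j != 0))%:R.
  by move=> j k; apply: (orth (maxn j k).+1); rewrite ltnS ?leq_maxl ?leq_maxr.
elim: n j k => // n IH.
have last_orth j : (j < n)%N -> inner H (e n) (e j) = 0.
  move=> jn; rewrite gram_schmidtE innerZl innerBl inner_suml.
  rewrite (bigD1_seq j) ?mem_index_iota ?iota_uniq//=.
  rewrite big1_seq ?addr0 => [|k /andP[kj]]; last first.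
    by rewrite mem_index_iota => /andP[_ kn]; rewrite innerZl IH// (negPf kj) mulr0.
  rewrite innerZl IH// eqxx/=; have [->|_] := eqVneq (e j) 0.
    by rewrite inner0r mul0r subrr mulr0.
  by rewrite mulr1 subrr mulr0.
move=> j k; rewrite !ltnS leq_eqVlt => /predU1P[->|jn]; rewrite leq_eqVlt => /predU1P[->|kn].
- by rewrite eqxx inner_gram_schmidt.
- by rewrite last_orth// gtn_eqF.
- by rewrite innerC last_orth// conjC0 ltn_eqF.
- exact: IH.
Qed.

Lemma gram_schmidt_span v : (forall k, inner H v (e k) = 0) -> forall n, inner H v (d n) = 0.
Proof.
move=> ve n; have -> : d n = gs_residue n + \sum_(0 <= k < n) inner H (d n) (e k) *: e k.
  by rewrite subrK.
rewrite innerDr gs_residueE innerZr ve mulr0 add0r innerC inner_suml.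
by rewrite big1 ?conjC0// => k _; rewrite innerZl (innerC (e k)) ve conjC0 mulr0.
Qed.

Lemma gram_schmidt_fixed (P : H -> H) : linear P -> (forall n, P (d n) = d n) ->
  forall n, P (e n) = e n.
Proof.
move=> Pl Pd n; elim/ltn_ind: n => n IH.
rewrite gram_schmidtE (linZ Pl) /gs_residue (linB Pl) Pd (lin_sum Pl); congr (_ *: (_ - _)).
by rewrite big_nat [RHS]big_nat; apply: eq_bigr => k /andP[_ kn]; rewrite (linZ Pl) IH.
Qed.

End GramSchmidt.

Lemma separable_seq (V : normedModType R[i]) : separable_space V ->
  exists d : nat -> V, forall v (r : R), 0 < r -> exists n, nrm (d n - v) < r.
Proof.
move=> [D /countable_injP [f finj] /dense_nrmP Dd].
(* The point of [D] coded by [n], or 0 if there is none. *)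
exists (fun n => xget 0 [set v | D v /\ f v = n]) => v r r0.
have [a Da av] := Dd v r r0; exists (f a).
have [Db fb] := xgetPex 0 (ex_intro [set v | D v /\ f v = f a] a (conj Da erefl)).
by rewrite (finj _ _ _ _ fb) ?inE.
Qed.

(** Gram-Schmidt is run on the images under [P] of a dense sequence. Infinite dimension of the range
    leaves infinitely many nonzero vectors, renumbered by [nat]: all ranges thus get bases with the
    same index set and can be identified. *)
Lemma projection_basis (H : hilbertSpace R) (P : H -> H) :
  separable_space H -> linear P -> (forall v, nrm (P v) <= nrm v) ->
  (forall v, P (P v) = P v) ->
  (forall (e : nat -> H) N, exists2 v, P v = v &
     v != \sum_(0 <= k < N) inner H v (e k) *: e k) ->
  exists e : nat -> H, [/\ orthosys xpredT e, forall k, P (e k) = e k &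
    forall v, P v = v -> (forall k, inner H v (e k) = 0) -> v = 0].
Proof.
move=> /separable_seq [d dd] Pl P1 PP Pinf.
pose g := gram_schmidt (fun n => P (d n)).
have g_orth := gram_schmidt_orthosys (fun n => P (d n)).
have gP n : P (g n) = g n by apply: gram_schmidt_fixed.
have g_total v : P v = v -> (forall k, inner H v (g k) = 0) -> v = 0.
  move=> Pv /gram_schmidt_span vd; apply: nrm0_eq0; apply/eqP.
  rewrite -sqrf_eq0; apply/eqP; apply: (@complexI R).
  rewrite -inner_nrm; apply: (@nrm_eps0 _ _ _ (nrm v)) => r r0.
  have [n nv] := dd v r r0.
  (* [v] is orthogonal to every [P (d n)], yet these come arbitrarily close to [v = P v]. *)
  have -> : inner H v v = inner H v (v - P (d n)) by rewrite innerBr vd subr0.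
  rewrite (le_trans (Cauchy_Schwarz _ _))// ler_wpM2l ?nrm_ge0//.
  by rewrite -{1}Pv -(linB Pl) (le_trans (P1 _))// nrmC ltW.
pose B := [set k | g k != 0].
have Binf : infinite_set B.
  move=> /finite_seqP [s Bs]; pose N := (\max_(k <- s) k).+1.
  have gN k : (N <= k)%N -> g k = 0.
    move=> Nk; apply/eqP; apply: contrapT => /negP gk.
    have : B k by [].
    rewrite Bs /= => ks; move: Nk; rewrite /N ltnNge.
    by rewrite (@leq_bigmax_seq _ s xpredT id k ks).
  have [v Pv] := Pinf g N; apply/negP; rewrite negbK -subr_eq0; apply/eqP.
  apply: g_total => [|k].
    rewrite (linB Pl) Pv (lin_sum Pl); congr (_ - _).
    by apply: eq_bigr => k _; rewrite (linZ Pl) gP.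
  have [Nk|kN] := leqP N k; first by rewrite gN// inner0r.
  rewrite innerBl (inner_sum_orthosys g_orth (fun k => inner H v (g k)))//.
  have [gk|_] := eqVneq (gram_schmidt (fun n => P (d n)) k) 0.
    by rewrite mulr0 /g gk inner0r subrr.
  by rewrite mulr1 subrr.
have /card_set_bijP [f [fB fI fS]] : ([set: nat] #= B)%card.
  by rewrite card_eq_sym; exact: eq_card_nat.
exists (g \o f); split=> [j k|k|v Pv vg] /=.
- rewrite g_orth andbT; have -> : g (f j) != 0 by exact: fB.
  rewrite andbT; congr ((_ : bool)%:R).
  by apply/eqP/eqP => [/fI|->//]; apply; rewrite inE.
- exact: gP.
- apply: g_total => // k; have [gk|gk] := eqVneq (g k) 0; first by rewrite gk inner0r.
  by have [m _ <-] := fS k gk; exact: vg.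
Qed.

End OrthogonalSystems.

(** * Bases adapted to a Borel partition *)

Section ModuleBasis.
Context {R : realType} {X : metricType R} (H : xmodule X).
Hypothesis Xproper : proper_metric X.
Local Notation toC := (real_complex R).

Lemma rep_chi_supp (A : set X) f v : borel_set A -> C0 f ->
  (forall x, ~ A x -> f x = 0) -> rep H f (chi H A v) = rep H f v.
Proof.
move=> bA f0 fA.
have := phiM H Xproper (C0_bounded_borel f0) (bounded_borel_indic bA).
rewrite /chi -(phi_C0 H Xproper f0) => /(congr1 (@^~ v)) /= <-; congr (borel_rep H _ v).
apply/funext => x; rewrite indicE; have [Ax|nAx] := pselect (A x).
  by rewrite mem_set// mulr1.
by rewrite fA// mul0r.
Qed.

Lemma chi_rep_supp (A : set X) f v : borel_set A -> C0 f ->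
  (forall x, A x -> f x = 1) -> chi H A (rep H f v) = chi H A v.
Proof.
move=> bA f0 fA.
have := phiM H Xproper (bounded_borel_indic bA) (C0_bounded_borel f0).
rewrite /chi -(phi_C0 H Xproper f0) => /(congr1 (@^~ v)) /= <-; congr (borel_rep H _ v).
apply/funext => x; rewrite indicE; have [Ax|nAx] := pselect (A x).
  by rewrite mem_set// mul1r fA.
by rewrite memNset// mul0r.
Qed.

(** The ball is room for a nonzero function of [C0] supported in [A], to which ampleness is
    applied. *)
Definition thick (A : set X) : Prop := exists x, forall y, mdist x y < 1 -> A y.

(** Otherwise a bump [f] inside [A], whose operator has its range in that of [chi H A], would act
    with finite rank, hence compactly, and ampleness would force [f = 0]. *)
Lemma ample_chi_infinite (A : set X) : ample H -> borel_set A -> thick A ->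
  forall (e : nat -> H) N, exists2 v, chi H A v = v &
    v != \sum_(0 <= k < N) inner H v (e k) *: e k.
Proof.
move=> Hample bA [x0 xA] e N; apply: contrapT => h.
have fin v : chi H A v = v -> v = \sum_(0 <= k < N) inner H v (e k) *: e k.
  by move=> Av; apply/eqP; apply: contrapT => /negP vN; apply: h; exists v.
have oU : open [set y | mdist x0 y < 1].
  apply: (@open_comp _ _ (mdist x0) [set t | t < 1]) => [x _|]; last exact: open_lt.
  exact: continuous_mdist.
have [|u [u0 u01 u1 uU]] := bump_fun Xproper (compact_set1 (x := x0)) oU.
  by move=> x /= ->; rewrite mdistxx.
pose f x := toC (u x); have f0 : C0 f by exact: C0_toC.
have fl := rho_lin (rep_star H) f0; have fc := rho_continuous (rep_star H) f0.
have fA v : chi H A (rep H f v) = rep H f v.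
  apply: chi_rep => // x nAx; rewrite /f uU//; apply: contra_not nAx.
  exact: xA.
have [C C0 fC] := lin_continuous_bound fl fc.
suff /(Hample _ f0) : compact_operator (rep H f).
  move=> /(congr1 (@^~ x0)) /=; rewrite /f u1// => /(congr1 (@complex.Re R)) /=.
  by move/eqP; rewrite oner_eq0.
apply/compact_operatorP; split=> //.
apply: (@tb_op_finite_rank _ _ _ _ N (fun i => e i) (fun v i => inner H (rep H f v) (e i))
  (C * \sum_(i < N) nrm (e i))).
  by move=> v; rewrite {1}(fin _ (fA v)) big_mkord.
move=> v i v1; rewrite (le_trans (Cauchy_Schwarz _ _))// ler_pM ?nrm_ge0//.
  by rewrite (le_trans (fC v))// ler_piMr// ltW.
by rewrite (bigD1 i)//= lerDl; apply: sumr_ge0 => j _; exact: nrm_ge0.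
Qed.

(* Blocks with [D i = false] are empty, so that finite partitions, which arise
   for bounded [X], are also indexed by [nat]. *)
Record borel_partition (D : nat -> bool) (A : nat -> set X) : Prop := BorelPartition {
  bp_borel : forall i, borel_set (A i) ;
  bp_disjoint : forall i j x, A i x -> A j x -> i = j ;
  bp_cover : forall x, exists i, A i x ;
  bp_empty : forall i x, A i x -> D i ;
  bp_thick : forall i, D i -> thick (A i) }.

(** Arbitrary unions of cells are the sets whose projections the unitary will intertwine. *)
Definition block (A : nat -> set X) (S : set nat) : set X := \bigcup_(i in S) A i.

(* [k] encodes a block and a position in the basis of that block; the codes [k]
   outside of the image of [pickle] carry the zero vector. *)
Definition basis_index k : nat := if pickle_inv k is Some p then (p : nat * nat).1 else 0%N.
Definition basis_mask (D : nat -> bool) k : bool :=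
  if pickle_inv k is Some p then D (p : nat * nat).1 else false.

Lemma block_borel D A S : borel_partition D A -> borel_set (block A S).
Proof.
move=> DA; rewrite /block bigcup_mkcond; apply: borel_bigcup => i.
by case: ifP => _; [exact: bp_borel DA i|exact: borel_set0].
Qed.

Lemma block_setI D A S i : borel_partition D A ->
  block A S `&` A i = if i \in S then A i else set0.
Proof.
move=> DA; case: ifPn => [iS|iS].
  apply/seteqP; split=> x; first by case.
  by move=> Ax; split=> //; exists i => //; rewrite inE in iS.
apply/seteqP; split=> x // [[j Sj Ajx] Aix]; move: iS.
by rewrite -(bp_disjoint DA Ajx Aix) mem_set.
Qed.

(** Bases of the ranges of the [chi H (A i)] are merged along [pickle]. A vector orthogonal to all
    of them is killed by each [chi H (A i)], hence by [chi H setT]. The mask depends on [D] alone,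
    so two modules whose partitions share [D] get matching systems. *)
Lemma module_basis D A : ample H -> borel_partition D A ->
  exists e : nat -> H, [/\ orthosys (basis_mask D) e, total_system e &
    forall S k, chi H (block A S) (e k) = if basis_index k \in S then e k else 0].
Proof.
move=> Hample DA; have bA := bp_borel DA.
have ex i : exists e : nat -> H, D i -> [/\ orthosys xpredT e,
    forall k, chi H (A i) (e k) = e k &
    forall v, chi H (A i) v = v -> (forall k, inner H v (e k) = 0) -> v = 0].
  have [Di|_] := boolP (D i); last by exists (fun=> 0).
  have := @projection_basis _ H (chi H (A i)) (mod_separable H) (chi_lin Xproper (bA i)).
  case=> [v|v|e0 N|e eP]; last by exists e.
  - exact: chi_le.
  - by rewrite chi_chi// setIid.
  - by apply: ample_chi_infinite => //; exact: bp_thick DA i Di.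
have /choice [g gP] := ex.
pose e k : H := if pickle_inv k is Some p then
    (if D (p : nat * nat).1 then g p.1 p.2 else 0) else 0.
have eA k : chi H (A (basis_index k)) (e k) = e k.
  rewrite /basis_index /e; case: pickle_inv => [[i n]|]/=; last first.
    by rewrite (lin0 (chi_lin Xproper (bA _))).
  have [Di|_] := boolP (D i); first by case: (gP i Di) => _ + _; apply.
  by rewrite (lin0 (chi_lin Xproper (bA _))).
exists e; split.
- move=> j k; rewrite /e /basis_mask.
  have := @pickle_invK (nat * nat)%type j; case: (pickle_inv j : option (nat * nat)) => [[i m]|]/=; last first.
    by rewrite inner0l andbF.
  move=> <-; have := @pickle_invK (nat * nat)%type k.
  case kE: (pickle_inv k : option (nat * nat)) => [[i' m']|]/=; last first.
    move=> _; rewrite inner0r; case: eqP => // jk.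
    by rewrite -jk pickleK_inv in kE.
  move=> <-; rewrite (inj_eq (pcan_inj pickleK)).
  have [Di|_] := boolP (D i); last by rewrite inner0l andbF.
  have [gi gA _] := gP i Di; have [ii'|ii'] := eqVneq i i'.
    rewrite -ii' Di gi !andbT; congr ((_ : bool)%:R).
    by apply/eqP/eqP => [->|[]].
  have [Di'|_] := boolP (D i'); last first.
    by rewrite inner0r; case: eqP => // -[/eqP]; rewrite (negPf ii').
  have [_ gA' _] := gP i' Di'.
  have -> : ((i, m) == (i', m')) = false by apply/eqP => -[/eqP]; rewrite (negPf ii').
  rewrite -(gA m) -(gA' m') chi_adj// chi_chi//.
  rewrite [X in chi H X](_ : _ = set0) ?chi_set0 ?inner0r//.
  apply/seteqP; split=> x // [Ax A'x].
  by move/eqP: ii'; apply; exact: bp_disjoint DA _ _ _ Ax A'x.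
- move=> v ve.
  have Av i : chi H (A i) v = 0.
    have [Di|Di] := boolP (D i); last first.
      rewrite [X in chi H X](_ : _ = set0) ?chi_set0//.
      by apply/seteqP; split=> x // /(bp_empty DA); apply/negP.
    case: (gP i Di) => _ gA gt; apply: gt => [|n]; first by rewrite chi_chi// setIid.
    rewrite chi_adj// gA; have := ve (pickle (i, n)).
    by rewrite /e pickleK_inv/= Di.
  rewrite -(chi_setT Xproper v) [X in chi H X](_ : _ = \bigcup_i A i).
    exact: chi_bigcup0.
  by apply/seteqP; split=> x // _; have [i Aix] := bp_cover DA x; exists i.
- move=> S k; rewrite -(eA k) chi_chi//; last exact: block_borel DA.
  rewrite (block_setI _ _ DA); case: ifP => // _.
  by rewrite chi_set0.
Qed.

End ModuleBasis.

(** In adapted bases both projections retain exactly the coordinates whose block index lies in [S],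
    and [V] preserves coordinates. *)
Lemma module_unitary (R : realType) (X Y : metricType R) (H : xmodule X) (K : xmodule Y)
    (D : nat -> bool) (A : nat -> set X) (B : nat -> set Y) :
  proper_metric X -> proper_metric Y -> ample H -> ample K ->
  borel_partition D A -> borel_partition D B ->
  exists (V : H -> K) (W : K -> H),
    [/\ cancel V W, cancel W V,
        forall v w, inner K (V v) w = inner H v (W w) &
        forall S v, V (chi H (block A S) v) = chi K (block B S) (V v)].
Proof.
move=> Xproper Yproper Hample Kample DA DB.
have [e [eo et eS]] := module_basis Xproper Hample DA.
have [e' [e'o e't e'S]] := module_basis Yproper Kample DB.
have [V [W [VW WV Vadj Vk _]]] := orthosys_unitary eo e'o et e't.
exists V, W; split=> // S v; apply/eqP; rewrite -subr_eq0; apply/eqP/e't => k.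
rewrite innerBl Vk !chi_adj//; [|exact: block_borel DB|exact: block_borel DA].
rewrite eS e'S; case: ifP => _; last by rewrite !inner0r subrr.
by rewrite Vk subrr.
Qed.

(** * Nets and partitions *)

Section Nets.
Context {R : realType} {X : metricType R}.

Lemma compact_net (K : set X) : compact K ->
  exists s : seq X, forall x, K x -> exists2 y, y \in s & mdist y x < 1.
Proof.
move=> /compact_near_coveringP cK.
(* Finite lists directed by inclusion: compactness along this filter yields one list that serves all
   points of [K]. *)
pose F := filter_from [set: seq X] (fun s => [set t : seq X | {subset s <= t}]).
have FF : Filter F.
  apply: filter_from_filter; first by exists [::].
  move=> s t _ _; exists (s ++ t) => // u su; split=> x xs; apply: su;
    by rewrite mem_cat xs ?orbT.
have [|s _ sK] := cK _ F (fun s x => exists2 y, y \in s & mdist y x < 1) FF.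
  move=> x _; exists (ball x 1, [set t : seq X | {subset [:: x] <= t}]).
    by split; [exact: nbhsx_ballx|exists [:: x]].
  move=> [y t] /= [xy xt]; exists x; first by apply: xt; exact: mem_head.
  by move: xy; rewrite ballEmdist.
by exists s => x; exact: (sK s (fun _ h => h)).
Qed.

(** Finite nets of the compact balls of radius [m] around [x0] are enumerated together; numbers that
    code no pair give [x0]. *)
Lemma proper_countable_net (x0 : X) : proper_metric X ->
  exists d : nat -> X, forall x, exists n, mdist (d n) x < 1.
Proof.
move=> Xproper.
have /choice [s sP] m := compact_net (closed_ball_compact Xproper (x0 := x0) (r := m%:R)).
exists (fun n => if unpickle n is Some p then nth x0 (s (p : nat * nat).1) p.2 else x0) => x.
pose m := (Num.truncn (mdist x0 x)).+1.
have [|y ys yx] := sP m x.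
  by have /andP[_ /ltW] := truncn_itv (mdist_ge0 x0 x).
by exists (pickle (m, index y (s m))); rewrite pickleK/= nth_index.
Qed.

Fixpoint greedy (r : R) (d : nat -> X) n : seq nat :=
  if n is m.+1 then
    if all (fun j => r < mdist (d j) (d m)) (greedy r d m)
    then m :: greedy r d m else greedy r d m
  else [::].

(** Greedy selection from a countable 1-net: a rejected point lies within [r] of a retained one,
    hence the covering radius [r + 1]. The indices stay in [nat], and [D] marks the retained
    ones. *)
Lemma separated_net (x0 : X) (r : R) : proper_metric X -> 0 <= r ->
  exists (D : nat -> bool) (y : nat -> X),
    (forall i j, D i -> D j -> i != j -> r < mdist (y i) (y j)) /\
    (forall x, exists2 i, D i & mdist (y i) x <= r + 1).
Proof.
move=> Xproper r0; have [d dd] := proper_countable_net x0 Xproper.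
pose D n := all (fun j => r < mdist (d j) (d n)) (greedy r d n).
have mem n j : (j \in greedy r d n) = (j < n)%N && D j.
  elim: n => [|n IH] /=; first by rewrite in_nil.
  rewrite -/(D n) ltnS leq_eqVlt; have [jn|jn] := eqVneq j n.
    move: IH; rewrite jn ltnn /= => IH; case: ifP => Dn; first by rewrite mem_head.
    by rewrite IH.
  by case: ifP => _; rewrite ?inE ?(negPf jn)/= IH.
exists D, d; split=> [i j Di Dj|x].
  wlog ij : i j Di Dj / (i < j)%N.
    move=> h; rewrite neq_ltn => /orP[ij|ji]; [|rewrite metric_sym]; apply: h => //.
      by rewrite ltn_eqF.
    by rewrite ltn_eqF.
  by move=> _; move/allP: Dj; apply; rewrite mem ij.
have [n nx] := dd x; have [Dn|] := boolP (D n).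
  by exists n => //; apply: ltW; apply: lt_le_trans nx _; rewrite lerDr.
move=> /allPn [j]; rewrite mem -leNgt => /andP[_ Dj] jn; exists j => //.
by rewrite (le_trans (metric_triangle _ (d n) _))// lerD// ltW.
Qed.

(** The unit balls [b i], disjoint by 2-separation, are reserved in advance to keep every cell
    thick. Each remaining point goes to the first closed ball [c i] that contains it. *)
Lemma partition_of_net (D : nat -> bool) (x : nat -> X) (S : R) :
  (forall i j, D i -> D j -> i != j -> 2 < mdist (x i) (x j)) ->
  (forall p, exists2 i, D i & mdist (x i) p <= S) ->
  exists2 A, borel_partition D A &
    exists2 M : R, 0 <= M & forall i p, A i p -> mdist (x i) p <= M.
Proof.
move=> sep net.
pose b i := if D i then [set p | mdist (x i) p < 1] else set0.
pose c i := if D i then [set p | mdist (x i) p <= S] else set0.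
pose A i := b i `|` (c i `\` (\bigcup_(j < i) c j `|` \bigcup_j b j)).
have bb i : borel_set (b i).
  rewrite /b; case: ifP => _; last exact: borel_set0.
  apply: borel_open; apply: (@open_comp _ _ (mdist (x i)) [set t | t < 1]) => [p _|].
    exact: continuous_mdist.
  exact: open_lt.
have bc i : borel_set (c i).
  rewrite /c; case: ifP => _; last exact: borel_set0.
  apply: borel_closed; apply: (@closed_comp _ _ (mdist (x i)) [set t | t <= S]) => [p _|].
    exact: continuous_mdist.
  exact: closed_le.
have bij i j p : b i p -> b j p -> i = j.
  rewrite /b; case: ifP => // Di /= ip; case: ifP => // Dj /= jp.
  apply/eqP; apply: contrapT => /negP /(sep _ _ Di Dj).
  by rewrite ltNge (le_trans (metric_triangle _ p _))// (metric_sym p); lra.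
exists A; first split.
- move=> i; apply: borel_setU => //; apply: borel_setD => //; apply: borel_setU.
    rewrite bigcup_mkcond; apply: borel_bigcup => j.
    by case: ifP => _; [exact: bc|exact: borel_set0].
  exact: borel_bigcup.
- move=> i j p [ip|[ip ni]] [jp|[jp nj]]; first exact: bij ip jp.
  + by case: nj; right; exists i.
  + by case: ni; right; exists j.
  + apply/eqP; rewrite eqn_leq; apply/andP; split; rewrite leqNgt; apply/negP => ij.
      by apply: ni; left; exists j.
    by apply: nj; left; exists i.
- move=> p; have [[i _ ip]|nb] := pselect ((\bigcup_j b j) p); first by exists i; left.
  have ex : exists i, `[< c i p >].
    by have [i Di ip] := net p; exists i; apply/asboolP; rewrite /c Di.
  have [i /asboolP ip imin] := ex_minnP ex.
  exists i; right; split=> // -[[j /= ji jp]|//].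
  by have := imin j; rewrite leqNgt ji => h; have := h (asboolT jp).
- move=> i p; have [//|nDi] := boolP (D i).
  by rewrite /A /b /c (negPf nDi) => -[//|[]].
- by move=> i Di; exists (x i) => y iy; left; rewrite /b Di.
exists (`|S| + 1) => [|i p]; first by rewrite addr_ge0.
rewrite /A /b /c; case: ifP => _ [|[]]//=; last first.
  by move=> pS _; rewrite (le_trans pS)// (le_trans (ler_norm _))// lerDl.
by move=> /ltW p1; rewrite (le_trans p1)// lerDr.
Qed.

End Nets.

Definition controlled {R : realType} {X Y : metricType R} (f : X -> Y) (rho : R -> R) : Prop :=
  (forall s t, 0 <= s -> s <= t -> rho s <= rho t) /\
  forall x y, mdist (f x) (f y) <= rho (mdist x y).

(** If [g (y i)] and [g (y j)] were within 2, then [y i] and [y j] would be within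
    [C1 + rf 2 + C1 < r]. The images still cover [X] coarsely: [f p] is within [r + 1] of some
    [y i], and [g (f p)] within [C2] of [p]. The final constant adds up the displacement bounds for
    [f] and for [g]. *)
Lemma coarse_partitions (R : realType) (X Y : metricType R) (x0 : X) :
  proper_metric X -> proper_metric Y -> coarsely_equivalent X Y ->
  exists D A B (f : X -> Y) (g : Y -> X) rho_f rho_g (C : R),
    [/\ borel_partition D A, borel_partition D B,
        controlled f rho_f /\ controlled g rho_g,
        forall i a b, A i a -> B i b -> mdist (f a) b <= C &
        forall i a b, A i a -> B i b -> mdist (g b) a <= C].
Proof.
move=> Xproper Yproper [f [g [[_ [rf [rf0 rfm fr]]] [_ [rg [rg0 rgm gr]]] [C1 fg] [C2 gf]]]].
have C10 : 0 <= C1 by exact: le_trans (mdist_ge0 _ _) (fg (f x0)).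
have C20 : 0 <= C2 by exact: le_trans (mdist_ge0 _ _) (gf x0).
(* The choice of [r] makes the points [g (y i)] 2-separated. *)
pose r := 2 * C1 + rf 2 + 2.
have r2 : 2 <= r by have := rf0 2 (ler0n _ _); rewrite /r; lra.
have r0 : 0 <= r by lra.
have [D [y [ysep ynet]]] := separated_net (f x0) Yproper r0.
have [||B DB [MB MB0 BM]] := @partition_of_net _ _ D y (r + 1).
- by move=> i j Di Dj ij; exact: le_lt_trans (ysep i j Di Dj ij).
- exact: ynet.
have [||A DA [MA MA0 AM]] := @partition_of_net _ _ D (g \o y) (rg (r + 1) + C2).
- move=> i j Di Dj /(ysep i j Di Dj) ij /=; rewrite ltNge; apply/negP => gij.
  have := rfm _ _ (mdist_ge0 (g (y i)) (g (y j))) gij.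
  have := fr (g (y i)) (g (y j)).
  have := metric_triangle (y i) (f (g (y i))) (y j).
  have := metric_triangle (f (g (y i))) (f (g (y j))) (y j).
  have := fg (y i); have := fg (y j) => /=.
  by rewrite (metric_sym (y i) (f _)); move: ij; rewrite /r; lra.
- move=> p; have [i Di ip] := ynet (f p); exists i => //=.
  rewrite (le_trans (metric_triangle _ (g (f p)) _))// lerD//; last exact: gf.
  by rewrite (le_trans (gr _ _))// rgm// mdist_ge0.
exists D, A, B, f, g, rf, rg, (rf MA + C1 + MB + rg MB + MA); split=> //.
- move=> i a b Aa Bb; have Am : mdist (g (y i)) a <= MA := AM i a Aa; have Bm := BM i b Bb.
  have := metric_triangle (f a) (f (g (y i))) b.
  have := metric_triangle (f (g (y i))) (y i) b.
  have := fg (y i) => /=; have := fr (g (y i)) a.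
  have := rfm _ _ (mdist_ge0 _ _) Am; have := rg0 MB MB0.
  by rewrite (metric_sym (f a) (f (g (y i)))); lra.
- move=> i a b Aa Bb; have Am : mdist (g (y i)) a <= MA := AM i a Aa; have Bm := BM i b Bb.
  have := metric_triangle (g b) (g (y i)) a.
  have := gr (y i) b; have := rgm _ _ (mdist_ge0 _ _) Bm; have := rf0 MA MA0.
  by rewrite (metric_sym (g b) (g (y i))); lra.
Qed.

(** * Transport of the quasi-local algebra *)

Section Transfer.
Context {R : realType} {X Y : metricType R} (H : xmodule X) (K : xmodule Y).
Hypotheses (Xproper : proper_metric X) (Yproper : proper_metric Y).
Local Notation toC := (real_complex R).
Variables (V : H -> K) (W : K -> H).
Hypotheses (VW : cancel V W) (WV : cancel W V).
Hypothesis Vadj : forall v w, inner K (V v) w = inner H v (W w).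

Lemma unitary_lin : linear V.
Proof. by move=> a u v; apply: inner_ext => w; rewrite innerDl innerZl !Vadj innerDl innerZl. Qed.

Lemma unitary_nrm v : nrm (V v) = nrm v.
Proof.
apply/eqP; rewrite -(eqrXn2 (n := 2)) ?nrm_ge0//; apply/eqP.
by apply: (@complexI R); rewrite -!inner_nrm Vadj VW.
Qed.

Lemma unitary_inv_adj w v : inner H (W w) v = inner K w (V v).
Proof. by rewrite innerC -Vadj -innerC. Qed.

Lemma unitary_inv_lin : linear W.
Proof.
move=> a u v; apply: inner_ext => w.
by rewrite innerDl innerZl !unitary_inv_adj innerDl innerZl.
Qed.

Lemma unitary_inv_nrm w : nrm (W w) = nrm w.
Proof. by rewrite -unitary_nrm WV. Qed.

Lemma unitary_continuous : continuous V.
Proof. by apply: (lin_bound_continuous unitary_lin ler01) => v; rewrite unitary_nrm mul1r. Qed.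

Lemma unitary_inv_continuous : continuous W.
Proof. by apply: (lin_bound_continuous unitary_inv_lin ler01) => v; rewrite unitary_inv_nrm mul1r. Qed.

Lemma conj_bounded (T : H -> H) : bounded_operator T -> bounded_operator (V \o T \o W).
Proof.
move=> [Tl Tc]; split.
  by move=> a u v /=; rewrite unitary_inv_lin Tl unitary_lin.
move=> w; apply: continuous_comp; first exact: unitary_inv_continuous.
by apply: continuous_comp; [exact: Tc|exact: unitary_continuous].
Qed.

Variables (D : nat -> bool) (A : nat -> set X) (B : nat -> set Y).
Hypotheses (DA : borel_partition D A) (DB : borel_partition D B).
Hypothesis Vchi : forall S v, V (chi H (block A S) v) = chi K (block B S) (V v).
Variables (f : X -> Y) (g : Y -> X) (rho_f rho_g : R -> R) (C : R).
Hypotheses (f_ctrl : controlled f rho_f) (g_ctrl : controlled g rho_g).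
Hypothesis fC : forall i a b, A i a -> B i b -> mdist (f a) b <= C.
Hypothesis gC : forall i a b, A i a -> B i b -> mdist (g b) a <= C.

(** [block B (meets E)] is the saturation of [E] by cells; [block A (meets E)] is its counterpart in
    [X]. *)
Definition meets (E : set Y) : set nat := [set i | B i `&` E !=set0].

Lemma Wchi S w : W (chi K (block B S) w) = chi H (block A S) (W w).
Proof. by rewrite -{1}(WV w) -Vchi VW. Qed.

Lemma block_meets (E : set Y) : block B (meets E) `&` E = E.
Proof.
apply/seteqP; split=> y; first by case.
move=> Ey; split=> //; have [i Biy] := bp_cover DB y.
by exists i => //; exists y.
Qed.

Lemma chi_meets (E : set Y) w : borel_set E ->
  chi K (block B (meets E)) (chi K E w) = chi K E w.
Proof. by move=> bE; rewrite chi_chi ?block_meets//; exact: block_borel DB. Qed.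

Lemma meets_chi (E : set Y) w : borel_set E ->
  chi K E (chi K (block B (meets E)) w) = chi K E w.
Proof. by move=> bE; rewrite chi_chi 1?setIC ?block_meets//; exact: block_borel DB. Qed.

(** Points of two blocks in [X] at distance below [r] would give points of [E] and [F] at distance
    at most [C + rho_f r + C]; the summand 1 makes this a contradiction. *)
Lemma block_dist (E F : set Y) (r : R) : 0 < r ->
  ((2 * C + rho_f r + 1)%:E <= set_dist E F)%E ->
  (r%:E <= set_dist (block A (meets E)) (block A (meets F)))%E.
Proof.
move=> r0 EF; apply/ereal_infP => _ [[a a'] [/= [i [y [Biy Ey]] Aia] [j [z [Bjz Fz]] Aja']] <-] /=.
rewrite lee_fin leNgt; apply/negP => aa'.
have : ((2 * C + rho_f r + 1)%:E <= (mdist y z)%:E)%E.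
  by apply: le_trans EF _; apply: ereal_inf_lbound; exists (y, z).
rewrite lee_fin; have [mono ctrl] := f_ctrl.
have := mono _ _ (mdist_ge0 a a') (ltW aa'); have := ctrl a a'.
have := fC Aia Biy; have := fC Aja' Bjz.
have := metric_triangle y (f a) z; have := metric_triangle (f a) (f a') z.
by rewrite (metric_sym y (f a)); lra.
Qed.

(** Between [chi K E] and [chi K F], the operator [T] may be replaced by its compression [T'] to the
    blocks met by [E] and [F], whose norm is small by quasi-locality of [T]. *)
Lemma conj_quasi_local (T : H -> H) : bounded_operator T ->
  quasi_local H T -> quasi_local K (V \o T \o W).
Proof.
move=> Tb Tq e e0; have [r r0 Tr] := Tq e e0.
(* The maximum with 1 ensures a positive radius, as nothing here fixes the signs of [C] and
   [rho_f r]. *)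
exists (Num.max 1 (2 * C + rho_f r + 1)) => [|E F bE bF EF]; first by rewrite lt_max ltr01.
have bA S := block_borel S DA.
have {}EF : ((2 * C + rho_f r + 1)%:E <= set_dist E F)%E.
  by apply: le_trans EF; rewrite lee_fin le_max lexx orbT.
have := Tr _ _ (bA (meets E)) (bA (meets F)) (block_dist r0 EF).
set T' := chi H _ \o T \o chi H _; apply: le_lt_trans.
have T'b : bounded_operator T'.
  have [Tl Tc] := Tb; split.
    by move=> a u v; rewrite /T'/= (chi_lin Xproper (bA _)) Tl (chi_lin Xproper (bA _)).
  move=> v; apply: continuous_comp; first exact: (chi_bounded H Xproper (bA _)).2.
  by apply: continuous_comp; [exact: Tc|exact: (chi_bounded H Xproper (bA _)).2].
have T'0 : 0 <= op_norm T'.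
  apply: ub_le_sup; last by exists 0 => /=; rewrite ?normr0 ?(lin0 T'b.1) ?normr0.
  have [C' C'0 T'C] := lin_continuous_bound T'b.1 T'b.2.
  exists C' => _ [v /= v1 <-]; rewrite (le_trans (T'C v))// ler_piMr//; first exact: ltW.
  by rewrite -nrm_le1.
have Vl := unitary_lin; have Wl := unitary_inv_lin.
apply: op_norm_le => //.
  move=> a u v /=; rewrite (chi_lin Yproper bF) Wl Tb.1 Vl.
  by rewrite (chi_lin Yproper bE).
move=> w /=; have -> : chi K E (V (T (W (chi K F w)))) = chi K E (V (T' (W (chi K F w)))).
  rewrite -[chi K F w in LHS]chi_meets// Wchi -[LHS]meets_chi//.
  by rewrite -Vchi.
rewrite (le_trans (chi_le _ _ _))// unitary_nrm (le_trans (op_norm_ge _ T'b))//.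
by rewrite unitary_inv_nrm ler_wpM2l// chi_le.
Qed.

(** The cells of [X] that correspond to a ball around [y0] lie within [rho_g r + C] of [g y0], where
    a cutoff can be 1. *)
Lemma block_cutoff (y0 : Y) (r : R) : exists2 u : X -> R[i], C0 u &
  forall x, block A (meets [set y | mdist y0 y <= r]) x -> u x = 1.
Proof.
have [c [c0 c01 c1 _]] := cutoff Xproper (g y0) (rho_g r + C).
exists (fun x => toC (c x)); first exact: C0_toC.
move=> x [i [y [Biy /= yr]] Aix]; rewrite c1//.
have [mono ctrl] := g_ctrl.
rewrite (le_trans (metric_triangle _ (g y) _))// lerD//; last exact: gC Aix Biy.
by rewrite (le_trans (ctrl _ _))// mono// mdist_ge0.
Qed.

(** [h] is a uniform limit of functions [q] supported in balls [E]. With [k = 1] on the blocks met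
    by [E], the product of [q] with the conjugated operator factors through [rep H k \o T], or
    through [T \o rep H k] on the other side, and totally bounded operators are closed under norm
    limits. *)
Lemma conj_locally_compact (y0 : Y) (T : H -> H) : bounded_operator T ->
  locally_compact_operator H T -> locally_compact_operator K (V \o T \o W).
Proof.
move=> Tb Tlc h h0; have Tb' := conj_bounded Tb.
have [Tl Tc] := Tb; have [T'l T'c] := Tb'.
have hl := rho_lin (rep_star K) h0; have hc := rho_continuous (rep_star K) h0.
have Vl := unitary_lin; have Wl := unitary_inv_lin.
have Vc := unitary_continuous; have Wc := unitary_inv_continuous.
have [M M0 TM] := lin_continuous_bound Tl Tc.
have approx (e : R) : 0 < e -> exists q E k, [/\ C0 q, borel_set E, C0 k &
    [/\ forall y, ~ E y -> q y = 0, forall y, nrm (h y - q y) <= e &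
        forall x, block A (meets E) x -> k x = 1]].
  move=> e0; have /C0_nrmP [_ [_ hK]] := h0; have [L cL Lh] := hK e e0.
  have [r Lr] := compact_radius y0 cL.
  have [c [c0 c01 c1 cE]] := cutoff Yproper y0 r.
  pose E := [set y | mdist y0 y <= r + 1].
  have [k k0 k1] := block_cutoff y0 (r + 1).
  exists (fun y => h y * toC (c y)), E, k; split=> //.
  - by apply: C0M => //; exact: C0_toC.
  - apply: borel_closed; apply: metric_compact_closed.
    exact: closed_ball_compact.
  split=> // y => [nE|].
    by rewrite cE ?mulr0// ltNge; apply/negP.
  have /andP[cy0 cy1] := c01 y.
  have -> : h y - h y * toC (c y) = h y * toC (1 - c y).
    by rewrite rmorphB/= mulrBr mulr1.
  rewrite nrmM nrm_toC ger0_norm ?subr_ge0//.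
  have [Ly|/Lh] := pselect (L y); first by rewrite c1 ?subrr ?mulr0 ?(ltW e0)//; exact: Lr.
  rewrite ger0_norm ?nrm_ge0// => /ltW he; rewrite -[leRHS]mulr1 ler_pM ?nrm_ge0 ?subr_ge0//.
  by rewrite gerBl.
have key q E k : C0 q -> borel_set E -> C0 k -> (forall y, ~ E y -> q y = 0) ->
    (forall x, block A (meets E) x -> k x = 1) ->
    tb_op (rep K q \o (V \o T \o W)) /\ tb_op ((V \o T \o W) \o rep K q).
  move=> q0 bE k0 qE k1.
  have bA : borel_set (block A (meets E)) by exact: block_borel DA.
  have [kT Tk] := Tlc k k0.
  have kl := rho_lin (rep_star H) k0.
  have ql := rho_lin (rep_star K) q0; have qc := rho_continuous (rep_star K) q0.
  have [chil chic] := chi_bounded H Xproper bA.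
  have [chiEl chiEc] := chi_bounded K Yproper bE.
  split.
    have -> : rep K q \o (V \o T \o W) =
        (rep K q \o chi K E \o V \o chi H (block A (meets E))) \o ((rep H k \o T) \o W).
      apply/funext => w /=; rewrite chi_rep_supp// Vchi meets_chi//.
      by rewrite rep_chi_supp.
    apply: tb_op_compl.
    - apply: tb_op_compr => //; first by case: (compact_operatorP (rep H k \o T)).1.
      by case: kT => -[].
    - by move=> a u v /=; rewrite chil Vl chiEl ql.
    - move=> v; apply: continuous_comp; first exact: chic.
      apply: continuous_comp; first exact: Vc.
      by apply: continuous_comp; [exact: chiEc|exact: qc].
  have -> : (V \o T \o W) \o rep K q =
      V \o ((T \o rep H k) \o (chi H (block A (meets E)) \o W \o rep K q)).
    apply/funext => w /=; rewrite rep_chi// -Wchi.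
    by rewrite -(chi_rep Yproper w bE q0 qE) chi_meets.
  apply: tb_op_compl => //; apply: tb_op_compr.
  - by case: (compact_operatorP (T \o rep H k)).1.
  - by case: Tk => -[].
  - by move=> a u v /=; rewrite ql Wl chil.
  - move=> v; apply: continuous_comp; first exact: qc.
    by apply: continuous_comp; [exact: Wc|exact: chic].
have near_h q v e : C0 q -> 0 <= e -> (forall y, nrm (h y - q y) <= e) ->
    nrm (rep K h v - rep K q v) <= e * nrm v.
  move=> q0 e0 hq; rewrite -(rhoB (rep_star K))//.
  by apply: (rho_contractive (rep_star K)) => //; exact: C0B.
have T'M w : nrm (V (T (W w))) <= M * nrm w.
  by rewrite unitary_nrm (le_trans (TM _))// unitary_inv_nrm.
split; apply/compact_operatorP; split.
- split; first by move=> a u v /=; rewrite Wl Tl Vl hl.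
  by move=> v; apply: continuous_comp; [exact: T'c|exact: hc].
(* The error in [h] gets multiplied by the bound [M] of the conjugated operator. *)
- apply: tb_op_approx => e e0; have eM : 0 < e / M by rewrite divr_gt0.
  have [q [E [k [q0 bE k0 [qE hq k1]]]]] := approx _ eM.
  exists (rep K q \o (V \o T \o W)); first by case: (key q E k q0 bE k0 qE k1).
  move=> v v1 /=; rewrite (le_trans (near_h _ _ _ q0 (ltW eM) hq))//.
  rewrite -mulrA ler_piMr ?(ltW e0)// ler_pdivrMl// mulr1 (le_trans (T'M v))//.
  by rewrite ler_piMr// ltW.
- split; first by move=> a u v /=; rewrite hl Wl Tl Vl.
  by move=> v; apply: continuous_comp; [exact: hc|exact: T'c].
- apply: tb_op_approx => e e0; have eM : 0 < e / M by rewrite divr_gt0.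
  have [q [E [k [q0 bE k0 [qE hq k1]]]]] := approx _ eM.
  exists ((V \o T \o W) \o rep K q); first by case: (key q E k q0 bE k0 qE k1).
  move=> v v1 /=; rewrite -(linB T'l) /= (le_trans (T'M _))//.
  rewrite mulrC -ler_pdivlMr// (le_trans (near_h _ _ _ q0 (ltW eM) hq))//.
  by rewrite ler_piMr// ltW.
Qed.

End Transfer.

(** Over an empty space every [rep H h] vanishes, so non-degeneracy would make the
    infinite-dimensional module zero. The point serves as a centre for nets and cutoffs. *)
Lemma mod_space_point (R : realType) (X : metricType R) (H : xmodule X) : exists x : X, True.
Proof.
apply: contrapT => noX; have X0 (x : X) : False by apply: noX; exists x.
apply: (@mod_infinite _ _ H 0%N (fun=> 0)); apply/seteqP; split=> // v _.
exists 0%N, (fun=> 0), (fun=> 0); split; first by case.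
rewrite big_ord0; apply: le_eps_nrm0 => e e0.
have /dense_nrmP /(_ v e e0) [a [n [c [u [uP ->]]]]] := @rep_nondegenerate _ _ H.
rewrite big1 ?sub0r ?nrmN; first exact: ltW.
move=> i _; have [h h0 [w ->]] := uP i.
have -> : h = (fun x => 0 * h x) by apply/funext => x; case: (X0 x).
by rewrite (rhoZ (rep_star H))// scale0r scaler0.
Qed.

Lemma coarse_star_isomorphic (R : realType) (X Y : metricType R)
    (H : xmodule X) (K : xmodule Y) :
  proper_metric X -> proper_metric Y -> ample H -> ample K ->
  coarsely_equivalent X Y ->
  star_isomorphic (quasi_local_algebra H) (quasi_local_algebra K).
Proof.
move=> Xproper Yproper Hample Kample XY.
have [x0 _] := mod_space_point H; have [y0 _] := mod_space_point K.
have [D [A [B [f [g [rf [rg [C [DA DB [f_ctrl g_ctrl] fC gC]]]]]]]]] :=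
  coarse_partitions x0 Xproper Yproper XY.
have [V [W [VW WV Vadj Vchi]]] := module_unitary Xproper Yproper Hample Kample DA DB.
have Vl := unitary_lin Vadj.
have Wadj w v : inner H (W w) v = inner K w (V v) by exact: unitary_inv_adj Vadj w v.
have Wchi S w : W (chi K (block B S) w) = chi H (block A S) (W w).
  by rewrite -{1}(WV w) -Vchi VW.
exists (fun T => V \o T \o W); split.
- split.
  + move=> T [Tb Tlc Tq]; split.
    * exact: (conj_bounded VW WV Vadj).
    * exact: (conj_locally_compact Xproper Yproper VW WV Vadj DA DB Vchi g_ctrl gC y0 Tb Tlc).
    * exact: (conj_quasi_local Xproper Yproper VW WV Vadj DA DB Vchi f_ctrl fC Tb Tq).
  + move=> S T _ _ /funeqP ST; apply/funext => v; apply: (can_inj VW).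
    by have := ST (V v); rewrite /= VW.
  (* The hypotheses are symmetric: surjectivity follows from the same transport lemmas with [V] and
     [W], [A] and [B], [f] and [g] exchanged. *)
  + move=> T [Tb Tlc Tq]; exists (W \o T \o V); last first.
      by apply/funext => w /=; rewrite !WV.
    have fC' i b a : B i b -> A i a -> mdist (g b) a <= C by move=> Bb Aa; exact: gC Aa Bb.
    have gC' i b a : B i b -> A i a -> mdist (f a) b <= C by move=> Bb Aa; exact: fC Aa Bb.
    split.
    * exact: (conj_bounded WV VW Wadj).
    * exact: (conj_locally_compact Yproper Xproper WV VW Wadj DB DA Wchi f_ctrl gC' x0 Tb Tlc).
    * exact: (conj_quasi_local Yproper Xproper WV VW Wadj DB DA Wchi g_ctrl fC' Tb Tq).
- by move=> S T _ _; apply/funext => w /=; rewrite (linD Vl).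
- by move=> c T _; apply/funext => w /=; rewrite (linZ Vl).
- by move=> S T _ _; apply/funext => w /=; rewrite VW.
- by move=> T S _ TS v w /=; rewrite Vadj TS Wadj.
Qed.

Lemma coarsely_equivalent_refl (R : realType) (X : metricType R) : coarsely_equivalent X X.
Proof.
have id_coarse : coarse_map (idfun : X -> X).
  by split=> //; exists id; split.
exists idfun, idfun; split=> //; exists 0 => x; by rewrite /= mdistxx.
Qed.

Theorem corollary2p10 (R : realType) :
  (forall (X Y : metricType R) (HX : xmodule X) (HY : xmodule Y),
     proper_metric X -> proper_metric Y -> ample HX -> ample HY ->
     coarsely_equivalent X Y ->
     star_isomorphic (quasi_local_algebra HX) (quasi_local_algebra HY)) /\
  (forall (X : metricType R) (H H' : xmodule X),
     proper_metric X -> ample H -> ample H' ->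
     star_isomorphic (quasi_local_algebra H) (quasi_local_algebra H')).
Proof.
split=> [X Y HX HY|X H H' Xproper Hample H'ample]; first exact: coarse_star_isomorphic.
by apply: coarse_star_isomorphic => //; exact: coarsely_equivalent_refl.
Qed.
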